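(* Let $(X,Y)$ be any pair of jointly distributed random variables, each taking values in a measurable space, and let $0<\epsilon<1$. If $I(X;Y)<\infty$, then \[ L_{\epsilon}^{*}(X;Y)\ge I(X;Y)-3\log\bigl(I(X;Y)+1\bigr)-2\log\frac{1}{\epsilon}-15 \] and \[ L_{\epsilon}^{*}(X;Y)\le(1-\epsilon)^{-1}\bigl(I(X;Y)+\log 3+1\bigr). \] If $I(X;Y)=\infty$, then $L_{\epsilon}^{*}(X;Y)=\infty$.
   Context: All logarithms are base 2 and entropies/mutual informations are in bits; $I(X;Y)$ is the mutual information for general (not necessarily discrete) random variables. For integers $a\le b$, $[a:b]=\{a,a+1,\dots,b\}$. $d_{\mathrm{TV}}$ denotes total variation distance. One-shot variable-length secret key agreement model: Alice observes $X$, Bob observes $Y$; each may additionally use private randomness independent of everything else. They exchange public messages $W_1,W_2,\dots,W_N$, each a finite-valued random variable: odd-indexed messages are produced by Alice as a stochastic function of $X$ and the previous messages, even-indexed ones by Bob as a stochastic function of $Y$ and the previous messages; the number of rounds $N\in\mathbb{Z}_{\ge0}$ may be random (determined by the discussion), and $W^N=(W_1,\dots,W_N)$ is observed by an eavesdropper. Afterwards they agree on a key length $L\in\mathbb{Z}_{\ge0}$, which is a deterministic function of Alice's information $(X,W^N)$ and also a deterministic function of Bob's information $(Y,W^N)$. Alice outputs $A\in[1:2^L]$ and Bob outputs $B\in[1:2^L]$. The distance from the ideal distribution of such a scheme is \[ \sup_{l}\, d_{\mathrm{TV}}\Bigl(p_{A,B,W^N\mid L=l},\ \mathrm{U}_2[1:2^l]\times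 p_{W^N\mid L=l}\Bigr), \] where the supremum is over $l\in\mathbb{Z}_{\ge0}$ with $\mathbb{P}(L=l)>0$, and $\mathrm{U}_2[1:2^l]$ is the uniform distribution on $\{(a,a):a\in[1:2^l]\}$. $L^*_\epsilon(X;Y)$ denotes the supremum of $\mathbb{E}[L]$ over all such schemes whose distance from the ideal distribution is at most $\epsilon$. *)

(* Defs.v *)
From HB Require Import structures.
From mathcomp Require Import all_boot all_order all_algebra.
From mathcomp Require Import all_classical all_reals all_analysis.
Set Implicit Arguments.
Unset Strict Implicit.
Unset Printing Implicit Defensive.
Import Order.TTheory GRing.Theory Num.Theory.
Local Open Scope classical_set_scope.
Local Open Scope ring_scope.

Definition log2 {R : realType} (x : R) : R := ln x / ln 2.

(* Mutual information of a joint law P on T1 * T2 (general random     *)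
(* variables), defined as the supremum over finite measurable         *)
(* partitions of the two observation spaces of the discrete mutual    *)
(* information of the quantized pair (Dobrushin / Gelfand-Yaglom-     *)
(* Perez definition; equals D(P_XY || P_X x P_Y)).                    *)

Definition finite_mpartition {d} {T : measurableType d} (A : nat -> set T) (n : nat) : Prop :=
  (forall i, (i < n)%N -> measurable (A i)) /\
  (forall i j, (i < n)%N -> (j < n)%N -> i <> j -> A i `&` A j = set0) /\
  (\bigcup_(i in [set k | (k < n)%N]) A i = setT).

Section MI.
Context {R : realType} {d1 d2 : measure_display}
        {T1 : measurableType d1} {T2 : measurableType d2}.

Definition mi_term (p q1 q2 : R) : R :=
  if p == 0 then 0 else p * log2 (p / (q1 * q2)).

Definition quantized_mi (P : probability (T1 * T2)%type R)
    (A : nat -> set T1) (n : nat) (B : nat -> set T2) (m : nat) : R :=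
  \sum_(i < n) \sum_(j < m)
     mi_term (fine (P (A i `*` B j))) (fine (P (A i `*` setT)))
             (fine (P (setT `*` B j))).

Definition mutual_info (P : probability (T1 * T2)%type R) : \bar R :=
  ereal_sup [set e | exists (A : nat -> set T1) (n : nat) (B : nat -> set T2) (m : nat),
     [/\ finite_mpartition A n, finite_mpartition B m & e = (quantized_mi P A n B m)%:E]].
End MI.

(* One-shot variable-length secret key agreement schemes.             *)
(* Public messages are natural numbers; a public transcript is a      *)
(* seq nat.  Alice's private randomness is u : Oa (distributed Qa),   *)
(* Bob's is v : Ob (distributed Qb), independent of each other and of *)
(* (X,Y) ~ P.  Message W_{k+1} is sent by Alice if k is even (i.e.    *)
(* W_1, W_3, ...) and by Bob otherwise; it is a deterministic         *)
(* function of the speaker's observation, private randomness and the  *)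
(* previous messages.  The discussion stops (N = size of transcript)  *)
(* at the first transcript w with stop w = true.                      *)

Record skaScheme (T1 T2 Oa Ob : Type) := SkaScheme {
  sk_stop : seq nat -> bool;
  sk_msgA : seq nat -> T1 -> Oa -> nat;
  sk_msgB : seq nat -> T2 -> Ob -> nat;
  sk_lenA : T1 -> seq nat -> nat;
  sk_lenB : T2 -> seq nat -> nat;
  sk_keyA : T1 -> Oa -> seq nat -> nat;
  sk_keyB : T2 -> Ob -> seq nat -> nat }.

Section Scheme.
Context {R : realType} {d1 d2 da db : measure_display}
        {T1 : measurableType d1} {T2 : measurableType d2}
        {Oa : measurableType da} {Ob : measurableType db}.
Variable S : skaScheme T1 T2 Oa Ob.

Fixpoint sk_trans (k : nat) (x : T1) (y : T2) (u : Oa) (v : Ob) : seq nat :=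
  match k with
  | 0 => [::]
  | k'.+1 => let h := sk_trans k' x y u v in
             if sk_stop S h then h
             else rcons h (if odd (size h) then sk_msgB S h y v else sk_msgA S h x u)
  end.

Definition sk_term (w : seq nat) x y u v : Prop :=
  sk_stop S w /\ sk_trans (size w) x y u v = w.

Definition sk_valid (P : probability (T1 * T2)%type R)
    (Qa : probability Oa R) (Qb : probability Ob R) : Prop :=
      (forall h m, measurable [set xu : T1 * Oa | sk_msgA S h xu.1 xu.2 = m]) /\
      (forall h m, measurable [set yv : T2 * Ob | sk_msgB S h yv.1 yv.2 = m]) /\
      (forall w l, measurable [set x : T1 | sk_lenA S x w = l]) /\
      (forall w l, measurable [set y : T2 | sk_lenB S y w = l]) /\
      (forall w a, measurable [set xu : T1 * Oa | sk_keyA S xu.1 xu.2 w = a]) /\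
      (forall w b, measurable [set yv : T2 * Ob | sk_keyB S yv.1 yv.2 w = b]) /\
      (forall x y u v, exists k, sk_stop S (sk_trans k x y u v)) /\
      (forall k, exists M, forall x y u v,
          size (sk_trans k.+1 x y u v) = k.+1 -> (nth 0 (sk_trans k.+1 x y u v) k < M)%N) /\
      (forall x u w, (1 <= sk_keyA S x u w <= 2 ^ sk_lenA S x w)%N) /\
      (forall y v w, (1 <= sk_keyB S y v w <= 2 ^ sk_lenB S y w)%N).

Section Prob.
Variables (P : probability (T1 * T2)%type R) (Qa : probability Oa R) (Qb : probability Ob R).

Definition sk_pr (E : T1 -> T2 -> Oa -> Ob -> Prop) : R :=
  fine (\int[P]_xy \int[Qa]_u \int[Qb]_v (\1_[set v' | E xy.1 xy.2 u v'] v)%:E).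

(* the key length is a function of both parties' information: L_A = L_B a.s. *)
Definition sk_len_agree : Prop :=
  sk_pr (fun x y u v => exists w, sk_term w x y u v /\ sk_lenA S x w <> sk_lenB S y w) = 0.

Definition sk_pL (l : nat) : R :=
  sk_pr (fun x y u v => exists w, sk_term w x y u v /\ sk_lenA S x w = l).

Definition sk_pABWL (a b : nat) (w : seq nat) (l : nat) : R :=
  sk_pr (fun x y u v => [/\ sk_term w x y u v, sk_keyA S x u w = a,
                            sk_keyB S y v w = b & sk_lenA S x w = l]).

Definition sk_pWL (w : seq nat) (l : nat) : R :=
  sk_pr (fun x y u v => sk_term w x y u v /\ sk_lenA S x w = l).

(* d_TV( p_{A,B,W^N | L=l}, U_2[1:2^l] x p_{W^N | L=l} ) *)
Definition sk_dist_l (l : nat) : \bar R :=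
  (2^-1)%:E * \esum_(o in [set: (nat * nat * seq nat)%type])
     (`| sk_pABWL o.1.1 o.1.2 o.2 l / sk_pL l
         - (if (o.1.1 == o.1.2) && (1 <= o.1.1 <= 2 ^ l)%N
            then (2 ^ l)%:R^-1 * (sk_pWL o.2 l / sk_pL l) else 0) |)%:E.

Definition sk_dist_le (eps : R) : Prop :=
  forall l : nat, 0 < sk_pL l -> (sk_dist_l l <= eps%:E)%E.

Definition sk_EL : \bar R := \esum_(l in [set: nat]) (l%:R * sk_pL l)%:E.
End Prob.
End Scheme.

Definition Lstar {R : realType} {d1 d2 : measure_display}
    {T1 : measurableType d1} {T2 : measurableType d2}
    (P : probability (T1 * T2)%type R) (eps : R) : \bar R :=
  ereal_sup [set e | exists (da db : measure_display) (Oa : measurableType da)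
     (Ob : measurableType db) (Qa : probability Oa R) (Qb : probability Ob R)
     (S : skaScheme T1 T2 Oa Ob),
     [/\ sk_valid S P Qa Qb, sk_len_agree S P Qa Qb, sk_dist_le S P Qa Qb eps
       & e = sk_EL S P Qa Qb]].

(* Main.v *)
(* Upper bound.  For a fixed transcript the event that it occurs is a product
   of an event on Alice's side and one on Bob's side.  So the joint law of
   (transcript, length, key) under [P], compared with the one under the product
   of the marginals, is controlled by a data-processing inequality for mutual
   information, obtained by discretising [0, 1]-valued test functions.  Testing
   with the weight [2 ^ l] on agreeing keys of length [l], corrected by the
   conditional law of Alice's key, gives [(1 - eps) E[L] <= I + 2].

   Lower bound.  It suffices to treat finite quantisations of [(X, Y)].  Alice's
   cells are split at random into pieces [x] of probability at most [2 ^- T] and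
   hashed to [H x] below [2 ^ T].  For [v] decreasing from [T] she announces the
   prefix [H x %/ 2 ^ v], and Bob stops her at the first [v] for which his list of
   likely pieces contains one with this prefix; about [v] bits of [x] are then
   still secret, and [E[v]] is close to [I].  Given the stopping level and the
   prefix, the possible pieces are grouped by their probability up to a factor
   [1 + eps], and each group is cut into aligned dyadic blocks; the position
   inside the block is the key. *)

(* The number [T] of levels grows with the quantisation and is unrelated to I, so no error of the
   lower bound may depend on it. This is the role of [th = 1 - 1/N] with [N = q + 1], [q] the
   quantised information: error budgets at level [v] carry a factor [th ^+ v], so they sum to at
   most N, or N^2 when weighted by v, whatever [T] is. The price, [- log2 th] per level, is O(1)
   over the N - 1 levels that matter. The three logarithms of I + 1 arise here: one from the block
   sizes, two from the lists. The two logarithms of 1/eps come from the list threshold and from the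
   geometric sum over probability classes. The distance budget is split evenly: eps/2 for decoding
   errors, eps/2 for non-uniformity inside blocks. In the upper bound the raw weight 2^l is not
   admissible: if Alice's key is concentrated, its mean under the product law can far exceed 1.
   Dividing by the excess of her conditional key law over the uniform one repairs this and costs one
   bit; normalising the test function by 1/2 costs the other. *)
Require Import Defs.
From HB Require Import structures.
From mathcomp Require Import all_boot all_order all_algebra.
From mathcomp Require Import all_classical all_reals all_analysis.
From mathcomp Require Import measurable_realfun.
From mathcomp Require Import ring lra zify.
Import Order.TTheory GRing.Theory Num.Theory.
Import numFieldNormedType.Exports.
Set Implicit Arguments.
Unset Strict Implicit.
Unset Printing Implicit Defensive.
Local Open Scope classical_set_scope.
Local Open Scope ring_scope.

(** * Finite quantisations *)

Section LnBounds.
Context {R : realType}.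
Implicit Types x y : R.

Lemma ln_leB1 x : 0 < x -> ln x <= x - 1.
Proof.
move=> x0; have := @le_ln1Dx R (x - 1).
by rewrite addrCA subrr addr0; apply; lra.
Qed.

Lemma ln2_gt0 : 0 < ln 2 :> R.
Proof. by rewrite ln_gt0// ltr1n. Qed.

Lemma ln2_ge : 2^-1 <= ln 2 :> R.
Proof.
have /ln_leB1 : (0 : R) < 2^-1 by rewrite invr_gt0.
by rewrite lnV ?posrE// => h; lra.
Qed.

Lemma ln_log2 x : ln x = log2 x * ln 2.
Proof. by rewrite /log2 divfK// gt_eqF// ln2_gt0. Qed.

(** Apply ln x <= x - 1 at x = g q / p. Summed over cells this is the Donsker-Varadhan bound in
    linear form; the last hypothesis is absolute continuity. *)
Lemma gibbs_le p q g : 0 <= p -> 0 <= q -> 0 < g -> (q = 0 -> p = 0) ->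
  p * ln g <= (if p == 0 then 0 : R else p * ln (p / q)) + q * g - p.
Proof.
move=> p0 q0 g0 qp; case: eqVneq => [->|pn0].
  by rewrite mul0r add0r subr0 mulr_ge0// ltW.
have {}p0 : 0 < p by rewrite lt0r pn0.
have {}q0 : 0 < q by rewrite lt0r q0 andbT; apply/eqP => /qp/eqP; rewrite (negbTE pn0).
have /ln_leB1 : 0 < g * (q / p) by rewrite mulr_gt0// divr_gt0.
rewrite lnM ?posrE ?divr_gt0// -[q / p]invf_div lnV ?posrE ?divr_gt0// => h.
have : p * (ln g - ln (p / q)) <= p * (g / (p / q) - 1) by rewrite ler_wpM2l// ltW.
have -> : p * (g / (p / q) - 1) = q * g - p.
  by field; rewrite !gt_eqF.
by lra.
Qed.
End LnBounds.

Section Cells.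
Context {R : realType} {d1 d2 : measure_display}
  {T1 : measurableType d1} {T2 : measurableType d2}.
Variables (P : probability (T1 * T2)%type R).

Definition fiber {T I : Type} (r : T -> I) (i : I) : set T := [set x | r x = i].

Definition mfibers {d} {T : measurableType d} {I : Type} (r : T -> I) :=
  forall i, measurable (fiber r i).

Lemma fiber_partition {d} {T : measurableType d} n (r : T -> 'I_n) :
  mfibers r -> finite_mpartition (fiber (fun x => r x : nat)) n.
Proof.
move=> mr; split.
  move=> i ltin; rewrite (_ : fiber _ _ = fiber r (Ordinal ltin)); first exact: mr.
  by apply/seteqP; split => x; rewrite /fiber/=; [move=> h; exact: val_inj|by move=> ->].
split.
  move=> i j _ _ ij; apply/seteqP; split => x //= -[]; rewrite /fiber/= => e1 e2.
  by case: ij; rewrite -e1 -e2.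
by apply/seteqP; split => x //= _; exists (r x) => //=.
Qed.

Variables (n m : nat) (r : T1 -> 'I_n) (s : T2 -> 'I_m).
Hypotheses (mr : mfibers r) (ms : mfibers s).

Lemma measurable_fiberX i j : measurable (fiber r i `*` fiber s j).
Proof. exact: (measurableX (mr i) (ms j)). Qed.

Definition cell_pr i j : R := fine (P (fiber r i `*` fiber s j)).

Lemma cell_pr_ge0 i j : 0 <= cell_pr i j.
Proof. exact: fine_ge0. Qed.

Lemma cell_prE i j : P (fiber r i `*` fiber s j) = (cell_pr i j)%:E.
Proof. by rewrite fineK// fin_num_measure//; exact: measurable_fiberX. Qed.

Lemma cell_split (g : 'I_n -> 'I_m -> R) z :
  (g (r z.1) (s z.2))%:E =
  (\sum_(i < n) \sum_(j < m) (g i j)%:E * (\1_(fiber r i `*` fiber s j) z)%:E)%E.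
Proof.
rewrite (bigD1 (r z.1))//= (bigD1 (s z.2))//= !indicE mem_set ?mule1; last by split.
rewrite [X in (_ + X + _)%E]big1 ?adde0; last first.
  move=> j jz; rewrite indicE memNset ?mule0// => -[_]; rewrite /fiber/= => e.
  by rewrite e eqxx in jz.
rewrite big1 ?adde0// => i iz; rewrite big1// => j _.
by rewrite indicE memNset ?mule0// => -[+ _]; rewrite /fiber/= => e; rewrite e eqxx in iz.
Qed.

Lemma cell_integral (g : 'I_n -> 'I_m -> R) : (forall i j, 0 <= g i j) ->
  (\int[P]_z (g (r z.1) (s z.2))%:E = (\sum_i \sum_j g i j * cell_pr i j)%:E)%E.
Proof.
move=> g0; under eq_integral do rewrite cell_split.
have mI i j : measurable_fun setT (fun z => (\1_(fiber r i `*` fiber s j) z : R)%:E).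
  by apply/measurable_EFinP; exact: measurable_indic (measurable_fiberX _ _).
have mgI i j : measurable_fun setT
    (fun z => (g i j)%:E * (\1_(fiber r i `*` fiber s j) z : R)%:E)%E.
  exact: emeasurable_funM.
rewrite ge0_integral_sum//; last 2 first.
- by move=> i; exact: emeasurable_sum.
- by move=> i z _; apply: sume_ge0 => j _; rewrite mule_ge0// lee_fin.
rewrite -sumEFin; apply: eq_bigr => i _.
rewrite ge0_integral_sum//; last by move=> j z _; rewrite mule_ge0// lee_fin.
rewrite -sumEFin; apply: eq_bigr => j _.
rewrite ge0_integralZl_EFin//.
rewrite integral_indic//; last exact: measurable_fiberX.
by rewrite setIT EFinM; congr (_ * _)%E; exact: cell_prE.
Qed.

Lemma measurable_cell (g : 'I_n -> 'I_m -> R) :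
  measurable_fun setT (fun z => g (r z.1) (s z.2)).
Proof.
apply/measurable_EFinP; rewrite /comp; under eq_fun do rewrite cell_split.
apply: emeasurable_sum => i; apply: emeasurable_sum => j.
apply: emeasurable_funM => //; apply/measurable_EFinP.
exact: measurable_indic (measurable_fiberX _ _).
Qed.

Lemma cell_pr_sum1 : \sum_i \sum_j cell_pr i j = 1.
Proof.
have := @cell_integral (fun _ _ => 1) (fun _ _ => ler01).
rewrite [LHS]integral_cst// mul1e [X in X = _]probability_setT => -[->].
by apply: eq_bigr => i _; apply: eq_bigr => j _; rewrite mul1r.
Qed.

Definition rowpr i : R := \sum_j cell_pr i j.
Definition colpr j : R := \sum_i cell_pr i j.

Lemma rowprE i : fine (P (fiber r i `*` setT)) = rowpr i.
Proof.
have := @cell_integral (fun i' _ => (i' == i)%:R) (fun _ _ => ler0n _ _).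
rewrite (_ : (fun z => _) = (fun z => (\1_(fiber r i `*` setT) z)%:E)); last first.
  apply/funext => z; congr (_%:E); rewrite indicE; case: eqP => e; last first.
    by rewrite memNset// => -[/=].
  by rewrite mem_set.
rewrite integral_indic//; last by apply: measurableX => //; exact: mr.
rewrite setIT => ->/=; rewrite (bigD1 i)//= [X in _ + X]big1 ?addr0.
  by rewrite /rowpr; apply: eq_bigr => j _; rewrite eqxx mul1r.
by move=> k /negbTE ki; rewrite big1// => j _; rewrite ki mul0r.
Qed.

Lemma colprE j : fine (P (setT `*` fiber s j)) = colpr j.
Proof.
have := @cell_integral (fun _ j' => (j' == j)%:R) (fun _ _ => ler0n _ _).
rewrite (_ : (fun z => _) = (fun z => (\1_(setT `*` fiber s j) z)%:E)); last first.
  apply/funext => z; congr (_%:E); rewrite indicE; case: eqP => e; last first.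
    by rewrite memNset// => -[/=].
  by rewrite mem_set.
rewrite integral_indic//; last by apply: measurableX => //; exact: ms.
rewrite setIT => ->/=; rewrite /colpr; apply: eq_bigr => i _.
rewrite (bigD1 j)//= [X in _ + X]big1 ?addr0 ?eqxx ?mul1r//.
by move=> k /negbTE kj; rewrite kj mul0r.
Qed.

Definition qmi : R := quantized_mi P (fiber (fun x => r x : nat)) n
                                     (fiber (fun x => s x : nat)) m.

Lemma fiber_val {T} k (t : T -> 'I_k) (i : 'I_k) :
  fiber (fun x => t x : nat) i = fiber t i.
Proof. by apply/seteqP; split => x; rewrite /fiber/=; [move=> h; exact: val_inj|by move=> ->]. Qed.

Lemma qmiE : qmi = \sum_i \sum_j mi_term (cell_pr i j) (rowpr i) (colpr j).
Proof.
rewrite /qmi /quantized_mi; apply: eq_bigr => i _; apply: eq_bigr => j _.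
by rewrite !fiber_val rowprE colprE.
Qed.

(** A vanishing sum of nonnegative terms kills each term: the quantised joint law is absolutely
    continuous with respect to the product of its marginals, as [gibbs_le] requires. *)
Lemma cell_pr_eq0 i j : rowpr i * colpr j = 0 -> cell_pr i j = 0.
Proof.
move=> /eqP; rewrite mulf_eq0 => /orP[] /eqP h.
  by move/psumr_eq0P: h => -> // k _; exact: cell_pr_ge0.
by move/psumr_eq0P: h => -> // k _; exact: cell_pr_ge0.
Qed.

(** Termwise [gibbs_le]; the final - 1 is the total mass of the cells. The linear form, without a
    logarithm of a mean, leaves the scale of [G] free. *)
Lemma qmi_variational (G : 'I_n -> 'I_m -> R) : (forall i j, 0 < G i j) ->
  \sum_i \sum_j cell_pr i j * ln (G i j) <=
  qmi * ln 2 + \sum_i \sum_j rowpr i * colpr j * G i j - 1.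
Proof.
move=> G0; rewrite -[X in _ - X]cell_pr_sum1 qmiE mulr_suml -big_split/= -sumrB.
apply: ler_sum => i _; rewrite mulr_suml -big_split/= -sumrB.
apply: ler_sum => j _.
apply: (le_trans (@gibbs_le _ _ (rowpr i * colpr j) _ (cell_pr_ge0 _ _) _ _ _)) => //.
- by rewrite mulr_ge0// sumr_ge0// => k _; exact: cell_pr_ge0.
- exact: cell_pr_eq0.
rewrite lerB// lerD2r /mi_term; case: eqP => _; first by rewrite mul0r.
by rewrite ln_log2 mulrA.
Qed.

Lemma qmi_le I : mutual_info P = I%:E -> qmi <= I.
Proof.
move=> PI; rewrite -lee_fin -PI; apply: ereal_sup_ubound.
exists (fiber (fun x => r x : nat)), n, (fiber (fun x => s x : nat)), m.
by split => //; exact: fiber_partition.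
Qed.
End Cells.

(** * Data processing and the upper bound *)

Section Expectation.
Context {R : realType} {d : measure_display} {T : measurableType d}.
Variable P : probability T R.
Implicit Types f g : T -> R.

(** [fine] would turn an infinite integral into 0; this is why several lemmas below carry a uniform
    bound [c]. *)
Definition expect (f : T -> R) : R := fine (\int[P]_z (f z)%:E)%E.

Lemma expect_fin f c : measurable_fun setT f -> (forall z, 0 <= f z <= c) ->
  (\int[P]_z (f z)%:E = (expect f)%:E)%E.
Proof.
move=> mf fc; rewrite /expect fineK// ge0_fin_numE; last first.
  by apply: integral_ge0 => z _; rewrite lee_fin; case/andP: (fc z).
apply: (@le_lt_trans _ _ (\int[P]_z (cst c%:E z))%E); last first.
  by rewrite integral_cst// [X in (_ * X)%E]probability_setT mule1 ltry.
apply: ge0_le_integral => //.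
- by move=> z _; rewrite lee_fin; case/andP: (fc z).
- exact/measurable_EFinP.
- by move=> z _; rewrite lee_fin; case/andP: (fc z).
Qed.

Lemma expect_le_add f g e c : measurable_fun setT f -> measurable_fun setT g ->
  (forall z, 0 <= f z) -> (forall z, 0 <= g z <= c) -> 0 <= e ->
  (forall z, f z <= g z + e) -> expect f <= expect g + e.
Proof.
move=> mf mg f0 gc e0 fg.
rewrite -lee_fin EFinD -(@expect_fin f (c + e))//; last first.
  move=> z; rewrite f0 (le_trans (fg z))// lerD2r.
  by case/andP: (gc z).
rewrite -(@expect_fin g c)//.
have -> : e%:E = (\int[P]_z (cst e%:E z))%E.
  by rewrite integral_cst// [X in (_ * X)%E]probability_setT mule1.
rewrite -ge0_integralD//; last 2 first.
- by move=> z _; rewrite lee_fin; case/andP: (gc z).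
- exact/measurable_EFinP.
apply: ge0_le_integral => //.
- by move=> z _; rewrite lee_fin.
- exact/measurable_EFinP.
- by apply: emeasurable_funD => //; exact/measurable_EFinP.
- by move=> z _; rewrite /cst -EFinD lee_fin.
Qed.

Lemma expect_ge0 f : (forall z, 0 <= f z) -> 0 <= expect f.
Proof. by move=> f0; apply/fine_ge0/integral_ge0 => z _; rewrite lee_fin. Qed.

Lemma expect_cst c : expect (fun=> c) = c.
Proof.
by rewrite /expect integral_cst// [X in (_ * X)%E]probability_setT mule1.
Qed.

Lemma expect_le f g c : measurable_fun setT f -> measurable_fun setT g ->
  (forall z, 0 <= f z) -> (forall z, 0 <= g z <= c) ->
  (forall z, f z <= g z) -> expect f <= expect g.
Proof.
move=> mf mg f0 gc fg; rewrite -[expect g]addr0.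
by apply: (@expect_le_add _ _ _ c) => // z; rewrite addr0.
Qed.

Lemma expect_sum (I : Type) (s : seq I) (F : I -> T -> R) c :
  (forall i, measurable_fun setT (F i)) -> (forall i z, 0 <= F i z <= c) ->
  expect (fun z => \sum_(i <- s) F i z) = \sum_(i <- s) expect (F i).
Proof.
move=> mF Fc; rewrite {1}/expect; under eq_integral do rewrite -sumEFin.
rewrite ge0_integral_sum//; last 2 first.
- by move=> i; exact/measurable_EFinP.
- by move=> i z _; rewrite lee_fin; case/andP: (Fc i z).
under eq_bigr do rewrite (expect_fin (mF _) (Fc _)).
by rewrite sumEFin.
Qed.
End Expectation.

(** * Discretisation of finitely many functions into [0, 1] *)

Section Discretise.
Context {R : realType} {d : measure_display} {T : measurableType d}.
Variables (K : finType) (a : K -> T -> R) (N : nat).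
Hypotheses (ma : forall k, measurable_fun setT (a k))
  (a01 : forall k x, 0 <= a k x <= 1) (N0 : (0 < N)%N).

(** One digit vector records all the functions at once, so a single finite partition serves every
    outcome [k]. There are N + 1 digits because the value 1 has digit N. *)
Definition digits (x : T) : {ffun K -> 'I_N.+1} :=
  [ffun k => inord (Num.truncn (N%:R * a k x))].
Definition digit_cell (x : T) : 'I_#|{: {ffun K -> 'I_N.+1}}| := enum_rank (digits x).
Definition digit_val (k : K) (i : 'I_#|{: {ffun K -> 'I_N.+1}}|) : R :=
  (enum_val i k : nat)%:R / N%:R.

Let Na_ge0 k x : 0 <= N%:R * a k x.
Proof. by rewrite mulr_ge0//; case/andP: (a01 k x). Qed.

Let digitsE k x : digits x k = Num.truncn (N%:R * a k x) :> nat.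
Proof.
rewrite ffunE inordK// truncn_lt_nat//.
rewrite (@le_lt_trans _ _ N%:R)//; last by rewrite ltr_nat.
by rewrite ler_piMr//; case/andP: (a01 k x).
Qed.

Lemma digit_val_ge0 k i : 0 <= digit_val k i.
Proof. exact: divr_ge0. Qed.

Lemma digit_val_bounds k x :
  digit_val k (digit_cell x) <= a k x <= digit_val k (digit_cell x) + N%:R^-1.
Proof.
rewrite /digit_val /digit_cell enum_rankK digitsE.
have /andP[h1 h2] := truncn_itv (Na_ge0 k x).
have N0' : (0 : R) < N%:R by rewrite ltr0n.
apply/andP; split; first by rewrite ler_pdivrMr// [leRHS]mulrC.
by rewrite -[X in _ + X]mul1r -mulrDl ler_pdivlMr// [leLHS]mulrC ltW// natr1.
Qed.

Lemma digit_cell_measurable : mfibers digit_cell.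
Proof.
move=> i; rewrite (_ : fiber _ _ =
  \bigcap_(k in [set: K]) (a k @^-1` [set y | (enum_val i k)%:R <= N%:R * y < (enum_val i k).+1%:R])).
  apply: fin_bigcap_measurable => // k _.
  rewrite -[X in measurable X]setTI.
  have mNa : measurable_fun setT (fun x => N%:R * a k x).
    exact: measurable_funM.
  rewrite (_ : _ @^-1` _ = (fun x => N%:R * a k x) @^-1`
     `[(enum_val i k)%:R, (enum_val i k).+1%:R[%classic); first exact: mNa.
  by apply/seteqP; split => x /=; rewrite in_itv.
apply/seteqP; split => x.
  by rewrite /fiber/= => <- k _ /=; rewrite /digit_cell enum_rankK digitsE truncn_itv.
move=> h; rewrite /fiber/= /digit_cell -[RHS]enum_valK; congr enum_rank.
apply/ffunP => k; apply/val_inj => /=; rewrite digitsE.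
by apply: truncn_def; exact: h.
Qed.
End Discretise.

(** Used to let the precision of the discretisation tend to infinity. *)
Lemma ler_addinvn {R : realType} (x y C : R) :
  (forall n, (0 < n)%N -> x <= y + C / n%:R) -> x <= y.
Proof.
move=> h; apply/ler_addgt0Pr => e e0.
pose n := (Num.truncn (`|C| / e)).+1.
apply: (le_trans (h n _)) => //; rewrite lerD2l ler_pdivrMr ?ltr0n//.
apply: (le_trans (ler_norm C)); rewrite mulrC -ler_pdivrMr//.
by apply/ltW; rewrite truncnS_gt.
Qed.

Lemma ler_mul_near {R : realType} (p q e x : R) :
  `|p - q| <= e -> p * x <= q * x + e * `|x|.
Proof.
move=> pqe; rewrite -lerBlDl -mulrBl (le_trans (ler_norm _))// normrM.
by rewrite ler_wpM2r.
Qed.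

(** Jensen for weights of total at most 1, the missing weight being put on the value 1, where [ln]
    vanishes. *)
Lemma ln_concave_sum {R : realType} (K : finType) (w f : K -> R) :
  (forall k, 0 <= w k) -> \sum_k w k <= 1 -> (forall k, 0 < f k) ->
  0 < 1 + \sum_k w k * (f k - 1) /\
  \sum_k w k * ln (f k) <= ln (1 + \sum_k w k * (f k - 1)).
Proof.
move=> w0 w1 f0.
have SE : 1 + \sum_k w k * (f k - 1) = (1 - \sum_k w k) + \sum_k w k * f k.
  rewrite -addrA; congr (_ + _).
  rewrite -sumrN -big_split/=; apply: eq_bigr => k _; ring.
have S0 : 0 < 1 + \sum_k w k * (f k - 1).
  rewrite SE; have [h|h] := ltP (\sum_k w k) 1.
    by rewrite ltr_pwDl ?subr_gt0// sumr_ge0// => k _; rewrite mulr_ge0// ltW.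
  have {w1 h} w1 : \sum_k w k = 1 by apply/le_anti; rewrite w1 h.
  rewrite w1 subrr add0r lt0r sumr_ge0 ?andbT//; last first.
    by move=> k _; rewrite mulr_ge0// ltW.
  apply/eqP => /psumr_eq0P h; have : (1 : R) == 0.
    rewrite -w1 big1// => k _.
    have /eqP := h (fun k _ => mulr_ge0 (w0 k) (ltW (f0 k))) k isT.
    by rewrite mulf_eq0 (gt_eqF (f0 k)) orbF => /eqP.
  by rewrite oner_eq0.
split => //; move: S0 SE; set S := 1 + _ => S0 SE.
rewrite -subr_le0.
(* Tangent line of [ln] at 1, applied to each ratio f k / S and to the leftover value 1 / S. *)
have : \sum_k w k * (ln (f k) - ln S) + (1 - \sum_k w k) * (0 - ln S) <=
       \sum_k w k * (f k / S - 1) + (1 - \sum_k w k) * (S^-1 - 1).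
  rewrite lerD//.
    apply: ler_sum => k _; rewrite ler_wpM2l// -ln_div ?posrE//.
    by apply: ln_leB1; rewrite divr_gt0.
  rewrite ler_wpM2l ?subr_ge0// sub0r -lnV ?posrE//.
  by apply: ln_leB1; rewrite invr_gt0.
have -> : \sum_k w k * (f k / S - 1) + (1 - \sum_k w k) * (S^-1 - 1) =
   ((1 - \sum_k w k) + \sum_k w k * f k) / S - 1.
  under eq_bigr do rewrite mulrBr mulr1 mulrA.
  rewrite sumrB -mulr_suml; ring.
rewrite -SE divff ?gt_eqF// subrr.
under eq_bigr do rewrite mulrBr.
rewrite sumrB -mulr_suml => h; apply: le_trans h; rewrite le_eqVlt; apply/orP; left.
by apply/eqP; ring.
Qed.

(** * Data processing for outcomes of product form *)

Section DataProcessing.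
Context {R : realType} {d1 d2 : measure_display}
  {T1 : measurableType d1} {T2 : measurableType d2}.
Variables (P : probability (T1 * T2)%type R).
Variables (K : finType) (a : K -> T1 -> R) (b : K -> T2 -> R).
Hypotheses (ma : forall k, measurable_fun setT (a k))
  (mb : forall k, measurable_fun setT (b k))
  (a01 : forall k x, 0 <= a k x <= 1) (b01 : forall k y, 0 <= b k y <= 1)
  (ab1 : forall x y, \sum_k a k x * b k y <= 1).

(** [a k x * b k y] stands for the probability of outcome [k] given (x, y), one factor for each
    party's private randomness. *)
Definition joint_weight k : R := expect P (fun z => a k z.1 * b k z.2).
Definition prod_weight k : R :=
  expect P (fun z => a k z.1) * expect P (fun z => b k z.2).

Section FixedPrecision.
Variables (N : nat).
Hypothesis (N0 : (0 < N)%N).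
Let r := digit_cell a N.
Let s := digit_cell b N.
Let a' := fun k i => @digit_val R K N k i.
Let mr : mfibers r. Proof. exact: digit_cell_measurable. Qed.
Let ms : mfibers s. Proof. exact: digit_cell_measurable. Qed.
Let c i j := cell_pr P r s i j.
Let row i := rowpr P r s i.
Let col j := colpr P r s j.

Let p' k := \sum_i \sum_j c i j * (a' k i * a' k j).
Let qa' k := \sum_i row i * a' k i.
Let qb' k := \sum_j col j * a' k j.

Let e : R := N%:R^-1.
Let e0 : 0 <= e. Proof. by rewrite invr_ge0. Qed.

Let a'le k x : 0 <= a' k (r x) <= 1.
Proof.
rewrite digit_val_ge0/=; have /andP[h _] := digit_val_bounds a01 N0 k x.
by rewrite (le_trans h)//; case/andP: (a01 k x).
Qed.
Let b'le k y : 0 <= a' k (s y) <= 1.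
Proof.
rewrite digit_val_ge0/=; have /andP[h _] := digit_val_bounds b01 N0 k y.
by rewrite (le_trans h)//; case/andP: (b01 k y).
Qed.

Let ma1 k : measurable_fun [set: T1 * T2] (fun z => a k z.1).
Proof. exact: measurableT_comp. Qed.
Let mb2 k : measurable_fun [set: T1 * T2] (fun z => b k z.2).
Proof. exact: measurableT_comp. Qed.
Let mab k : measurable_fun [set: T1 * T2] (fun z => a k z.1 * b k z.2).
Proof. exact: measurable_funM. Qed.

Let p'E k : expect P (fun z => a' k (r z.1) * a' k (s z.2)) = p' k.
Proof.
rewrite /expect (@cell_integral _ _ _ _ _ P _ _ _ _ mr ms (fun i j => a' k i * a' k j)).
  by apply: eq_bigr => i _; apply: eq_bigr => j _; rewrite mulrC.
by move=> i j; rewrite mulr_ge0// digit_val_ge0.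
Qed.
Let qa'E k : expect P (fun z => a' k (r z.1)) = qa' k.
Proof.
rewrite /expect (@cell_integral _ _ _ _ _ P _ _ _ _ mr ms (fun i j => a' k i)).
  rewrite /qa'; apply: eq_bigr => i _; rewrite mulr_suml.
  by apply: eq_bigr => j _; rewrite mulrC.
by move=> i j; exact: digit_val_ge0.
Qed.
Let qb'E k : expect P (fun z => a' k (s z.2)) = qb' k.
Proof.
rewrite /expect (@cell_integral _ _ _ _ _ P _ _ _ _ mr ms (fun i j => a' k j)).
  rewrite exchange_big; apply: eq_bigr => i _; rewrite mulr_suml.
  by apply: eq_bigr => j _; rewrite mulrC.
by move=> i j; exact: digit_val_ge0.
Qed.

(** a b - a' b' = a (b - b') + (a - a') b', and each term is at most 1/N. *)
Let p'_bound k : p' k <= joint_weight k <= p' k + 2 * e.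
Proof.
rewrite -p'E; apply/andP; split.
  apply: (@expect_le _ _ _ _ _ _ 1) => //.
  - exact: (@measurable_cell R _ _ _ _ _ _ _ _ mr ms (fun i j => a' k i * a' k j)).
  - by move=> z; rewrite mulr_ge0//; [case/andP: (a'le k z.1)|case/andP: (b'le k z.2)].
  - move=> z; have /andP[? ?] := a01 k z.1; have /andP[? ?] := b01 k z.2.
    by rewrite mulr_ge0//= mulr_ile1.
  - move=> z; have /andP[? _] := digit_val_bounds a01 N0 k z.1.
    have /andP[? _] := digit_val_bounds b01 N0 k z.2.
    by rewrite ler_pM// digit_val_ge0.
apply: (@expect_le_add _ _ _ _ _ _ _ 1) => //.
- exact: (@measurable_cell R _ _ _ _ _ _ _ _ mr ms (fun i j => a' k i * a' k j)).
- by move=> z; rewrite mulr_ge0//; [case/andP: (a01 k z.1)|case/andP: (b01 k z.2)].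
- move=> z; have /andP[? ?] := a'le k z.1; have /andP[? ?] := b'le k z.2.
  by rewrite mulr_ge0//= mulr_ile1.
- by rewrite mulr_ge0.
- move=> z; have /andP[h1 h2] := digit_val_bounds a01 N0 k z.1.
  have /andP[h3 h4] := digit_val_bounds b01 N0 k z.2.
  have /andP[? ?] := a01 k z.1; have /andP[? ?] := b'le k z.2.
  rewrite -/r -/s -/(a' _ _) -/(a' _ _) -/e in h1 h2 h3 h4 *.
  by nra.
Qed.

Let q'_bound k : qa' k * qb' k <= prod_weight k <= qa' k * qb' k + 2 * e.
Proof.
rewrite -qa'E -qb'E /prod_weight.
have m1 : measurable_fun [set: T1 * T2] (fun z => a' k (r z.1)).
  exact: (@measurable_cell R _ _ _ _ _ _ _ _ mr ms (fun i j => a' k i)).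
have m2 : measurable_fun [set: T1 * T2] (fun z => a' k (s z.2)).
  exact: (@measurable_cell R _ _ _ _ _ _ _ _ mr ms (fun i j => a' k j)).
have h1 : expect P (fun z => a' k (r z.1)) <= expect P (fun z => a k z.1).
  apply: (@expect_le _ _ _ _ _ _ 1) => // z; first by case/andP: (a'le k z.1).
  by case/andP: (digit_val_bounds a01 N0 k z.1).
have h2 : expect P (fun z => a' k (s z.2)) <= expect P (fun z => b k z.2).
  apply: (@expect_le _ _ _ _ _ _ 1) => // z; first by case/andP: (b'le k z.2).
  by case/andP: (digit_val_bounds b01 N0 k z.2).
have h3 : expect P (fun z => a k z.1) <= expect P (fun z => a' k (r z.1)) + e.
  apply: (@expect_le_add _ _ _ _ _ _ _ 1) => // z; first by case/andP: (a01 k z.1).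
  by case/andP: (digit_val_bounds a01 N0 k z.1).
have h4 : expect P (fun z => b k z.2) <= expect P (fun z => a' k (s z.2)) + e.
  apply: (@expect_le_add _ _ _ _ _ _ _ 1) => // z; first by case/andP: (b01 k z.2).
  by case/andP: (digit_val_bounds b01 N0 k z.2).
have h5 : 0 <= expect P (fun z => a' k (r z.1)).
  by apply: expect_ge0 => z; case/andP: (a'le k z.1).
have h6 : 0 <= expect P (fun z => a' k (s z.2)).
  by apply: expect_ge0 => z; case/andP: (b'le k z.2).
have h7 : expect P (fun z => a k z.1) <= 1.
  rewrite -[leRHS](expect_cst P); apply: (@expect_le _ _ _ _ _ _ 1) => // z.
  - by case/andP: (a01 k z.1).
  - by rewrite ler01 lexx.
  - by case/andP: (a01 k z.1).
have h8 : expect P (fun z => a' k (s z.2)) <= 1.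
  rewrite -[leRHS](expect_cst P); apply: (@expect_le _ _ _ _ _ _ 1) => // z.
  - by case/andP: (b'le k z.2).
  - by rewrite ler01 lexx.
  - by case/andP: (b'le k z.2).
rewrite ler_pM//=; nra.
Qed.

(** The bound is inherited from an actual pair (x, y), so both fibers must be nonempty; nonzero
    marginal mass ensures this. *)
Let sub1 i j : row i * col j != 0 -> \sum_k a' k i * a' k j <= 1.
Proof.
rewrite mulf_eq0 negb_or => /andP[ri cj].
have [x xi] : exists x, r x = i.
  apply: contrapT => /forallNP h; case/negP: ri.
  rewrite /row -rowprE// (_ : fiber r i = set0) ?set0X ?measure0//.
  by apply/seteqP; split => z //= /h.
have [y yj] : exists y, s y = j.
  apply: contrapT => /forallNP h; case/negP: cj.
  rewrite /col -colprE// (_ : fiber s j = set0) ?setX0 ?measure0//.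
  by apply/seteqP; split => z //= /h.
apply: le_trans (ab1 x y); apply: ler_sum => k _; rewrite -xi -yj.
have /andP[? _] := digit_val_bounds a01 N0 k x.
have /andP[? _] := digit_val_bounds b01 N0 k y.
by rewrite ler_pM// digit_val_ge0.
Qed.

Lemma data_processing_fixed (f : K -> R) (t I : R) :
  mutual_info P = I%:E -> (forall k, 0 < f k) -> 0 < t ->
  \sum_k joint_weight k * ln (f k) + ln t <=
  I * ln 2 + t * (1 + \sum_k prod_weight k * (f k - 1)) - 1 +
  2 * (\sum_k `|ln (f k)| + t * \sum_k `|f k - 1|) / N%:R.
Proof.
move=> PI f0 t0.
pose h i j : R := 1 + \sum_k a' k i * a' k j * (f k - 1).
(* On cells of product mass zero [h] may fail to be positive, and the value there does not affect
   the sums; any positive constant does. *)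
pose G i j : R := if row i * col j != 0 then t * h i j else t.
have hP i j : row i * col j != 0 ->
    0 < h i j /\ \sum_k a' k i * a' k j * ln (f k) <= ln (h i j).
  move=> rc0; apply: (ln_concave_sum (w := fun k => a' k i * a' k j)) => //.
    by move=> k; rewrite mulr_ge0// digit_val_ge0.
  exact: sub1.
have G0 i j : 0 < G i j.
  by rewrite /G; case: ifPn => // /hP[h0 _]; rewrite mulr_gt0.
have := qmi_variational P mr ms G0.
rewrite -/c -/row -/col => main.
have qI : qmi P r s * ln 2 <= I * ln 2.
  by rewrite ler_wpM2r ?(ltW ln2_gt0)//; exact: qmi_le.
have lhs : ln t + \sum_k p' k * ln (f k) <= \sum_i \sum_j c i j * ln (G i j).
  have -> : ln t + \sum_k p' k * ln (f k) =
    \sum_i \sum_j c i j * (ln t + \sum_k a' k i * a' k j * ln (f k)).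
    under [RHS]eq_bigr do under eq_bigr do rewrite mulrDr.
    under [RHS]eq_bigr do rewrite big_split/=.
    rewrite big_split/=; congr (_ + _).
      under eq_bigr do rewrite -mulr_suml.
      by rewrite -mulr_suml cell_pr_sum1// mul1r.
    rewrite /p'; under eq_bigr do rewrite mulr_suml.
    rewrite exchange_big/=; apply: eq_bigr => i _.
    under eq_bigr do rewrite mulr_suml.
    rewrite exchange_big/=; apply: eq_bigr => j _.
    by rewrite [RHS]mulr_sumr; apply: eq_bigr => k _; rewrite -!mulrA.
  apply: ler_sum => i _; apply: ler_sum => j _.
  have [rc0|rc0] := eqVneq (row i * col j) 0.
    by rewrite /c (cell_pr_eq0 rc0) !mul0r.
  rewrite ler_wpM2l ?cell_pr_ge0// /G rc0.
  have [h0 h1] := hP _ _ rc0.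
  by rewrite lnM ?posrE// lerD2l.
have rhs : \sum_i \sum_j row i * col j * G i j =
    t * (1 + \sum_k qa' k * qb' k * (f k - 1)).
  transitivity (\sum_i \sum_j row i * col j * (t * h i j)).
    apply: eq_bigr => i _; apply: eq_bigr => j _.
    by rewrite /G; case: eqVneq => [->|]//; rewrite !mul0r.
  have rc1 : \sum_i \sum_j row i * col j = 1.
    under eq_bigr do rewrite -mulr_sumr.
    rewrite -mulr_suml.
    have -> : \sum_i row i = 1 by rewrite -(cell_pr_sum1 P mr ms).
    rewrite mul1r /col -(cell_pr_sum1 P mr ms) exchange_big//.
  rewrite mulrDr mulr1 mulr_sumr.
  transitivity (\sum_i \sum_j (t * (row i * col j) +
     \sum_k t * (row i * a' k i * (col j * a' k j) * (f k - 1)))).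
    apply: eq_bigr => i _; apply: eq_bigr => j _.
    rewrite /h mulrDr mulr1 mulrDr [row i * col j * t]mulrC; congr (_ + _).
    rewrite mulrA big_distrr/=; apply: eq_bigr => k _.
    by move: (row i) (col j) (a' k i) (a' k j) => ? ? ? ?; ring.
  under eq_bigr do rewrite big_split/=.
  rewrite big_split/=; congr (_ + _).
    under eq_bigr do rewrite -mulr_sumr.
    by rewrite -mulr_sumr rc1 mulr1.
  under eq_bigr do rewrite exchange_big/=.
  rewrite exchange_big/=; apply: eq_bigr => k _.
  rewrite /qa' /qb' mulr_suml mulr_suml mulr_sumr; apply: eq_bigr => i _.
  by rewrite mulr_sumr mulr_suml mulr_sumr.
have ep : \sum_k joint_weight k * ln (f k) <=
    \sum_k p' k * ln (f k) + 2 * e * \sum_k `|ln (f k)|.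
  rewrite mulr_sumr -big_split/=; apply: ler_sum => k _.
  have /andP[h1 h2] := p'_bound k.
  by apply: ler_mul_near; rewrite ger0_norm ?subr_ge0// lerBlDl.
have eq : \sum_k qa' k * qb' k * (f k - 1) <=
    \sum_k prod_weight k * (f k - 1) + 2 * e * \sum_k `|f k - 1|.
  rewrite mulr_sumr -big_split/=; apply: ler_sum => k _.
  have /andP[h1 h2] := q'_bound k.
  by apply: ler_mul_near; rewrite ler0_norm ?subr_le0// opprB lerBlDl.
have : t * (1 + \sum_k qa' k * qb' k * (f k - 1)) <=
  t * (1 + (\sum_k prod_weight k * (f k - 1) + 2 * e * \sum_k `|f k - 1|)).
  by rewrite ler_pM2l// lerD2l.
rewrite rhs in main.
move: main lhs ep qI.
set A := \sum_k joint_weight k * _; set B := \sum_i _; set C := \sum_k `|ln _|.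
set D := \sum_k prod_weight k * _; set E := \sum_k `| _ |; set F := \sum_k p' k * _.
rewrite -/e => main' lhs' ep' qI' hq.
have -> : 2 * (C + t * E) / N%:R = 2 * e * C + t * (2 * e * E) by rewrite -/e; ring.
lra.
Qed.
End FixedPrecision.

(* [t] rescales the test function of the Donsker-Varadhan bound, [f k] is its
   value on outcome [k]; all other outcomes receive the value 1. *)
Lemma data_processing (f : K -> R) (t I : R) :
  mutual_info P = I%:E -> (forall k, 0 < f k) -> 0 < t ->
  \sum_k joint_weight k * ln (f k) + ln t <=
  I * ln 2 + t * (1 + \sum_k prod_weight k * (f k - 1)) - 1.
Proof.
move=> PI f0 t0; apply: ler_addinvn => N N0.
exact: data_processing_fixed.
Qed.
End DataProcessing.

(** min(p, u) = (p + u - |p - u|) / 2: for equal totals the overlap is the total minus the variation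
    distance. *)
Lemma sum_norm_sub {R : realType} (I : finType) (p u : I -> R) :
  \sum_i p i = \sum_i u i ->
  \sum_i Num.min (p i) (u i) = \sum_i u i - 2^-1 * \sum_i `|p i - u i|.
Proof.
move=> pu; have -> : \sum_i Num.min (p i) (u i) =
    \sum_i (2^-1 * p i + 2^-1 * u i - 2^-1 * `|p i - u i|).
  apply: eq_bigr => i _; rewrite minElt; case: ltP => h.
    by rewrite ltr0_norm ?subr_lt0//; lra.
  by rewrite ger0_norm ?subr_ge0//; lra.
by rewrite sumrB big_split/= -!mulr_sumr pu; lra.
Qed.

Lemma sum_tagged {R : realType} (J : finType) (K : J -> finType)
    (F : forall j, K j -> R) :
  \sum_(k : {j & K j}) F (tag k) (tagged k) = \sum_j \sum_(k : K j) F j k.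
Proof. by rewrite sig_big_dep/=. Qed.

(** Average over y with x fixed, then over x; the sum over [k] is finite, so both steps are
    linearity of the expectation. *)
Lemma prod_weight_sum_le1 {R : realType} {d1 d2 : measure_display}
    {T1 : measurableType d1} {T2 : measurableType d2}
    (P : probability (T1 * T2)%type R) (K : finType)
    (a : K -> T1 -> R) (b : K -> T2 -> R) :
  (forall k, measurable_fun setT (a k)) -> (forall k, measurable_fun setT (b k)) ->
  (forall k x, 0 <= a k x <= 1) -> (forall k y, 0 <= b k y <= 1) ->
  (forall x y, \sum_k a k x * b k y <= 1) ->
  \sum_k prod_weight P a b k <= 1.
Proof.
move=> ma mb a01 b01 ab1.
have ma1 k : measurable_fun [set: T1 * T2] (fun z => a k z.1) by exact: measurableT_comp.
have mb2 k : measurable_fun [set: T1 * T2] (fun z => b k z.2) by exact: measurableT_comp.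
have expZ (c : R) (f : T1 * T2 -> R) : 0 <= c -> measurable_fun setT f ->
    (forall z, 0 <= f z <= 1) -> expect P (fun z => c * f z) = c * expect P f.
  move=> c0 mf f1; rewrite {1}/expect; under eq_integral do rewrite EFinM.
  rewrite ge0_integralZl_EFin//; last 2 first.
  - by move=> z _; rewrite lee_fin; case/andP: (f1 z).
  - exact/measurable_EFinP.
  by rewrite (expect_fin _ mf f1).
have eb0 k : 0 <= expect P (fun z => b k z.2).
  by apply: expect_ge0 => z; case/andP: (b01 k z.2).
have eb1 k : expect P (fun z => b k z.2) <= 1.
  rewrite -[leRHS](expect_cst P); apply: (@expect_le _ _ _ _ _ _ 1) => // z.
  - by case/andP: (b01 k z.2).
  - by rewrite ler01 lexx.
  - by case/andP: (b01 k z.2).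
have inner x : \sum_k expect P (fun z => b k z.2) * a k x <= 1.
  have -> : \sum_k expect P (fun z => b k z.2) * a k x =
      expect P (fun z => \sum_k a k x * b k z.2).
    rewrite (@expect_sum _ _ _ _ _ _ _ 1).
    - by apply: eq_bigr => k _; rewrite mulrC expZ//; case/andP: (a01 k x).
    - by move=> k; exact: measurable_funM.
    - move=> k z; have /andP[? ?] := a01 k x; have /andP[? ?] := b01 k z.2.
      by rewrite mulr_ge0//= mulr_ile1.
  rewrite -[leRHS](expect_cst P); apply: (@expect_le _ _ _ _ _ _ 1) => //.
  - by apply: measurable_sum => k; exact: measurable_funM.
  - move=> z; apply: sumr_ge0 => k _; rewrite mulr_ge0//.
      by case/andP: (a01 k x).
    by case/andP: (b01 k z.2).
  - by move=> z; rewrite ler01 lexx.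
have -> : \sum_k prod_weight P a b k =
    expect P (fun z => \sum_k expect P (fun z => b k z.2) * a k z.1).
  rewrite (@expect_sum _ _ _ _ _ _ _ 1).
  - by apply: eq_bigr => k _; rewrite /prod_weight mulrC expZ//.
  - by move=> k; exact: measurable_funM.
  - move=> k z; have /andP[? ?] := a01 k z.1.
    by rewrite mulr_ge0//= mulr_ile1.
rewrite -[leRHS](expect_cst P); apply: (@expect_le _ _ _ _ _ _ 1) => //.
- by apply: measurable_sum => k; exact: measurable_funM.
- by move=> z; apply: sumr_ge0 => k _; rewrite mulr_ge0//; case/andP: (a01 k z.1).
- by move=> z; rewrite ler01 lexx.
Qed.

(** max(1, z) <= 1 + z, then the tangent of ln(1 + z) at z = 1. Averaged over values of z with mean
    at most 1 this gives ln 2. *)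
Lemma ln_max1_le {R : realType} (z : R) : 0 <= z ->
  ln (Num.max 1 z) <= ln 2 + (z - 1) / 2.
Proof.
move=> z0; apply: (@le_trans _ _ (ln (1 + z))).
  rewrite ler_ln ?posrE ?ltr_pwDl// ?lt_max ?ltr01//.
  by rewrite ge_max lerDl z0 lerDr ler01.
have -> : 1 + z = 2 * ((1 + z) / 2) by field.
rewrite lnM ?posrE ?divr_gt0 ?ltr_pwDl// lerD2l.
apply: (le_trans (ln_leB1 _)); first by rewrite divr_gt0// ltr_pwDl.
by lra.
Qed.

(** * Length of a nearly uniform shared key *)

Section KeyRateBound.
Context {R : realType} {d1 d2 : measure_display}
  {T1 : measurableType d1} {T2 : measurableType d2}.
Variables (P : probability (T1 * T2)%type R).
(** An index [j] stands for a transcript together with a key length; [a k x] is the probability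
    given x that Alice's side is compatible with [j] and her key is [k], and [b] is the same for
    Bob. *)
Variables (J : finType) (len : J -> nat).
Let key j := 'I_(2 ^ len j).
Variables (a : forall j, key j -> T1 -> R) (b : forall j, key j -> T2 -> R).
Hypotheses (ma : forall j k, measurable_fun setT (@a j k))
  (mb : forall j k, measurable_fun setT (@b j k))
  (a0 : forall j k x, 0 <= @a j k x) (b0 : forall j k y, 0 <= @b j k y)
  (a1 : forall j x, \sum_(k : key j) a k x <= 1)
  (b1 : forall j y, \sum_(k : key j) b k y <= 1)
  (ab1 : forall x y, \sum_j (\sum_(k : key j) a k x) * (\sum_(k : key j) b k y) <= 1).

Definition key_pr j (k k' : key j) : R := expect P (fun z => a k z.1 * b k' z.2).
Definition msg_pr j : R := \sum_(k : key j) \sum_(k' : key j) key_pr k k'.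
Definition key_dev j : R :=
  \sum_(k : key j) \sum_(k' : key j)
    `|key_pr k k' - (if k == k' then (2 ^ len j)%:R^-1 * msg_pr j else 0)|.

Let ale1 j (k : key j) x : 0 <= a k x <= 1.
Proof.
rewrite a0/= (le_trans _ (a1 j x))// (bigD1 k)//= lerDl.
by apply: sumr_ge0.
Qed.
Let ble1 j (k : key j) x : 0 <= b k x <= 1.
Proof.
rewrite b0/= (le_trans _ (b1 j x))// (bigD1 k)//= lerDl.
by apply: sumr_ge0.
Qed.
Let ma1 j (k : key j) : measurable_fun [set: T1 * T2] (fun z => a k z.1).
Proof. exact: measurableT_comp. Qed.
Let mb2 j (k : key j) : measurable_fun [set: T1 * T2] (fun z => b k z.2).
Proof. exact: measurableT_comp. Qed.

Lemma key_pr_ge0 j (k k' : key j) : 0 <= key_pr k k'.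
Proof. by apply: expect_ge0 => z; rewrite mulr_ge0. Qed.

Lemma msg_pr_ge0 j : 0 <= msg_pr j.
Proof. by do 2 (apply: sumr_ge0 => ? _); exact: key_pr_ge0. Qed.

(** The ideal law lives on the diagonal, so the off-diagonal minima vanish and the overlap of the
    two laws is the diagonal sum. Half of [key_dev] is their unnormalised variation distance. *)
Lemma diag_overlap j :
  msg_pr j - 2^-1 * key_dev j <=
  \sum_(k : key j) Num.min (key_pr k k) ((2 ^ len j)%:R^-1 * msg_pr j).
Proof.
set u := (2 ^ len j)%:R^-1 * msg_pr j.
have u0 : 0 <= u by rewrite mulr_ge0// msg_pr_ge0.
pose U (kk : key j * key j) : R := if kk.1 == kk.2 then u else 0.
have sU : \sum_kk U kk = msg_pr j.
  rewrite -(pair_bigA _ (fun k k' => U (k, k')))/=.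
  rewrite (eq_bigr (fun=> u)); last first.
    move=> k _; rewrite (bigD1 k)//= /U/= eqxx big1 ?addr0// => k' /negbTE kk'.
    by rewrite eq_sym kk'.
  rewrite sumr_const card_ord -mulr_natr /u mulrC mulrA divff ?mul1r//.
have := @sum_norm_sub R _ (fun kk : key j * key j => key_pr kk.1 kk.2) U.
rewrite sU -(pair_bigA _ (fun k k' => key_pr k k'))/= => /(_ erefl).
rewrite -(pair_bigA _ (fun k k' => `|key_pr k k' - U (k, k')|))/= => <-.
rewrite -(pair_bigA _ (fun k k' => Num.min (key_pr k k') (U (k, k'))))/=.
apply: ler_sum => k _; rewrite (bigD1 k)//= /U/= eqxx [X in _ + X]big1 ?addr0//.
move=> k' kk'; rewrite eq_sym (negbTE kk') minElt; case: ltP => // h.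
by apply/le_anti; rewrite key_pr_ge0 andbT ltW.
Qed.

Let qa j (k : key j) : R := expect P (fun z => a k z.1).
Let qb j (k : key j) : R := expect P (fun z => b k z.2).
Let qA j : R := \sum_(k : key j) qa k.
Let qB j : R := \sum_(k : key j) qb k.
Let n2 j : R := (2 ^ len j)%:R.
Let n2_gt0 j : 0 < n2 j. Proof. by rewrite ltr0n expn_gt0. Qed.

Let qa0 j (k : key j) : 0 <= qa k.
Proof. by apply: expect_ge0 => z; exact: a0. Qed.
Let qb0 j (k : key j) : 0 <= qb k.
Proof. by apply: expect_ge0 => z; exact: b0. Qed.

Let qAE j : qA j = expect P (fun z => \sum_(k : key j) a k z.1).
Proof. by rewrite (@expect_sum _ _ _ _ _ _ _ 1). Qed.
Let qBE j : qB j = expect P (fun z => \sum_(k : key j) b k z.2).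
Proof. by rewrite (@expect_sum _ _ _ _ _ _ _ 1). Qed.

Let qAB1 : \sum_j qA j * qB j <= 1.
Proof.
under eq_bigr do rewrite qAE qBE.
apply: (@prod_weight_sum_le1 _ _ _ _ _ P J (fun j x => \sum_(k : key j) a k x)
   (fun j y => \sum_(k : key j) b k y)) => //.
- by move=> j; apply: measurable_sum.
- by move=> j; apply: measurable_sum.
- by move=> j x; rewrite a1 andbT; apply: sumr_ge0.
- by move=> j x; rewrite b1 andbT; apply: sumr_ge0.
Qed.

(** Ratio of Alice's key law given [j], computed from her marginal, to the uniform law. The floor 1
    keeps [f] well defined and [ln (gain k)] nonnegative. *)
Let gain j (k : key j) : R := Num.max 1 (n2 j * (qa k / qA j)).
Let f (k : {j & key j}) : R := n2 (tag k) / gain (tagged k).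

Let gain_gt0 j (k : key j) : 0 < gain k.
Proof. by rewrite lt_max ltr01. Qed.

(** The second arguments of the maximum have uniform average at most 1, so [ln_max1_le] averages to
    ln 2: the correction costs one bit. *)
Let gain_sum j : (n2 j)^-1 * \sum_(k : key j) ln (gain k) <= ln 2.
Proof.
rewrite mulrC ler_pdivrMr//.
apply: (@le_trans _ _ (\sum_(k : key j) (ln 2 + (n2 j * (qa k / qA j) - 1) / 2))).
  apply: ler_sum => k _; apply: ln_max1_le.
  by rewrite mulr_ge0// ?(ltW (n2_gt0 j))// divr_ge0// sumr_ge0.
rewrite big_split/= sumr_const card_ord -mulr_suml sumrB sumr_const card_ord.
rewrite -mulr_sumr -mulr_suml -/(qA j) -/(n2 j) -[ln 2 *+ _]mulr_natr -/(n2 j).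
rewrite gerDl pmulr_lle0 ?invr_gt0// subr_le0 -[leRHS]mulr1 ler_pM2l//.
by have [->|q0] := eqVneq (qA j) 0; rewrite ?mul0r// divff.
Qed.

(** By the choice of [gain], [qa k * f k] is at most [qA]; what remains is the product probability
    of the indices [j]. *)
Let f_sum : \sum_(k : {j & key j}) qa (tagged k) * qb (tagged k) * f k <= 1.
Proof.
apply: le_trans qAB1.
rewrite (sum_tagged (fun j (k : key j) => qa k * qb k * (n2 j / gain k))).
apply: ler_sum => j _; rewrite mulr_sumr; apply: ler_sum => k _.
rewrite mulrAC ler_wpM2r//.
have [q0|q0] := eqVneq (qA j) 0.
  have -> : qa k = 0 by move/psumr_eq0P: q0 => ->.
  by rewrite mul0r sumr_ge0.
have {q0}q0 : 0 < qA j by rewrite lt0r q0 sumr_ge0.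
rewrite mulrA ler_pdivrMr// /gain maxr_pMr ?(ltW q0)// le_max; apply/orP; right.
by rewrite le_eqVlt; apply/orP; left; apply/eqP; field; rewrite gt_eqF.
Qed.

Lemma key_rate_bound (I : R) : mutual_info P = I%:E -> \sum_j msg_pr j <= 1 ->
  \sum_j (len j)%:R * (msg_pr j - 2^-1 * key_dev j) <= I + 2.
Proof.
move=> PI p1.
have f0 k : 0 < f k by rewrite divr_gt0.
(* The bracket in [data_processing] will be at most 2, so the factor 1/2 cancels it against - 1, at
   the price ln 2. *)
have t0 : (0 : R) < 2^-1 by rewrite invr_gt0.
have := @data_processing R _ _ _ _ P {j & key j} (fun k => a (tagged k))
  (fun k => b (tagged k)) _ _ _ _ _ f 2^-1 I PI f0 t0.
have sab x y : \sum_(k : {j & key j}) a (tagged k) x * b (tagged k) y <= 1.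
  apply: le_trans (ab1 x y).
  rewrite (sum_tagged (fun j (k : key j) => a k x * b k y)).
  apply: ler_sum => j _; rewrite mulr_suml; apply: ler_sum => k _.
  by rewrite ler_wpM2l// (bigD1 k)//= lerDl sumr_ge0.
move=> /(_ (fun k => ma (tagged k)) (fun k => mb (tagged k)) (fun k => ale1 (tagged k))
  (fun k => ble1 (tagged k)) sab).
set S := \sum_k _; set D := \sum_k _ => main.
have D1 : D <= 1.
  apply: le_trans f_sum; apply: ler_sum => k _.
  rewrite /prod_weight -/(qa (tagged k)) -/(qb (tagged k)).
  by rewrite ler_wpM2l ?mulr_ge0// gerBl.
have SI : S <= (I + 1) * ln 2.
  move: main; rewrite lnV ?posrE//.
  move: D1; set L := ln 2; move: (ln2_gt0 (R := R)); rewrite -/L; nra.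
have SE : S = \sum_j \sum_(k : key j) key_pr k k * ((len j)%:R * ln 2 - ln (gain k)).
  rewrite -(sum_tagged (fun j (k : key j) => key_pr k k * ((len j)%:R * ln 2 - ln (gain k)))).
  apply: eq_bigr => k _; congr (_ * _).
  by rewrite /f ln_div ?posrE// /n2 natrX lnXn// mulr_natl.
have lnf0 j (k : key j) : 0 <= (len j)%:R * ln 2 - ln (gain k).
  rewrite subr_ge0 mulr_natl -lnXn// -natrX -/(n2 j) ler_ln ?posrE//.
  rewrite /gain ge_max ler1n expn_gt0/= ler_piMr ?(ltW (n2_gt0 j))//.
  have [->|q0] := eqVneq (qA j) 0; first by rewrite invr0 mulr0.
  rewrite ler_pdivrMr ?lt0r ?q0 ?sumr_ge0// mul1r /qA (bigD1 k)//= lerDl.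
  by rewrite sumr_ge0.
(* The factor is nonnegative because [gain] is at most [2 ^ len], so the diagonal probability may be
   lowered to its minimum with the uniform one. The overlap then controls the main term from below,
   and the uniform value controls the correction. *)
have per j : ((len j)%:R * (msg_pr j - 2^-1 * key_dev j)) * ln 2 - msg_pr j * ln 2 <=
    \sum_(k : key j) key_pr k k * ((len j)%:R * ln 2 - ln (gain k)).
  set u := (n2 j)^-1 * msg_pr j.
  have u0 : 0 <= u by rewrite mulr_ge0 ?msg_pr_ge0// invr_ge0 ltW.
  apply: (@le_trans _ _ (\sum_(k : key j) (Num.min (key_pr k k) u * ((len j)%:R * ln 2) -
      u * ln (gain k)))).
    rewrite sumrB -mulr_suml -mulr_sumr lerB//.
      rewrite [(len j)%:R * (_ - _)]mulrC -mulrA.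
      rewrite ler_wpM2r ?mulr_ge0 ?(ltW (ln2_gt0 (R := R)))//.
      exact: diag_overlap.
    rewrite /u [_^-1 * _]mulrC -mulrA.
    exact: (ler_wpM2l (msg_pr_ge0 j) (gain_sum j)).
  apply: ler_sum => k _.
  apply: (@le_trans _ _ (Num.min (key_pr k k) u * ((len j)%:R * ln 2 - ln (gain k)))).
    rewrite [leRHS]mulrBr lerB// ler_wpM2r ?ln_ge0 ?le_max ?lexx//.
    by rewrite ge_min lexx orbT.
  by rewrite ler_wpM2r// ge_min lexx.
have h : (\sum_j (len j)%:R * (msg_pr j - 2^-1 * key_dev j)) * ln 2 -
    (\sum_j msg_pr j) * ln 2 <= S.
  by rewrite SE !mulr_suml -sumrB; apply: ler_sum => j _; exact: per.
have L0 := ln2_gt0 (R := R).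
have h2 : (\sum_j msg_pr j) * ln 2 <= 1 * ln 2 by rewrite ler_pM2r.
rewrite -(ler_pM2r L0) mulrDl; move: h h2 SI; rewrite mulrDl.
set Y := (\sum_j (len j)%:R * _) * _; set Z := (\sum_j _) * _; lra.
Qed.
End KeyRateBound.

(** * Transcripts as rectangles *)

Section Transcripts.
Context {d1 d2 da db : measure_display}
        {T1 : measurableType d1} {T2 : measurableType d2}
        {Oa : measurableType da} {Ob : measurableType db}.
Variable S : skaScheme T1 T2 Oa Ob.

(* The event that the transcript is [w] is a rectangle: it is the conjunction
   of an event about [(x, u)] and an event about [(y, v)]. *)
Definition alice_ok (w : seq nat) (x : T1) (u : Oa) : Prop :=
  sk_stop S w /\ forall k, (k < size w)%N ->
    ~~ sk_stop S (take k w) /\ (~~ odd k -> sk_msgA S (take k w) x u = nth 0%N w k).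
Definition bob_ok (w : seq nat) (y : T2) (v : Ob) : Prop :=
  forall k, (k < size w)%N -> odd k -> sk_msgB S (take k w) y v = nth 0%N w k.

Lemma size_sk_trans k x y u v : (size (sk_trans S k x y u v) <= k)%N.
Proof.
elim: k => //= k ih; case: ifP => _; first exact: leqW.
by rewrite size_rcons ltnS.
Qed.

Lemma sk_trans_eqP w x y u v :
  sk_trans S (size w) x y u v = w <->
  forall k, (k < size w)%N -> ~~ sk_stop S (take k w) /\
    (if odd k then sk_msgB S (take k w) y v else sk_msgA S (take k w) x u) = nth 0%N w k.
Proof.
elim/last_ind: w => [|w c ih]; first by split.
rewrite size_rcons /=; split.
  case: ifPn => [_ e|ns].
    by have := size_sk_trans (size w) x y u v; rewrite e size_rcons ltnn.
  move=> /eqP; rewrite eqseq_rcons => /andP[/eqP e /eqP ec].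
  rewrite e in ns ec; move: ih => [/(_ e) ih _] k; rewrite ltnS leq_eqVlt => /orP[/eqP->|kw].
    by rewrite -cats1 take_size_cat// nth_cat ltnn subnn/= ns ec.
  by rewrite -cats1 takel_cat ?(ltnW kw)// nth_cat kw; exact: ih.
move=> h; have e : sk_trans S (size w) x y u v = w.
  apply/ih => k kw; have := h k (ltnW (kw : (k < size w)%N)).
  by rewrite -cats1 takel_cat ?(ltnW kw)// nth_cat kw.
have [] := h (size w) (ltnSn _).
rewrite -cats1 take_size_cat// nth_cat ltnn subnn/= e => /negbTE -> ->.
by rewrite cats1.
Qed.

(** Stopping depends on the transcript alone; [alice_ok] carries these conditions, so [bob_ok]
    constrains only Bob's messages. *)
Lemma sk_termP w x y u v : sk_term S w x y u v <-> alice_ok w x u /\ bob_ok w y v.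
Proof.
rewrite /sk_term sk_trans_eqP; split.
  move=> [sw h]; split; [split => // k kw|move=> k kw ok]; have [ns e] := h k kw.
    by split => // /negbTE ok; rewrite ok in e.
  by rewrite ok in e.
move=> [[sw ha] hb]; split => // k kw; have [ns ea] := ha k kw; split => //.
by case: ifPn => ok; [exact: hb|exact: ea].
Qed.

Lemma sk_trans_stop k n x y u v : sk_stop S (sk_trans S k x y u v) -> (k <= n)%N ->
  sk_trans S n x y u v = sk_trans S k x y u v.
Proof.
move=> sk /subnKC <-; elim: (n - k)%N => [|m ih]; first by rewrite addn0.
by rewrite addnS /= ih sk.
Qed.

Lemma sk_term_trans k x y u v : sk_stop S (sk_trans S k x y u v) ->
  sk_term S (sk_trans S k x y u v) x y u v.
Proof.
move=> sk; split => //; set w := sk_trans S k x y u v.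
elim: k @w sk => //= k ih; case: ifPn => sk; first by move=> _; exact: ih.
move=> _; rewrite size_rcons /=.
have sz : size (sk_trans S k x y u v) = k.
  elim: k sk {ih} => //= k ih; case: ifPn => [sk|sk _]; first by rewrite sk.
  by rewrite size_rcons ih.
by rewrite !sz (negbTE sk).
Qed.

Lemma sk_term_uniq w w' x y u v : sk_term S w x y u v -> sk_term S w' x y u v -> w = w'.
Proof.
move=> [sw ew] [sw' ew'].
have [h|h] := leqP (size w) (size w').
  by rewrite -ew -ew' [RHS](@sk_trans_stop (size w)) ?ew.
by rewrite -ew -ew' [LHS](@sk_trans_stop (size w')) ?ew'// ltnW.
Qed.
End Transcripts.

(** * Probabilities of scheme events *)

Section SchemeMeasure.
Context {R : realType} {d1 d2 da db : measure_display}
        {T1 : measurableType d1} {T2 : measurableType d2}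
        {Oa : measurableType da} {Ob : measurableType db}.
Variables (P : probability (T1 * T2)%type R) (Qa : probability Oa R) (Qb : probability Ob R).
Implicit Types (E F : T1 -> T2 -> Oa -> Ob -> Prop).

Definition event (E : T1 -> T2 -> Oa -> Ob -> Prop) : set (((T1 * T2) * Oa) * Ob)%type :=
  [set o | E o.1.1.1 o.1.1.2 o.1.2 o.2].
Definition total_law : probability (((T1 * T2) * Oa) * Ob)%type R := ((P \x Qa) \x Qb)%E.

(** Tonelli: on measurable events the iterated integral is a product measure, which brings
    monotonicity and countable additivity. *)
Lemma sk_pr_event E : measurable (event E) ->
  sk_pr P Qa Qb E = fine (total_law (event E)).
Proof.
move=> mE; congr fine.
have -> : total_law (event E) = (\int[(P \x Qa)%E]_z Qb (xsection (event E) z))%E by [].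
rewrite fubini_tonelli1//; last exact: measurable_fun_xsection.
apply: eq_integral => -[x y] _; apply: eq_integral => u _ /=.
have mx := measurable_xsection ((x, y), u) mE.
rewrite (_ : [set v | E x y u v] = xsection (event E) ((x, y), u)).
  by rewrite integral_indic// setIT.
by apply/seteqP; split => v; rewrite /xsection/= ?inE.
Qed.

Lemma event_alice_measurable (A : T1 -> Oa -> Prop) :
  measurable [set xu : T1 * Oa | A xu.1 xu.2] -> measurable (event (fun x y u v => A x u)).
Proof.
move=> mA; rewrite -[X in measurable X]setTI.
have mf : measurable_fun setT (fun o : ((T1 * T2) * Oa) * Ob => (o.1.1.1, o.1.2)).
  apply: measurable_fun_pair.
    apply: (measurableT_comp measurable_fst); apply: (measurableT_comp measurable_fst).
    exact: measurable_fst.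
  by apply: (measurableT_comp measurable_snd); exact: measurable_fst.
exact: (mf measurableT _ mA).
Qed.

Lemma event_bob_measurable (B : T2 -> Ob -> Prop) :
  measurable [set yv : T2 * Ob | B yv.1 yv.2] -> measurable (event (fun x y u v => B y v)).
Proof.
move=> mA; rewrite -[X in measurable X]setTI.
have mf : measurable_fun setT (fun o : ((T1 * T2) * Oa) * Ob => (o.1.1.2, o.2)).
  apply: measurable_fun_pair.
    apply: (measurableT_comp measurable_snd); apply: (measurableT_comp measurable_fst).
    exact: measurable_fst.
  exact: measurable_snd.
exact: (mf measurableT _ mA).
Qed.

Definition slice_pr {d d'} {T : measurableType d} {O : measurableType d'}
  (Q : probability O R) (A : T -> O -> Prop) (x : T) : R := fine (Q [set u | A x u]).

Lemma slice_prE {d d'} {T : measurableType d} {O : measurableType d'}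
  (Q : probability O R) (A : T -> O -> Prop) x :
  slice_pr Q A x = fine (Q (xsection [set xu : T * O | A xu.1 xu.2] x)).
Proof.
by congr (fine (Q _)); apply/seteqP; split => u; rewrite /xsection/= inE.
Qed.

Lemma slice_measurable {d d'} {T : measurableType d} {O : measurableType d'}
  (A : T -> O -> Prop) x :
  measurable [set xu : T * O | A xu.1 xu.2] -> measurable [set u | A x u].
Proof.
move=> /(measurable_xsection x); congr measurable.
by apply/seteqP; split => u; rewrite /xsection/= inE.
Qed.

Lemma slice_pr_measurable {d d'} {T : measurableType d} {O : measurableType d'}
  (Q : probability O R) (A : T -> O -> Prop) :
  measurable [set xu : T * O | A xu.1 xu.2] -> measurable_fun setT (slice_pr Q A).
Proof.
move=> mA; have -> : slice_pr Q A =
    fine \o (Q \o xsection [set xu : T * O | A xu.1 xu.2]).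
  by apply/funext => x; rewrite slice_prE.
by apply: measurableT_comp => //; exact: measurable_fun_xsection.
Qed.

Lemma slice_pr_ge0 {d d'} {T : measurableType d} {O : measurableType d'}
  (Q : probability O R) (A : T -> O -> Prop) x : 0 <= slice_pr Q A x.
Proof. exact: fine_ge0. Qed.

(** Given (x, y) the private randomnesses are independent, so rectangles factor; this yields the
    product form that [data_processing] asks for. *)
Lemma sk_pr_rect (A : T1 -> Oa -> Prop) (B : T2 -> Ob -> Prop) :
  measurable [set xu : T1 * Oa | A xu.1 xu.2] ->
  measurable [set yv : T2 * Ob | B yv.1 yv.2] ->
  sk_pr P Qa Qb (fun x y u v => A x u /\ B y v) =
  expect P (fun z => slice_pr Qa A z.1 * slice_pr Qb B z.2).
Proof.
move=> mA mB; rewrite /sk_pr /expect; congr fine.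
apply: eq_integral => -[x y] _ /=.
have mAx := slice_measurable x mA; have mBy := slice_measurable y mB.
transitivity (\int[Qa]_u ((\1_[set u | A x u] u)%:E * (slice_pr Qb B y)%:E))%E.
  apply: eq_integral => u _.
  have [Axu|nAxu] := pselect (A x u).
    rewrite indicE mem_set// mul1e (_ : [set v' | _ /\ _] = [set v | B y v]).
      by rewrite integral_indic// setIT /slice_pr fineK// fin_num_measure.
    by apply/seteqP; split => v //= -[].
  rewrite indicE memNset// mul0e (_ : [set v' | _ /\ _] = set0).
    by rewrite integral_indic// set0I measure0.
  by apply/seteqP; split => v //= -[].
rewrite ge0_integralZr//.
- by rewrite integral_indic// setIT EFinM /slice_pr !fineK// fin_num_measure.
- exact/measurable_EFinP/measurable_indic.
- by rewrite lee_fin slice_pr_ge0.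
Qed.

Lemma sk_pr_le E F : measurable (event E) -> measurable (event F) ->
  (forall x y u v, E x y u v -> F x y u v) -> sk_pr P Qa Qb E <= sk_pr P Qa Qb F.
Proof.
move=> mE mF EF; rewrite !sk_pr_event// fine_le ?fin_num_measure//.
by apply: le_measure; rewrite ?inE// => o; exact: EF.
Qed.

Lemma sk_pr_ge0 E : 0 <= sk_pr P Qa Qb E.
Proof.
by apply/fine_ge0; do 3 (apply: integral_ge0 => ? _); rewrite lee_fin.
Qed.
End SchemeMeasure.

Lemma expect_indic {R : realType} {d} {T : measurableType d} (Q : probability T R)
    (A : set T) : measurable A -> fine (Q A) = expect Q \1_A.
Proof. by move=> mA; rewrite /expect integral_indic// setIT. Qed.

Lemma sum_pr_disjoint {R : realType} {d} {T : measurableType d} (Q : probability T R)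
    (I : finType) (A : I -> set T) (B : set T) :
  (forall i, measurable (A i)) -> measurable B ->
  (forall i j t, A i t -> A j t -> i = j) -> (forall t, B t <-> exists i, A i t) ->
  \sum_i fine (Q (A i)) = fine (Q B).
Proof.
move=> mA mB tA AB; rewrite expect_indic//.
under eq_bigr do rewrite expect_indic//.
rewrite -(@expect_sum _ _ _ _ _ _ _ 1)//; last first.
  by move=> i t; rewrite indicE; case: (_ \in _); rewrite ?lexx ?ler01.
congr (expect Q); apply/funext => t.
have [/AB[i Ai]|nB] := pselect (B t).
  rewrite [RHS]indicE mem_set//; last by apply/AB; exists i.
  rewrite (bigD1 i)//= indicE mem_set// big1 ?addr0// => j ji.
  by rewrite indicE memNset// => Aj; rewrite (tA _ _ _ Aj Ai) eqxx in ji.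
rewrite [RHS]indicE memNset// big1// => j _; rewrite indicE memNset// => Aj.
by apply: nB; apply/AB; exists j.
Qed.

Lemma sum_pr_disjoint_le1 {R : realType} {d} {T : measurableType d} (Q : probability T R)
    (I : finType) (A : I -> set T) :
  (forall i, measurable (A i)) -> (forall i j t, A i t -> A j t -> i = j) ->
  \sum_i fine (Q (A i)) <= 1.
Proof.
move=> mA tA; have mB : measurable (\bigcup_(i in [set: I]) A i).
  by apply: fin_bigcup_measurable => // i _.
rewrite (@sum_pr_disjoint _ _ _ Q I A _ mA mB tA).
  by rewrite -lee_fin fineK ?fin_num_measure//; exact: probability_le1.
by move=> t; split=> [[i _ Ai]|[i Ai]]; exists i.
Qed.

Lemma esum_ge_finsum {R : realType} {T : choiceType} (I : finType) (h : I -> T)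
    (a : T -> R) : injective h ->
  ((\sum_i a (h i))%:E <= \esum_(t in [set: T]) (a t)%:E)%E.
Proof.
move=> hI; apply: esum_ge; exists [set` [seq h i | i <- index_enum I]].
  by split.
rewrite -fsbig_seq ?map_inj_uniq ?index_enum_uniq//.
by rewrite big_map sumEFin.
Qed.

Lemma cvg_sum_ord {R : realType} n (f : nat -> nat -> R) (c : nat -> R) :
  (forall i, f i @ \oo --> c i) ->
  (fun N => \sum_(i < n) f i N) @ \oo --> \sum_(i < n) c i.
Proof.
move=> fc; elim: n => [|n ih].
  by rewrite big_ord0; under eq_fun do rewrite big_ord0; exact: cvg_cst.
rewrite big_ord_recr/=; under eq_fun do rewrite big_ord_recr/=.
by apply: cvgD; [exact: ih|exact: fc].
Qed.

(** * Upper bound for one scheme *)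

Section ConverseBound.
Context {R : realType} {d1 d2 da db : measure_display}
        {T1 : measurableType d1} {T2 : measurableType d2}
        {Oa : measurableType da} {Ob : measurableType db}.
Variables (S : skaScheme T1 T2 Oa Ob)
  (P : probability (T1 * T2)%type R) (Qa : probability Oa R) (Qb : probability Ob R).
Hypothesis valid : sk_valid S P Qa Qb.
Hypothesis agree : sk_len_agree S P Qa Qb.

Let mmA h m : measurable [set xu : T1 * Oa | sk_msgA S h xu.1 xu.2 = m].
Proof. by case: valid. Qed.
Let mmB h m : measurable [set yv : T2 * Ob | sk_msgB S h yv.1 yv.2 = m].
Proof. by case: valid => _ []. Qed.
Let mlA w l : measurable [set x : T1 | sk_lenA S x w = l].
Proof. by case: valid => _ [_ []]. Qed.
Let mlB w l : measurable [set y : T2 | sk_lenB S y w = l].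
Proof. by case: valid => _ [_ [_ []]]. Qed.
Let mkA w a : measurable [set xu : T1 * Oa | sk_keyA S xu.1 xu.2 w = a].
Proof. by case: valid => _ [_ [_ [_ []]]]. Qed.
Let mkB w a : measurable [set yv : T2 * Ob | sk_keyB S yv.1 yv.2 w = a].
Proof. by case: valid => _ [_ [_ [_ [_ []]]]]. Qed.
Let kA_itv x u w : (1 <= sk_keyA S x u w <= 2 ^ sk_lenA S x w)%N.
Proof. by case: valid => _ [_ [_ [_ [_ [_ [_ [_ []]]]]]]]. Qed.
Let kB_itv y v w : (1 <= sk_keyB S y v w <= 2 ^ sk_lenB S y w)%N.
Proof. by case: valid => _ [_ [_ [_ [_ [_ [_ [_ []]]]]]]]. Qed.
Lemma measurable_prop {d} {T : measurableType d} (p : Prop) :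
  measurable [set t : T | p].
Proof.
have [h|h] := pselect p.
  by rewrite (_ : [set _ | _] = setT)//; apply/seteqP; split.
by rewrite (_ : [set _ | _] = set0)//; apply/seteqP; split.
Qed.

Lemma alice_ok_measurable w :
  measurable [set xu : T1 * Oa | alice_ok S w xu.1 xu.2].
Proof.
have -> : [set xu : T1 * Oa | alice_ok S w xu.1 xu.2] =
    [set xu | sk_stop S w] `&` \bigcap_k [set xu : T1 * Oa | (k < size w)%N ->
      ~~ sk_stop S (take k w) /\
      (~~ odd k -> sk_msgA S (take k w) xu.1 xu.2 = nth 0%N w k)].
  apply/seteqP; split => xu /=.
    by move=> [sw h]; split => // k _ /=; exact: h.
  by move=> [sw h]; split => // k kw; exact: h.
apply: measurableI; first exact: measurable_prop.
apply: bigcapT_measurable => k; have [kw|kw] := ltnP k (size w); last first.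
  by rewrite (_ : [set _ | _] = setT)//; apply/seteqP; split.
have [ok|ok] := boolP (odd k).
  rewrite (_ : [set _ | _] = [set xu | ~~ sk_stop S (take k w)]).
    exact: measurable_prop.
  by apply/seteqP; split => xu /=; [move/(_ erefl) => -[]|].
rewrite (_ : [set _ | _] = [set xu | ~~ sk_stop S (take k w)] `&`
   [set xu : T1 * Oa | sk_msgA S (take k w) xu.1 xu.2 = nth 0%N w k]).
  by apply: measurableI => //; exact: measurable_prop.
apply/seteqP; split => xu /=; first by move/(_ erefl) => -[h1 /(_ erefl)].
by move=> [h1 h2] _.
Qed.

Lemma bob_ok_measurable w :
  measurable [set yv : T2 * Ob | bob_ok S w yv.1 yv.2].
Proof.
have -> : [set yv : T2 * Ob | bob_ok S w yv.1 yv.2] =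
    \bigcap_k [set yv : T2 * Ob | (k < size w)%N -> odd k ->
       sk_msgB S (take k w) yv.1 yv.2 = nth 0%N w k].
  by apply/seteqP; split => yv /=; [move=> h k _ /=; exact: h|move=> h k kw; exact: h].
apply: bigcapT_measurable => k; have [kw|kw] := ltnP k (size w); last first.
  by rewrite (_ : [set _ | _] = setT)//; apply/seteqP; split.
have [ok|ok] := boolP (odd k); last first.
  by rewrite (_ : [set _ | _] = setT)//; apply/seteqP; split.
rewrite (_ : [set _ | _] = [set yv : T2 * Ob | sk_msgB S (take k w) yv.1 yv.2 = nth 0%N w k])//.
by apply/seteqP; split => yv /=; [move=> /(_ erefl erefl)|].
Qed.

(** Each side refers to that party's own length, which keeps the event a rectangle; the two lengths
    differ only on a null event. *)
Definition alice_side w l (x : T1) (u : Oa) : Prop := alice_ok S w x u /\ sk_lenA S x w = l.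
Definition bob_side w l (y : T2) (v : Ob) : Prop := bob_ok S w y v /\ sk_lenB S y w = l.
Definition alice_key w l a (x : T1) (u : Oa) : Prop := alice_side w l x u /\ sk_keyA S x u w = a.
Definition bob_key w l b (y : T2) (v : Ob) : Prop := bob_side w l y v /\ sk_keyB S y v w = b.

Lemma lenA_measurable w l : measurable [set xu : T1 * Oa | sk_lenA S xu.1 w = l].
Proof.
rewrite -[X in measurable X]setTI.
exact: (measurable_fst measurableT _ (mlA w l)).
Qed.
Lemma lenB_measurable w l : measurable [set yv : T2 * Ob | sk_lenB S yv.1 w = l].
Proof.
rewrite -[X in measurable X]setTI.
exact: (measurable_fst measurableT _ (mlB w l)).
Qed.

Lemma alice_side_measurable w l : measurable [set xu : T1 * Oa | alice_side w l xu.1 xu.2].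
Proof. exact: measurableI (alice_ok_measurable w) (lenA_measurable w l). Qed.
Lemma bob_side_measurable w l : measurable [set yv : T2 * Ob | bob_side w l yv.1 yv.2].
Proof. exact: measurableI (bob_ok_measurable w) (lenB_measurable w l). Qed.
Lemma alice_key_measurable w l a : measurable [set xu : T1 * Oa | alice_key w l a xu.1 xu.2].
Proof. exact: measurableI (alice_side_measurable w l) (mkA w a). Qed.
Lemma bob_key_measurable w l b : measurable [set yv : T2 * Ob | bob_key w l b yv.1 yv.2].
Proof. exact: measurableI (bob_side_measurable w l) (mkB w b). Qed.

Lemma event_and (E F : T1 -> T2 -> Oa -> Ob -> Prop) :
  measurable (event E) -> measurable (event F) ->
  measurable (event (fun x y u v => E x y u v /\ F x y u v)).
Proof. exact: measurableI. Qed.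

Lemma event_term_measurable w : measurable (event (fun x y u v => sk_term S w x y u v)).
Proof.
rewrite (_ : event _ = event (fun x y u v => alice_ok S w x u /\ bob_ok S w y v)).
  apply: (@event_and (fun x y u v => alice_ok S w x u) (fun x y u v => bob_ok S w y v)).
    exact: (event_alice_measurable (alice_ok_measurable w)).
  exact: (event_bob_measurable (bob_ok_measurable w)).
by apply/seteqP; split => o; rewrite /event/= sk_termP.
Qed.

Definition len_mismatch (x : T1) (y : T2) (u : Oa) (v : Ob) : Prop :=
  exists w, sk_term S w x y u v /\ sk_lenA S x w <> sk_lenB S y w.

Lemma len_mismatch_measurable : measurable (event len_mismatch).
Proof.
rewrite (_ : event _ = \bigcup_(w in [set: seq nat])
    (event (fun x y u v => sk_term S w x y u v) `&`
    ~` \bigcup_l (event (fun x y u v => sk_lenA S x w = l) `&`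
                  event (fun x y u v => sk_lenB S y w = l)))).
  apply: countable_bigcupT_measurable => // w.
  apply: measurableI; first exact: event_term_measurable.
  apply/measurableC/bigcupT_measurable => l; apply: measurableI.
    exact: (@event_alice_measurable _ _ _ _ _ _ _ _ (fun x u => sk_lenA S x w = l) (lenA_measurable w l)).
  exact: (@event_bob_measurable _ _ _ _ _ _ _ _ (fun y v => sk_lenB S y w = l) (lenB_measurable w l)).
apply/seteqP; split => [z [w [tw nl]]|z [w _ [tw nl]]].
  by exists w => //; split => // -[l _ []]; rewrite /event/= => e1 e2; apply: nl; rewrite e1 e2.
exists w; split => // e; apply: nl; exists (sk_lenA S z.1.1.1 w) => //; split => //.
Qed.

Lemma sk_pr_le_agree E F : measurable (event E) -> measurable (event F) ->
  (forall x y u v, E x y u v -> ~ len_mismatch x y u v -> F x y u v) ->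
  sk_pr P Qa Qb E <= sk_pr P Qa Qb F.
Proof.
move=> mE mF EF; rewrite !sk_pr_event//.
have mM := len_mismatch_measurable.
have M0 : total_law P Qa Qb (event len_mismatch) = 0%E.
  rewrite -[LHS]fineK ?fin_num_measure// -sk_pr_event//.
  by congr (_%:E); exact: agree.
rewrite fine_le ?fin_num_measure//.
apply: (@le_trans _ _ (total_law P Qa Qb (event F `|` event len_mismatch))).
  apply: le_measure; rewrite ?inE//; first exact: measurableU.
  move=> o Eo; have [mo|mo] := pselect (event len_mismatch o); first by right.
  by left; exact: EF.
apply: (le_trans (measureU2 _ _ _)) => //.
by rewrite [X in (_ + X)%E]M0 adde0.
Qed.

Lemma sk_pr_eq_agree E F : measurable (event E) -> measurable (event F) ->
  (forall x y u v, ~ len_mismatch x y u v -> E x y u v <-> F x y u v) ->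
  sk_pr P Qa Qb E = sk_pr P Qa Qb F.
Proof.
move=> mE mF EF; apply/le_anti/andP; split.
  by apply: sk_pr_le_agree => // x y u v h1 /EF[+ _]; exact.
by apply: sk_pr_le_agree => // x y u v h1 /EF[_ +]; exact.
Qed.

Lemma event_rect_measurable (A : T1 -> Oa -> Prop) (B : T2 -> Ob -> Prop) :
  measurable [set xu : T1 * Oa | A xu.1 xu.2] ->
  measurable [set yv : T2 * Ob | B yv.1 yv.2] ->
  measurable (event (fun x y u v => A x u /\ B y v)).
Proof.
move=> mA mB; apply: (@event_and (fun x y u v => A x u) (fun x y u v => B y v)).
  exact: event_alice_measurable mA.
exact: event_bob_measurable mB.
Qed.

Lemma event_WL_measurable w l :
  measurable (event (fun x y u v => sk_term S w x y u v /\ sk_lenA S x w = l)).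
Proof.
apply: event_and; first exact: event_term_measurable.
exact: (@event_alice_measurable _ _ _ _ _ _ _ _ (fun x u => sk_lenA S x w = l) (lenA_measurable w l)).
Qed.

Lemma event_ABWL_measurable a b w l : measurable (event (fun x y u v =>
  [/\ sk_term S w x y u v, sk_keyA S x u w = a, sk_keyB S y v w = b & sk_lenA S x w = l])).
Proof.
rewrite (_ : event _ = event (fun x y u v => (sk_term S w x y u v /\ sk_lenA S x w = l) /\
    (sk_keyA S x u w = a /\ sk_keyB S y v w = b))).
  apply: event_and; first exact: event_WL_measurable.
  exact: (@event_rect_measurable (fun x u => sk_keyA S x u w = a) (fun y v => sk_keyB S y v w = b)).
by apply/seteqP; split => o; rewrite /event/=; [case|case=> -[? ?] []].
Qed.

Lemma sk_pABWL_rect a b w l : sk_pABWL S P Qa Qb a b w l =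
  expect P (fun z => slice_pr Qa (alice_key w l a) z.1 * slice_pr Qb (bob_key w l b) z.2).
Proof.
rewrite -(sk_pr_rect _ _ _ (alice_key_measurable w l a) (bob_key_measurable w l b)).
apply: sk_pr_eq_agree; first exact: event_ABWL_measurable.
  exact: event_rect_measurable (alice_key_measurable w l a) (bob_key_measurable w l b).
move=> x y u v nm; split.
  move=> [tw ka kb la]; have /sk_termP[aok bok] := tw.
  split; split => //; split => //; apply: contrapT => lb.
  by apply: nm; exists w; split => // e; apply: lb; rewrite -e.
move=> [[[aok la] ka] [[bok lb] kb]]; split => //.
by apply/sk_termP.
Qed.

Lemma event_L_measurable l :
  measurable (event (fun x y u v => exists w, sk_term S w x y u v /\ sk_lenA S x w = l)).
Proof.
rewrite (_ : event _ = \bigcup_(w in [set: seq nat])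
    (event (fun x y u v => sk_term S w x y u v /\ sk_lenA S x w = l))).
  by apply: countable_bigcupT_measurable => // w; exact: event_WL_measurable.
by apply/seteqP; split => [z [w h]|z [w _ h]]; exists w.
Qed.

Lemma sk_pWL_le_pL w l : sk_pWL S P Qa Qb w l <= sk_pL S P Qa Qb l.
Proof.
apply: sk_pr_le; [exact: event_WL_measurable|exact: event_L_measurable|].
by move=> x y u v h; exists w.
Qed.

Lemma sk_pABWL_le_pL a b w l : sk_pABWL S P Qa Qb a b w l <= sk_pL S P Qa Qb l.
Proof.
apply: sk_pr_le; [exact: event_ABWL_measurable|exact: event_L_measurable|].
by move=> x y u v [h _ _ hl]; exists w.
Qed.

Section FiniteFamily.
(** [data_processing] takes finitely many outcomes: transcripts from [s], lengths below [M]. Keys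
    start at 1, hence the successors below. *)
Variables (s : seq (seq nat)) (M : nat).
Hypothesis us : uniq s.
Let J : finType := ('I_(size s) * 'I_M)%type.
Let tr (j : J) : seq nat := nth [::] s j.1.
Let len (j : J) : nat := j.2.
Let a (j : J) (k : 'I_(2 ^ len j)) : T1 -> R :=
  slice_pr Qa (alice_key (tr j) (len j) k.+1).
Let b (j : J) (k : 'I_(2 ^ len j)) : T2 -> R :=
  slice_pr Qb (bob_key (tr j) (len j) k.+1).

Let tr_len_inj (j j' : J) : tr j = tr j' -> len j = len j' -> j = j'.
Proof.
case: j j' => [i l] [i' l']; rewrite /tr /len/= => /eqP; rewrite nth_uniq// => /eqP/val_inj ->.
by move/val_inj ->.
Qed.

Let sumA (j : J) x : \sum_(k < 2 ^ len j) @a j k x = slice_pr Qa (alice_side (tr j) (len j)) x.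
Proof.
apply: sum_pr_disjoint.
- by move=> k; exact: slice_measurable (alice_key_measurable _ _ _).
- exact: slice_measurable (alice_side_measurable _ _).
- by move=> i k u [_ ei] [_]; rewrite ei => -[] /val_inj.
- move=> u; split; last by move=> [k []].
  move=> h; have [_ la] := h; have /andP[k1 k2] := kA_itv x u (tr j).
  rewrite la in k2; have k3 : ((sk_keyA S x u (tr j)).-1 < 2 ^ len j)%N by rewrite prednK.
  by exists (Ordinal k3); split => //=; rewrite prednK.
Qed.

Let sumB (j : J) y : \sum_(k < 2 ^ len j) @b j k y = slice_pr Qb (bob_side (tr j) (len j)) y.
Proof.
apply: sum_pr_disjoint.
- by move=> k; exact: slice_measurable (bob_key_measurable _ _ _).
- exact: slice_measurable (bob_side_measurable _ _).
- by move=> i k u [_ ei] [_]; rewrite ei => -[] /val_inj.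
- move=> v; split; last by move=> [k []].
  move=> h; have [_ la] := h; have /andP[k1 k2] := kB_itv y v (tr j).
  rewrite la in k2; have k3 : ((sk_keyB S y v (tr j)).-1 < 2 ^ len j)%N by rewrite prednK.
  by exists (Ordinal k3); split => //=; rewrite prednK.
Qed.

Let slice_le1 {d d'} {T : measurableType d} {O : measurableType d'}
  (Q : probability O R) (A : T -> O -> Prop) x :
  measurable [set xu : T * O | A xu.1 xu.2] -> slice_pr Q A x <= 1.
Proof.
move=> /(slice_measurable x) mA; rewrite /slice_pr -lee_fin fineK ?fin_num_measure//.
exact: probability_le1.
Qed.

Let side_uniq (j j' : J) x y u v : alice_side (tr j) (len j) x u ->
  bob_side (tr j) (len j) y v -> alice_side (tr j') (len j') x u ->
  bob_side (tr j') (len j') y v -> j = j'.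
Proof.
move=> [aj lj] [bj _] [aj' lj'] [bj' _].
have e : tr j = tr j'.
  by apply: (@sk_term_uniq _ _ _ _ _ _ _ _ S _ _ x y u v); apply/sk_termP.
by apply: tr_len_inj => //; rewrite -lj -lj' e.
Qed.

(** For fixed (x, y) the summands are probabilities, under the private randomness, of pairwise
    disjoint rectangles: (x, y, u, v) determines the transcript, and x with the transcript
    determines the length. *)
Let rect_le1 x y : \sum_(j : J) (\sum_(k < 2 ^ len j) @a j k x) * (\sum_(k < 2 ^ len j) @b j k y) <= 1.
Proof.
under eq_bigr do rewrite sumA sumB.
have mX (j : J) := slice_measurable x (alice_side_measurable (tr j) (len j)).
have mY (j : J) := slice_measurable y (bob_side_measurable (tr j) (len j)).
rewrite (eq_bigr (fun j : J => fine ((Qa \x Qb)%E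
  ([set u | alice_side (tr j) (len j) x u] `*` [set v | bob_side (tr j) (len j) y v])))).
  apply: sum_pr_disjoint_le1 => [j|j j' [u v] [/= h1 h2] [/= h3 h4]].
    exact: measurableX.
  exact: side_uniq h1 h2 h3 h4.
move=> j _; rewrite product_measure1E// fineM ?fin_num_measure//.
Qed.

Let key_prE (j : J) (k k' : 'I_(2 ^ len j)) :
  @key_pr R _ _ _ _ P J len a b j k k' = sk_pABWL S P Qa Qb k.+1 k'.+1 (tr j) (len j).
Proof. by rewrite sk_pABWL_rect. Qed.

Let side_pr (j : J) : fine (total_law P Qa Qb
   (event (fun x y u v => alice_side (tr j) (len j) x u /\ bob_side (tr j) (len j) y v))) =
  sk_pWL S P Qa Qb (tr j) (len j).
Proof.
have m := event_rect_measurable (alice_side_measurable (tr j) (len j))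
  (bob_side_measurable (tr j) (len j)).
rewrite -(sk_pr_event _ _ _ m); apply: sk_pr_eq_agree; [exact: m|exact: event_WL_measurable|].
move=> x y u v nm; split=> [[[aok la] [bok lb]]|[tw la]].
  by split => //; apply/sk_termP.
have /sk_termP[aok bok] := tw; split; split => //.
by apply: contrapT => lb; apply: nm; exists (tr j); split => // e; apply: lb; rewrite -e.
Qed.

Let msg_prE (j : J) : msg_pr P a b j = sk_pWL S P Qa Qb (tr j) (len j).
Proof.
rewrite -side_pr /msg_pr pair_bigA/=.
pose E (kk : 'I_(2 ^ len j) * 'I_(2 ^ len j)) := event (fun x y u v =>
  alice_key (tr j) (len j) kk.1.+1 x u /\ bob_key (tr j) (len j) kk.2.+1 y v).
have mE kk : measurable (E kk).
  exact: event_rect_measurable (alice_key_measurable _ _ _) (bob_key_measurable _ _ _).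
rewrite (eq_bigr (fun kk => fine (total_law P Qa Qb (E kk)))); last first.
  move=> kk _; rewrite -sk_pr_event; last exact: mE.
  by rewrite sk_pr_rect//; [exact: alice_key_measurable|exact: bob_key_measurable].
apply: sum_pr_disjoint => //.
- exact: event_rect_measurable (alice_side_measurable _ _) (bob_side_measurable _ _).
- move=> [k1 k2] [k3 k4] z; rewrite /E /event/= => -[[_ e1] [_ e2]] [[_ e3] [_ e4]].
  by move: e3 e4; rewrite e1 e2 => -[/val_inj ->] [/val_inj ->].
- move=> z; split; last by move=> [kk [[? _] [? _]]].
  move=> [hA hB]; have [_ la] := hA; have [_ lb] := hB.
  have /andP[k1 k2] := kA_itv z.1.1.1 z.1.2 (tr j).
  have /andP[k3 k4] := kB_itv z.1.1.2 z.2 (tr j).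
  rewrite la in k2; rewrite lb in k4.
  have k5 : ((sk_keyA S z.1.1.1 z.1.2 (tr j)).-1 < 2 ^ len j)%N by rewrite prednK.
  have k6 : ((sk_keyB S z.1.1.2 z.2 (tr j)).-1 < 2 ^ len j)%N by rewrite prednK.
  by exists (Ordinal k5, Ordinal k6); split; split => //=; rewrite prednK.
Qed.

Let msg_pr_sum : \sum_(j : J) msg_pr P a b j <= 1.
Proof.
rewrite (eq_bigr (fun j => fine (total_law P Qa Qb (event (fun x y u v =>
    alice_side (tr j) (len j) x u /\ bob_side (tr j) (len j) y v))))).
  apply: sum_pr_disjoint_le1 => [j|j j' z [h1 h2] [h3 h4]].
    exact: event_rect_measurable (alice_side_measurable _ _) (bob_side_measurable _ _).
  exact: side_uniq h1 h2 h3 h4.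
by move=> j _; rewrite msg_prE side_pr.
Qed.

(** The deviations of length [l] are terms of the sum in [sk_dist_l], scaled by the probability of
    that length; the 2 undoes the factor 1/2 there. *)
Let dev_sum (eps : R) (l : 'I_M) : 0 <= eps -> sk_dist_le S P Qa Qb eps ->
  \sum_(i < size s) key_dev P a b (i, l) <= 2 * (eps * sk_pL S P Qa Qb l).
Proof.
move=> eps0 dist; have pL0 : 0 <= sk_pL S P Qa Qb l by exact: sk_pr_ge0.
(* For a length of probability 0 the distance hypothesis says nothing, but every term vanishes. *)
have [p0|p0] := eqVneq (sk_pL S P Qa Qb l) 0.
  rewrite p0 !mulr0 big1// => i _; rewrite /key_dev big1// => k _; rewrite big1// => k' _.
  rewrite key_prE msg_prE.
  have -> : sk_pABWL S P Qa Qb k.+1 k'.+1 (tr (i, l)) (len (i, l)) = 0.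
    by apply/le_anti; rewrite sk_pr_ge0 -[X in _ <= X]p0 sk_pABWL_le_pL.
  have -> : sk_pWL S P Qa Qb (tr (i, l)) (len (i, l)) = 0.
    by apply/le_anti; rewrite sk_pr_ge0 -[X in _ <= X]p0 sk_pWL_le_pL.
  by rewrite mulr0 if_same subrr normr0.
have {p0}p0 : 0 < sk_pL S P Qa Qb l by rewrite lt0r p0.
rewrite mulrA -ler_pdivrMr//.
have := dist l p0; rewrite /sk_dist_l.
pose K := ('I_(size s) * ('I_(2 ^ l) * 'I_(2 ^ l)))%type.
pose h (t : K) : nat * nat * seq nat := (t.2.1.+1, t.2.2.+1, nth [::] s t.1).
have hI : injective h.
  move=> [i [k k']] [i' [k2 k2']] [/val_inj -> /val_inj -> /eqP].
  by rewrite nth_uniq// => /eqP/val_inj ->.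
set g := (X in \esum_(o in _) X o).
have g0 o : (0 <= g o)%E by rewrite lee_fin.
have := esum_ge_finsum (fun o => fine (g o)) hI.
rewrite (_ : (fun t => (fine (g t))%:E) = g); last by apply/funext.
set E := \esum_(o in _) _ => hE hd.
have : (\sum_i fine (g (h i)) <= 2 * eps).
  rewrite -lee_fin; apply: (le_trans hE).
  have -> : E = (2%:E * ((2^-1)%:E * E))%E.
    by rewrite muleA -EFinM divff// mul1e.
  by rewrite EFinM lee_pmul2l.
apply: le_trans; rewrite mulr_suml -(pair_bigA _ (fun i kk => fine (g (h (i, kk)))))/=.
apply: ler_sum => i _; rewrite /key_dev mulr_suml.
rewrite -(pair_bigA _ (fun k k' => fine (g (h (i, (k, k'))))))/=.
apply: ler_sum => k _; rewrite mulr_suml; apply: ler_sum => k' _.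
rewrite key_prE msg_prE /h/= -[X in `|_| * X]ger0_norm ?invr_ge0// -normrM mulrBl.
have kl : (k < 2 ^ l)%N by exact: ltn_ord k.
rewrite eqSS (inj_eq val_inj) kl andbT.
by case: ifP => _; rewrite ?mul0r// mulrA.
Qed.

Lemma finite_family_bound (eps I : R) : mutual_info P = I%:E -> 0 <= eps ->
  sk_dist_le S P Qa Qb eps ->
  \sum_(l < M) l%:R * (\sum_(w <- s) sk_pWL S P Qa Qb w l - eps * sk_pL S P Qa Qb l) <= I + 2.
Proof.
move=> PI eps0 dist.
have mA (j : J) (k : 'I_(2 ^ len j)) : measurable_fun setT (@a j k).
  exact: slice_pr_measurable (alice_key_measurable _ _ _).
have mB (j : J) (k : 'I_(2 ^ len j)) : measurable_fun setT (@b j k).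
  exact: slice_pr_measurable (bob_key_measurable _ _ _).
have a0 (j : J) (k : 'I_(2 ^ len j)) x : 0 <= @a j k x by exact: slice_pr_ge0.
have b0 (j : J) (k : 'I_(2 ^ len j)) x : 0 <= @b j k x by exact: slice_pr_ge0.
have a1 (j : J) x : \sum_(k < 2 ^ len j) @a j k x <= 1.
  by rewrite sumA slice_le1//; exact: alice_side_measurable.
have b1 (j : J) x : \sum_(k < 2 ^ len j) @b j k x <= 1.
  by rewrite sumB slice_le1//; exact: bob_side_measurable.
apply: le_trans (key_rate_bound mA mB a0 b0 a1 b1 rect_le1 PI msg_pr_sum).
rewrite -(pair_bigA _ (fun i l => (len (i, l))%:R *
  (msg_pr P a b (i, l) - 2^-1 * key_dev P a b (i, l))))/= exchange_big/=.
apply: ler_sum => l _; rewrite -mulr_sumr ler_wpM2l// sumrB -mulr_sumr lerB//.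
  rewrite (big_nth [::]) big_mkord le_eqVlt; apply/orP; left; apply/eqP.
  by apply: eq_bigr => i _; rewrite msg_prE.
rewrite mulrC ler_pdivrMr// [leRHS]mulrC.
exact: dev_sum.
Qed.
End FiniteFamily.

Definition transcripts_upto (N : nat) : seq (seq nat) :=
  pmap (@pickle_inv (seq nat)) (iota 0 N).

(** Countable additivity over transcripts, enumerated by their codes. *)
Lemma sk_pWL_cvg l :
  (fun N => \sum_(w <- transcripts_upto N) sk_pWL S P Qa Qb w l) @ \oo --> sk_pL S P Qa Qb l.
Proof.
pose F n := event (fun x y u v => if @pickle_inv (seq nat) n is Some w then
  sk_term S w x y u v /\ sk_lenA S x w = l else False).
have mF n : measurable (F n).
  rewrite /F; case: pickle_inv => [w|]; first exact: event_WL_measurable.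
  exact: measurable_prop.
have tF : trivIset setT F.
  move=> i j _ _ [z []]; rewrite /F /event/=.
  case ei : (pickle_inv i) => [w|//]; case ej : (pickle_inv j) => [w'|//] [h1 _] [h2 _].
  have := pickle_invK (T := seq nat) i; have := pickle_invK (T := seq nat) j.
  by rewrite ei ej /= (sk_term_uniq h1 h2) => -> ->.
have UF : \bigcup_n F n =
    event (fun x y u v => exists w, sk_term S w x y u v /\ sk_lenA S x w = l).
  apply/seteqP; split => [z [n _]|z [w h]].
    by rewrite /F /event/=; case: pickle_inv => // w h; exists w.
  by exists (pickle w) => //; rewrite /F /event/= pickleK_inv.
have := @measure_sigma_additive _ _ _ (total_law P Qa Qb) F mF tF.
rewrite UF -[X in _ --> X]fineK; last by rewrite fin_num_measure//; exact: event_L_measurable.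
rewrite -sk_pr_event; last exact: event_L_measurable.
move=> /fine_cvgP[_]; apply: cvg_trans; apply: near_eq_cvg; apply: nearW => N /=.
have -> : \sum_(0 <= i < N) total_law P Qa Qb (F i) =
    (\sum_(0 <= i < N) fine (total_law P Qa Qb (F i)))%:E.
  by rewrite -sumEFin; apply: eq_bigr => i _; rewrite fineK// fin_num_measure.
rewrite /= /transcripts_upto big_pmap /index_iota subn0.
apply: eq_bigr => n _; rewrite /F; case: pickle_inv => [w|] /=.
  by rewrite /sk_pWL sk_pr_event//; exact: event_WL_measurable.
by rewrite (_ : event _ = set0) ?measure0//; apply/seteqP; split.
Qed.

(** With the lengths bounded by [M], the transcripts are exhausted first, which turns each bracket
    of [finite_family_bound] into (1 - eps) times the probability of that length; only then does [M]
    grow. *)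
Lemma sk_EL_le (eps I : R) : 0 <= eps -> eps < 1 -> mutual_info P = I%:E ->
  sk_dist_le S P Qa Qb eps -> (sk_EL S P Qa Qb <= ((1 - eps)^-1 * (I + 2))%:E)%E.
Proof.
move=> eps0 eps1 PI dist.
have e1 : 0 < 1 - eps by rewrite subr_gt0.
have fin M : \sum_(l < M) l%:R * sk_pL S P Qa Qb l <= (1 - eps)^-1 * (I + 2).
  rewrite mulrC ler_pdivlMr// mulr_suml.
  have h l : (fun N => l%:R * (\sum_(w <- transcripts_upto N) sk_pWL S P Qa Qb w l -
      eps * sk_pL S P Qa Qb l)) @ \oo --> l%:R * sk_pL S P Qa Qb l * (1 - eps).
    rewrite -mulrA; apply: cvgMr.
    rewrite mulrBr mulr1 [X in _ - X]mulrC.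
    by apply: cvgB; [exact: sk_pWL_cvg|exact: cvg_cst].
  apply: (cvgr_to_le (cvg_sum_ord (n := M) h)).
  apply: nearW => N; apply: finite_family_bound => //.
  apply: (@pmap_uniq _ _ _ pickle); [exact: pickle_invK|exact: iota_uniq].
rewrite /sk_EL -nneseries_esumT; last first.
  by move=> n; rewrite lee_fin mulr_ge0// sk_pr_ge0.
apply: lime_le.
  by apply: is_cvg_nneseries => n _ _; rewrite lee_fin mulr_ge0// sk_pr_ge0.
apply: nearW => M; rewrite sumEFin lee_fin big_mkord; exact: fin.
Qed.
End ConverseBound.

Lemma Lstar_le {R : realType} {d1 d2 : measure_display}
    {T1 : measurableType d1} {T2 : measurableType d2}
    (P : probability (T1 * T2)%type R) (eps I : R) : 0 <= eps -> eps < 1 ->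
  mutual_info P = I%:E ->
  (Lstar P eps <= ((1 - eps)^-1 * (I + log2 3 + 1))%:E)%E.
Proof.
move=> e0 e1 PI; apply: ge_ereal_sup => _ [da [db [Oa [Ob [Qa [Qb [S [v a d ->]]]]]]]].
apply: (le_trans (sk_EL_le v a e0 e1 PI d)).
(* The constant obtained is 2, and log2 3 >= 1. *)
rewrite lee_fin ler_pM2l ?invr_gt0 ?subr_gt0// -addrA lerD2l.
rewrite -lerBlDr /log2 ler_pdivlMr ?ln2_gt0//.
have -> : 2 - 1 = 1 :> R by lra.
by rewrite mul1r ler_ln ?posrE// ler_nat.
Qed.

(** * Dyadic blocks *)

Section DyadicBlocks.
Local Open Scope nat_scope.
Variables (n v : nat).

Definition block_fits (l i : nat) : bool := (i %/ 2 ^ l).+1 * 2 ^ l <= n.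

(* Exponent of the largest aligned dyadic block of size at most [2 ^ v] that
   contains [i] and lies inside [0, n). *)
Definition block_exp (i : nat) : nat := \max_(l < v.+1 | block_fits l i) l.

Lemma block_exp_le i : block_exp i <= v.
Proof. by apply/bigmax_leqP => l _; rewrite -ltnS. Qed.

Lemma block_fits0 i : i < n -> block_fits 0 i.
Proof. by rewrite /block_fits expn0 divn1 muln1. Qed.

Lemma block_exp_fits i : i < n -> block_fits (block_exp i) i.
Proof.
move=> ltin; have c0 : block_fits (@ord0 v) i by exact: block_fits0.
by rewrite /block_exp; have [|l fl ->] := @eq_bigmax_cond _ [pred l : 'I_v.+1 | block_fits l i] (fun l => l : nat);
  [apply/card_gt0P; exists ord0 | ].
Qed.

Lemma block_fits_leq l l' i : l' <= l -> block_fits l i -> block_fits l' i.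
Proof.
rewrite /block_fits => /subnK <-; apply: leq_trans.
rewrite expnD mulnA leq_mul2r -addn1; apply/orP; right.
rewrite [2 ^ (l - l') * _]mulnC divnMA -ltn_divLR ?expn_gt0// addn1.
Qed.

Lemma block_exp_lt l i : 0 < l <= v -> (block_exp i < l) = ~~ block_fits l i.
Proof.
move=> /andP[l0 lv]; apply/idP/idP.
  apply: contraL => fl; rewrite -leqNgt.
  exact: (@leq_bigmax_cond _ (fun m : 'I_v.+1 => block_fits m i) (fun m => m : nat) (Ordinal (lv : l < v.+1))).
move=> nf; rewrite ltnNge; apply: contra nf => le.
have l0' : 0 < block_exp i by exact: leq_trans le.
apply: (block_fits_leq le); move: l0'; rewrite /block_exp.
have [c0|c0 _] := posnP #|[pred m : 'I_v.+1 | block_fits m i]|.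
  by rewrite big_pred0// => m; exact: (card0_eq c0 m).
by have [m fm ->] := @eq_bigmax_cond _ [pred m : 'I_v.+1 | block_fits m i] (fun m => m : nat) c0.
Qed.

(** For l >= L whether a block fits depends only on the L-block of the index, so a whole block
    shares its exponent. Hence the maximal blocks partition [0, n). *)
Lemma block_exp_same i i' : i < n ->
  i' %/ 2 ^ block_exp i = i %/ 2 ^ block_exp i -> i' < n /\ block_exp i' = block_exp i.
Proof.
move=> ltin e; set L := block_exp i.
have same l : L <= l -> block_fits l i' = block_fits l i.
  move=> Ll; rewrite /block_fits -(subnKC Ll) expnD.
  by rewrite !divnMA e.
have fi' : block_fits L i' by rewrite same// block_exp_fits.
have ltin' : i' < n.
  apply: leq_trans fi'; rewrite -ltn_divLR ?expn_gt0//.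
split => //; apply/eqP; rewrite eqn_leq; apply/andP; split.
  have h := block_exp_fits ltin'.
  rewrite leqNgt; apply/negP => lt.
  have : L < block_exp i' <= v by rewrite lt block_exp_le.
  move=> /andP[_ le].
  have := @block_exp_lt (block_exp i') i; rewrite (leq_trans _ lt)//= le => /(_ isT).
  by rewrite -/L lt -(same _ (ltnW lt)) h.
exact: (@leq_bigmax_cond _ (fun m : 'I_v.+1 => block_fits m i') (fun m => m : nat)
  (Ordinal (block_exp_le i : L < v.+1))).
Qed.

(** Only indices in the last, incomplete block of size 2^l fail. *)
Lemma card_block_unfit l : #|[pred i : 'I_n | ~~ block_fits l i]| <= 2 ^ l.
Proof.
have -> : #|[pred i : 'I_n | ~~ block_fits l i]| =
    count (fun i => ~~ block_fits l i) (iota 0 n).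
  by rewrite cardE /enum_mem size_filter -val_enum_ord count_map enumT.
rewrite -size_filter.
have sub : {subset [seq i <- iota 0 n | ~~ block_fits l i] <= iota (n %/ 2 ^ l * 2 ^ l) (2 ^ l)}.
  move=> i; rewrite mem_filter !mem_iota /= add0n => /andP[+ ltin].
  rewrite /block_fits -ltnNge => h; apply/andP; split.
    rewrite -ltn_divLR ?expn_gt0// ltnS in h.
    by apply: leq_trans (leq_trunc_div i (2 ^ l)); rewrite leq_mul2r h orbT.
  by apply: (leq_trans ltin); rewrite {1}(divn_eq n (2 ^ l)) leq_add2l ltnW// ltn_mod expn_gt0.
rewrite -(size_iota (n %/ 2 ^ l * 2 ^ l) (2 ^ l)).
by apply: uniq_leq_size sub; rewrite filter_uniq// iota_uniq.
Qed.
End DyadicBlocks.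

(** * The hashing protocol *)

Section DeviationOfKeys.
Context {R : realType} {W : finType}.
Variables (wt : W -> R) (D : pred W) (n : nat) (A B : W -> 'I_n).
Hypothesis wt0 : forall o, 0 <= wt o.

(** Compares the laws of (A, B) and (A, A). An outcome with A = B cancels; one with A <> B is
    charged once off and once on the diagonal. *)
Lemma key_mismatch_dev :
  \sum_(a < n) \sum_(b < n) `|\sum_(o | D o && ((A o == a) && (B o == b))) wt o -
      (if a == b then \sum_(o | D o && (A o == a)) wt o else 0)| <=
  2 * \sum_(o | D o && (A o != B o)) wt o.
Proof.
pose f (a b : 'I_n) o : R := wt o *
  ((A o == a) && (B o == b) && (a != b))%:R + wt o * ((a == b) && (A o == a) && (B o != a))%:R.
apply: (@le_trans _ _ (\sum_(a < n) \sum_(b < n) \sum_(o | D o) f a b o)).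
  apply: ler_sum => a _; apply: ler_sum => b _.
  have [->|ab] := eqVneq a b.
    rewrite ler0_norm.
      rewrite opprB lerBlDr big_mkcondr [X in _ <= _ + X]big_mkcondr/= -big_split/=.
      apply: ler_sum => o _; rewrite /f eqxx/= andbF mulr0 add0r.
      by case: (A o == b) => /=; case: (B o == b) => /=; rewrite ?mulr0 ?mulr1 ?addr0 ?add0r ?lexx.
    rewrite subr_le0 big_mkcondr [leRHS]big_mkcondr/=; apply: ler_sum => o _.
    by case: (A o == b); case: (B o == b).
  rewrite subr0 ger0_norm ?sumr_ge0// big_mkcondr/=; apply: ler_sum => o _.
  rewrite /f (negbTE ab)/= mulr0 addr0 andbT.
  by case: (_ && _); rewrite ?mulr1 ?mulr0.
rewrite le_eqVlt; apply/orP; left; apply/eqP.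
under eq_bigr do rewrite exchange_big/=.
rewrite exchange_big/= big_mkcondr/= mulr_sumr; apply: eq_bigr => o _.
rewrite /f; under eq_bigr do rewrite big_split/= -!mulr_sumr.
rewrite big_split/= -!mulr_sumr.
have -> : \sum_(a < n) \sum_(b < n) ((A o == a) && (B o == b) && (a != b))%:R = (A o != B o)%:R :> R.
  rewrite (bigD1 (A o))//= [X in _ + X]big1 ?addr0; last first.
    by move=> a /negbTE aA; rewrite big1// => b _; rewrite eq_sym aA.
  rewrite (bigD1 (B o))//= [X in _ + X]big1 ?addr0 ?eqxx//.
  by move=> b /negbTE bB; rewrite [B o == b]eq_sym bB andbF.
have -> : \sum_(a < n) \sum_(b < n) ((a == b) && (A o == a) && (B o != a))%:R = (A o != B o)%:R :> R.
  rewrite (bigD1 (A o))//= [X in _ + X]big1 ?addr0; last first.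
    by move=> a /negbTE aA; rewrite big1// => b _; rewrite [A o == a]eq_sym aA andbF.
  rewrite (bigD1 (A o))//= [X in _ + X]big1 ?addr0 ?eqxx/= 1?eq_sym//.
  by move=> b /negbTE bA; rewrite eq_sym bA.
by case: (A o != B o); rewrite ?mulr0 ?mulr1 ?addr0 // mulr2n mulrDl !mul1r.
Qed.

End DeviationOfKeys.

(** All values and their mean lie in an interval of length e lo, and lo is at most the mean. *)
Lemma sum_dev_near_mean {R : realType} n (f : 'I_n -> R) (lo e : R) :
  (0 < n)%N -> 0 <= e ->
  (forall a, lo <= f a <= lo * (1 + e)) ->
  \sum_a `|f a - n%:R^-1 * \sum_a f a| <= e * \sum_a f a.
Proof.
move=> n0 e0 fb; have n0' : (0 : R) < n%:R by rewrite ltr0n.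
set m := n%:R^-1 * _.
have m1 : lo <= m.
  rewrite /m mulrC ler_pdivlMr// mulr_natr -[X in _ *+ X](card_ord n) -sumr_const.
  by apply: ler_sum => a _; case/andP: (fb a).
have m2 : m <= lo * (1 + e).
  rewrite /m mulrC ler_pdivrMr// mulr_natr -[X in _ *+ X](card_ord n) -sumr_const.
  by apply: ler_sum => a _; case/andP: (fb a).
have -> : e * \sum_a f a = \sum_(a < n) e * m.
  by rewrite sumr_const card_ord -mulr_natr -mulrA /m [_ * n%:R]mulrC mulVKf ?gt_eqF.
apply: ler_sum => a _; have /andP[f1 f2] := fb a.
rewrite ler_norml; apply/andP; split; nra.
Qed.

Section Log2.
Context {R : realType}.
Implicit Types x y : R.

Lemma log2M x y : 0 < x -> 0 < y -> log2 (x * y) = log2 x + log2 y.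
Proof. by move=> x0 y0; rewrite /log2 lnM ?posrE// mulrDl. Qed.

Lemma log2V x : 0 < x -> log2 x^-1 = - log2 x.
Proof. by move=> x0; rewrite /log2 lnV ?posrE// mulNr. Qed.

Lemma log2_div x y : 0 < x -> 0 < y -> log2 (x / y) = log2 x - log2 y.
Proof. by move=> x0 y0; rewrite log2M ?invr_gt0// log2V. Qed.

Lemma log2X x n : 0 < x -> log2 (x ^+ n) = n%:R * log2 x.
Proof. by move=> x0; rewrite /log2 lnXn// !mulrnAl mul1r. Qed.

Lemma log2_2 : log2 2 = 1 :> R.
Proof. by rewrite /log2 divff// gt_eqF// ln2_gt0. Qed.

Lemma log2_pow2 n : log2 (2 ^+ n) = n%:R :> R.
Proof. by rewrite log2X// log2_2 mulr1. Qed.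

Lemma log2_1 : log2 1 = 0 :> R.
Proof. by rewrite /log2 ln1 mul0r. Qed.

Lemma ler_log2 x y : 0 < x -> x <= y -> log2 x <= log2 y.
Proof.
move=> x0 xy; rewrite /log2 ler_pM2r ?invr_gt0 ?ln2_gt0// ler_ln ?posrE//.
exact: lt_le_trans xy.
Qed.

Lemma ltr_log2 x y : 0 < x -> x < y -> log2 x < log2 y.
Proof.
move=> x0 xy; rewrite /log2 ltr_pM2r ?invr_gt0 ?ln2_gt0// ltr_ln ?posrE//.
exact: lt_trans xy.
Qed.

Lemma log2_ge0 x : 1 <= x -> 0 <= log2 x.
Proof. by move=> x1; rewrite -log2_1 ler_log2. Qed.
End Log2.

Lemma partition_image {R : realType} {I : finType} {C : eqType} (g : I -> C) (f : I -> R) :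
  \sum_i f i = \sum_(c <- undup [seq g i | i <- enum I]) \sum_(i | g i == c) f i.
Proof.
rewrite (exchange_big_dep xpredT)//=; apply: eq_bigr => i _.
rewrite (eq_bigl (pred1 (g i))); last by move=> c; rewrite /= eq_sym.
rewrite -big_filter filter_pred1_uniq ?undup_uniq ?big_seq1//.
by rewrite mem_undup map_f// mem_enum.
Qed.

Lemma geometric_sum_le {R : realType} (q : R) n : 0 <= q < 1 ->
  \sum_(i < n) q ^+ i <= (1 - q)^-1.
Proof.
move=> /andP[q0 q1]; have q1' : 0 < 1 - q by rewrite subr_gt0.
rewrite -[(1 - q)^-1]mul1r ler_pdivlMr// mulrC -opprB mulNr -subrX1 opprB.
by rewrite gerBl exprn_ge0.
Qed.

Lemma sum_pow2_le {R : realType} v (B : R) : 0 < B ->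
  \sum_(1 <= l < v.+1) (if 2 ^+ l <= B then 2 ^+ l else 0) <= 2 * B.
Proof.
move=> B0; elim: v => [|v ih]; first by rewrite big_geq// mulr_ge0// ltW.
rewrite big_nat_recr//=; case: ifPn => h; last by rewrite addr0.
have {ih} -> : \sum_(1 <= l < v.+1) (if 2 ^+ l <= B then 2 ^+ l else 0) =
    2 ^+ v.+1 - 2 :> R.
  rewrite (eq_big_nat _ _ (F2 := fun l => 2 ^+ l)); last first.
    move=> l /andP[_ lv]; rewrite ifT// (le_trans _ h)// ler_weXn2l ?ler1n//.
    exact: ltnW.
  elim: v {h ih} => [|v ih]; first by rewrite big_geq// expr1 subrr.
  by rewrite big_nat_recr//= ih [2 ^+ v.+2]exprS; move: (2 ^+ v.+1) => z; ring.
by move: h; rewrite -(ler_pM2l (ltr0n R 2)); lra.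
Qed.

Lemma count_pow2_gt {R : realType} v (B : R) : 0 < B ->
  \sum_(1 <= l < v.+1) (if 2 ^+ l <= B then 0 else 1) <=
  Num.max 0 (v%:R - log2 B + 1).
Proof.
move=> B0; elim: v => [|v ih]; first by rewrite big_geq// le_max lexx.
rewrite big_nat_recr//=; case: ifPn => h.
  rewrite addr0 (_ : \sum_(_ <= _ < _) _ = 0) ?le_max ?lexx//.
  rewrite big_nat big1// => l /andP[_ lv]; rewrite ifT// (le_trans _ h)//.
  by rewrite ler_weXn2l ?ler1n// ltnW.
rewrite -ltNge in h.
have lB : log2 B < v.+1%:R.
  by rewrite -log2_pow2 ltr_log2.
rewrite -natr1 in lB *; apply: (le_trans (lerD ih (lexx 1))).
rewrite le_max; apply/orP; right.
by rewrite maxElt; case: ifP => _; lra.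
Qed.

(** Split at the threshold [B]: exponents with 2^l <= B use the second bound, a geometric sum; at
    most v - log2 B + 1 others use [M]. The choice of [B] is left open. *)
Lemma capped_sum_le {R : realType} v (u : nat -> R) (M K B : R) :
  0 <= M -> 0 <= K -> 0 < B -> B <= 2 ^+ v ->
  (forall l, (0 < l <= v)%N -> u l <= M /\ u l <= 2 ^+ l * K) ->
  \sum_(1 <= l < v.+1) u l <= M * (v%:R - log2 B + 1) + 2 * B * K.
Proof.
move=> M0 K0 B0 Bv ub.
have Bv' : log2 B <= v%:R.
  by rewrite -log2_pow2 ler_log2.
apply: (@le_trans _ _ (\sum_(1 <= l < v.+1) (M * (if 2 ^+ l <= B then 0 else 1) +
    K * (if 2 ^+ l <= B then 2 ^+ l else 0)))).
  rewrite big_nat [leRHS]big_nat; apply: ler_sum => l; rewrite ltnS => /ub[h1 h2].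
  by case: ifP => _; rewrite ?mulr0 ?mulr1 ?addr0 ?add0r// mulrC.
rewrite big_split/= -!mulr_sumr lerD//.
  rewrite ler_wpM2l// (le_trans (count_pow2_gt v B0))//.
  rewrite maxElt; case: ifP => // /negbT; rewrite -leNgt; lra.
by rewrite mulrC ler_wpM2r// sum_pow2_le.
Qed.

(** Layer-cake identity: it will turn the lost bits [v - blk] into a sum of the events [blk < l]. *)
Lemma sum_ltn_nat b v : (b <= v)%N -> (\sum_(1 <= l < v.+1) (b < l) = v - b)%N.
Proof.
elim: v => [|v ih] bv; first by rewrite big_geq.
rewrite big_nat_recr//=; case: (ltngtP b v.+1) bv => // [bv _|-> _].
  by rewrite ih// subSn// addn1.
rewrite big_nat big1 ?subnn ?add0n ?ltnn// => l /andP[_ lv].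
by rewrite ltnNge (ltnW lv).
Qed.

(* [Lst v y] is the list of Bob at level [v].  In round [v] Alice sends [h], the hash
   prefix of her piece, and [stops_at v h y] is Bob's answer.  Her last message
   [info v x] consists of the probability class [mass_lvl], the exponent [blk] of the
   dyadic block containing her rank within her group, and the index of this block. *)
Section Core.
Context {R : realType} {X Y : finType}.
Variables (p : X -> Y -> R) (T : nat) (H : X -> nat) (Lst : nat -> Y -> pred X) (e : R).

Definition found v h y : bool := [exists x', Lst v y x' && (H x' %/ 2 ^ v == h)%N].
(** Level 0 always stops, so the dialogue terminates; no key bits remain there and a wrong guess is
    harmless. *)
Definition stops_at v h y : bool := (v == 0%N) || found v h y.
(** Levels are tried downwards, so the first success is the largest stopping level. *)
Definition stop_lvl (x : X) (y : Y) : nat :=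
  \max_(v < T.+1 | stops_at v (H x %/ 2 ^ v)%N y) v.
Definition guess v h y : option X := [pick x' | Lst v y x' && (H x' %/ 2 ^ v == h)%N].

Definition mass v x : R := \sum_(y | stop_lvl x y == v) p x y.
(** Integer part of a logarithm in base 1 + e, nonnegative because no mass exceeds [2 ^- T]. *)
Definition mass_lvl v x : nat :=
  Num.truncn (ln ((2 ^ T)%:R^-1 / mass v x) / ln (1 + e)).
Definition group v h j : seq X :=
  [seq x <- enum X | [&& (H x %/ 2 ^ v == h)%N, 0 < mass v x & mass_lvl v x == j]].
Definition rank v h j x : nat := index x (group v h j).
Definition rank_of v x : nat := rank v (H x %/ 2 ^ v)%N (mass_lvl v x) x.
Definition blk v x : nat :=
  block_exp (size (group v (H x %/ 2 ^ v)%N (mass_lvl v x))) v (rank_of v x).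
Definition info v x : nat * nat * nat :=
  (mass_lvl v x, blk v x, (rank_of v x %/ 2 ^ blk v x)%N).
Definition pub x y : nat * nat * (nat * nat * nat) :=
  let v := stop_lvl x y in (v, (H x %/ 2 ^ v)%N, info v x).

Implicit Types c : nat * nat * (nat * nat * nat).
Definition class_pr c : R := \sum_(xy : X * Y | pub xy.1 xy.2 == c) p xy.1 xy.2.
Definition wrong x y : bool :=
  (0 < stop_lvl x y)%N && (guess (stop_lvl x y) (H x %/ 2 ^ stop_lvl x y)%N y != Some x).
Definition class_err c : R :=
  \sum_(xy : X * Y | (pub xy.1 xy.2 == c) && wrong xy.1 xy.2) p xy.1 xy.2.
(* The key length: transcripts on which decoding is too unreliable get length 0. *)
Definition klen c : nat :=
  if class_err c <= e / 2 * class_pr c then c.2.1.2 else 0%N.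
Definition key_of c x : nat := (rank c.1.1 c.1.2 c.2.1.1 x %% 2 ^ klen c)%N.
Definition keyA x c : nat := (key_of c x).+1.
(** Without a guess Bob outputs 1, a legal key of every length. *)
Definition keyB y c : nat :=
  if guess c.1.1 c.1.2 y is Some x then (key_of c x).+1 else 1%N.

Hypotheses (p0 : forall x y, 0 <= p x y) (e0 : 0 < e) (e1 : e < 1)
  (pX : forall x, \sum_y p x y <= (2 ^ T)%:R^-1).

Lemma mass_ge0 v x : 0 <= mass v x.
Proof. by apply: sumr_ge0 => y _. Qed.

Lemma mass_le v x : mass v x <= (2 ^ T)%:R^-1.
Proof.
apply: le_trans (pX x); rewrite /mass big_mkcond/=; apply: ler_sum => y _.
by case: ifP.
Qed.

Lemma mass_lvlP v x : 0 < mass v x ->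
  mass v x * (1 + e) ^+ mass_lvl v x <= (2 ^ T)%:R^-1 < mass v x * (1 + e) ^+ (mass_lvl v x).+1.
Proof.
move=> m0; rewrite /mass_lvl; set c := (2 ^ T)%:R^-1.
have c0 : 0 < c by rewrite invr_gt0 ltr0n expn_gt0.
have l0 : 0 < ln (1 + e) by rewrite ln_gt0// ltrDl.
have r0 : 0 <= ln (c / mass v x) / ln (1 + e).
  rewrite divr_ge0 ?(ltW l0)// ln_ge0// ler_pdivlMr// mul1r; exact: mass_le.
have /andP[h1 h2] := truncn_itv r0; set j := Num.truncn _ in h1 h2 *.
have e10 : 0 < 1 + e by rewrite ltr_pwDl// ltW.
rewrite ler_pdivlMr// in h1; rewrite ltr_pdivrMr// in h2.
have lnE k : k%:R * ln (1 + e) = ln ((1 + e) ^+ k) by rewrite lnXn// mulr_natl.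
apply/andP; split.
  by rewrite mulrC -ler_pdivlMr// -ler_ln ?posrE ?exprn_gt0 ?divr_gt0// -lnE.
by rewrite mulrC -ltr_pdivrMr// -ltr_ln ?posrE ?exprn_gt0 ?divr_gt0// -lnE.
Qed.

Lemma group_uniq v h j : uniq (group v h j).
Proof. by rewrite filter_uniq// enum_uniq. Qed.

Lemma mem_group v x : 0 < mass v x -> x \in group v (H x %/ 2 ^ v)%N (mass_lvl v x).
Proof. by move=> m0; rewrite mem_filter !eqxx m0 mem_enum. Qed.

Lemma group_mem v h j x : x \in group v h j ->
  [/\ (H x %/ 2 ^ v)%N = h, 0 < mass v x & mass_lvl v x = j].
Proof. by rewrite mem_filter => /andP[/and3P[/eqP ? ? /eqP ?] _]. Qed.

Lemma pub_eq x y v h i : (pub x y == (v, h, i)) =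
  (stop_lvl x y == v) && ((H x %/ 2 ^ v == h)%N && (info v x == i)).
Proof.
rewrite /pub !xpair_eqE /=; case: eqVneq => [->|]; last by [].
by rewrite -!andbA.
Qed.

Lemma class_sum (v h : nat) i (Q : pred X) :
  \sum_(xy : X * Y | (pub xy.1 xy.2 == (v, h, i)) && Q xy.1) p xy.1 xy.2 =
  \sum_(x | ((H x %/ 2 ^ v == h)%N && (info v x == i)) && Q x) mass v x.
Proof.
rewrite /mass pair_big_dep/=; apply: eq_bigl => -[x y] /=.
by rewrite pub_eq; case: (stop_lvl x y == v); rewrite ?andbF ?andbT.
Qed.

Section LiveClass.
Variables (v : nat) (x0 : X).
Hypothesis m0 : 0 < mass v x0.
Let h := (H x0 %/ 2 ^ v)%N.
Let j := mass_lvl v x0.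
Let L := blk v x0.
Let q := (rank_of v x0 %/ 2 ^ L)%N.
Let G := group v h j.

Let rk0 : (rank_of v x0 < size G)%N.
Proof. by rewrite index_mem; exact: mem_group. Qed.

Let elem k := nth x0 G (q * 2 ^ L + k).

Let elem_rank k : (k < 2 ^ L)%N -> (q * 2 ^ L + k < size G)%N /\
  [/\ (H (elem k) %/ 2 ^ v == h)%N, info v (elem k) == (j, L, q), 0 < mass v (elem k)
    & rank v h j (elem k) = (q * 2 ^ L + k)%N].
Proof.
move=> kL.
have dk : ((q * 2 ^ L + k) %/ 2 ^ L = rank_of v x0 %/ 2 ^ L)%N.
  by rewrite divnMDl ?expn_gt0// divn_small ?addn0.
have [lt be] := block_exp_same rk0 dk.
have inG : elem k \in G by exact: mem_nth.
have [eh em ej] := group_mem inG.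
have rk : rank v h j (elem k) = (q * 2 ^ L + k)%N.
  by rewrite /rank index_uniq ?group_uniq.
have eb : blk v (elem k) = L by rewrite /blk /rank_of eh ej rk.
split => //; split => //; first exact/eqP.
by rewrite /info /rank_of eh ej eb rk dk.
Qed.

Let elem_uniq x : (H x %/ 2 ^ v == h)%N -> info v x == (j, L, q) -> 0 < mass v x ->
  x = elem (rank v h j x %% 2 ^ L)%N.
Proof.
move=> /eqP eh /eqP[ej eb eq] m; have inG : x \in G by have := mem_group m; rewrite eh ej.
rewrite -[LHS](nth_index x0 inG) /elem; congr (nth _ _ _).
rewrite -/(rank v h j x) {1}(divn_eq (rank v h j x) (2 ^ L)); congr (_ * _ + _)%N.
by rewrite -eq /rank_of eh ej eb.
Qed.

(** Exactly one piece of positive mass in the class has position [k] in the block, and masses within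
    a group agree up to the factor 1 + e. *)
Lemma live_class_key k : (k < 2 ^ L)%N ->
  (2 ^ T)%:R^-1 / (1 + e) ^+ j.+1 <=
  \sum_(xy : X * Y | (pub xy.1 xy.2 == (v, h, (j, L, q))) && (rank v h j xy.1 %% 2 ^ L == k)%N)
    p xy.1 xy.2
  <= (2 ^ T)%:R^-1 / (1 + e) ^+ j.+1 * (1 + e).
Proof.
move=> kL; rewrite (class_sum v h (j, L, q) (fun x => rank v h j x %% 2 ^ L == k)%N).
have [_ [eh ei em er]] := elem_rank kL.
rewrite (bigD1 (elem k))/=; last first.
  by rewrite eh ei er modnMDl modn_small ?eqxx.
rewrite big1 ?addr0; last first.
  move=> x /andP[/andP[/andP[xh xi] /eqP xk] xe].
  apply/eqP; rewrite -[_ == 0]negbK; apply: contra xe => m.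
  have m' : 0 < mass v x by rewrite lt0r m mass_ge0.
  by rewrite [x](elem_uniq xh xi m') xk.
have [_ _ ej] : [/\ (H (elem k) %/ 2 ^ v)%N = h, 0 < mass v (elem k) & mass_lvl v (elem k) = j].
  by move/eqP: ei => [] *; split => //; exact/eqP.
have /andP[l1 l2] := mass_lvlP em; rewrite ej in l1 l2.
have e10 : 0 < 1 + e by rewrite ltr_pwDl// ltW.
apply/andP; split; first by rewrite ler_pdivrMr ?exprn_gt0// ltW.
by rewrite exprSr invfM mulrA divfK ?gt_eqF// ler_pdivlMr ?exprn_gt0.
Qed.
End LiveClass.

Definition class_key_pr c (a b : nat) : R :=
  \sum_(xy : X * Y | [&& pub xy.1 xy.2 == c, keyA xy.1 c == a & keyB xy.2 c == b])
    p xy.1 xy.2.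

Let key_lt c x : (key_of c x < 2 ^ klen c)%N.
Proof. by rewrite ltn_mod expn_gt0. Qed.
Let keyB_lt c y : ((keyB y c).-1 < 2 ^ klen c)%N.
Proof. by rewrite /keyB; case: guess => [x|] /=; rewrite ?key_lt ?expn_gt0. Qed.

Lemma keyA_itv x c : (1 <= keyA x c <= 2 ^ klen c)%N.
Proof. by rewrite /keyA/= key_lt. Qed.
Lemma keyB_itv y c : (1 <= keyB y c <= 2 ^ klen c)%N.
Proof. by rewrite /keyB; case: guess => [x|] /=; rewrite ?key_lt ?expn_gt0. Qed.

Lemma class_err_ge0 c : 0 <= class_err c.
Proof. exact: sumr_ge0. Qed.

Lemma blk_le v x : (blk v x <= v)%N.
Proof. exact: block_exp_le. Qed.

(** Triangle inequality through the law of (A, A). Reaching it costs twice the mismatch probability,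
    at most e times the class by the rule for [klen]; from there to uniform costs another e by
    [live_class_key]. *)
Lemma class_dev c :
  \sum_(a < 2 ^ klen c) \sum_(b < 2 ^ klen c)
    `|class_key_pr c a.+1 b.+1 - (if a == b then (2 ^ klen c)%:R^-1 * class_pr c else 0)| <=
  2 * e * class_pr c.
Proof.
have pc0 : 0 <= class_pr c by exact: sumr_ge0.
pose A (xy : X * Y) : 'I_(2 ^ klen c) := Ordinal (key_lt c xy.1).
pose B (xy : X * Y) : 'I_(2 ^ klen c) := Ordinal (keyB_lt c xy.2).
pose D (xy : X * Y) := pub xy.1 xy.2 == c.
pose wt (xy : X * Y) := p xy.1 xy.2.
pose pa (a : 'I_(2 ^ klen c)) := \sum_(o | D o && (A o == a)) wt o.
have pabE (a b : 'I_(2 ^ klen c)) : class_key_pr c a.+1 b.+1 =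
    \sum_(o | D o && ((A o == a) && (B o == b))) wt o.
  apply: eq_bigl => -[x y]; rewrite /D /= -!val_eqE/= /keyA eqSS; do 2 congr (_ && _).
  by have /andP[k1 _] := keyB_itv y c; rewrite -{1}(prednK k1) eqSS.
have spa : \sum_a pa a = class_pr c.
  by rewrite /pa /class_pr (partition_big A predT)//=.
apply: (@le_trans _ _ (\sum_(a < 2 ^ klen c) \sum_(b < 2 ^ klen c)
   (`|class_key_pr c a.+1 b.+1 - (if a == b then pa a else 0)| +
    (if a == b then `|pa a - (2 ^ klen c)%:R^-1 * class_pr c| else 0)))).
  apply: ler_sum => a _; apply: ler_sum => b _; case: ifP => _; last by rewrite addr0.
  by rewrite (le_trans _ (ler_normD _ _))// addrA subrK.
under eq_bigr do rewrite big_split/=.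
rewrite big_split/= [2 * e]mulr_natl mulr2n mulrDl lerD//.
  under eq_bigr do under eq_bigr do rewrite pabE.
  apply: (le_trans (key_mismatch_dev D A B _)) => //; first by move=> o; exact: p0.
  suff h : \sum_(o | D o && (A o != B o)) wt o <= e / 2 * class_pr c.
    rewrite (_ : e = 2 * (e / 2)); last by field.
    by rewrite -mulrA ler_pM2l.
  (* In a bad class the length is 0, only one key exists, and A = B. *)
  have [good|bad] := boolP (class_err c <= e / 2 * class_pr c); last first.
    rewrite big1 ?mulr_ge0// ?divr_ge0// ?(ltW e0)// => o /andP[_ /negP[]]; apply/eqP/val_inj.
    have kl : klen c = 0%N by rewrite /klen (negbTE bad).
    by case: (A o) (B o) => [a la] [b lb] /=; move: la lb; rewrite kl expn0 !ltnS !leqn0 => /eqP-> /eqP->.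
  apply: le_trans good; rewrite /class_err big_mkcond [leRHS]big_mkcond/=.
  apply: ler_sum => -[x y] _ /=; rewrite /D/=.
  case: eqVneq => //= pc; case: ifPn => [AB|_]; last by case: ifP.
  suff -> : wrong x y by [].
  have [v0 h0 i0] : [/\ c.1.1 = stop_lvl x y, c.1.2 = (H x %/ 2 ^ stop_lvl x y)%N &
     c.2 = info (stop_lvl x y) x] by rewrite -pc.
  apply/andP; split.
    (* At level 0 the block exponent is 0, so again there is only one key. *)
    rewrite lt0n; apply: contraNneq AB => s0; apply/eqP/val_inj => /=.
    have kl : klen c = 0%N.
      rewrite /klen; case: ifP => // _; apply/eqP; rewrite -leqn0 i0 s0.
      exact: blk_le.
    have := key_lt c x; have := keyB_lt c y; rewrite kl expn0 !ltnS !leqn0 => /eqP-> /eqP->.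
    by [].
  apply: contraNneq AB => gx; apply/eqP/val_inj => /=.
  by rewrite /keyB v0 h0 gx.
pose pk (k : nat) := \sum_(xy : X * Y | (pub xy.1 xy.2 == c) && (key_of c xy.1 == k)) p xy.1 xy.2.
have spk : \sum_(a < 2 ^ klen c) pk a = class_pr c by [].
rewrite (eq_bigr (fun a : 'I_(2 ^ klen c) => `|pk a - (2 ^ klen c)%:R^-1 * class_pr c|)); last first.
  by move=> a _; rewrite (bigD1 a)//= eqxx big1 ?addr0// => b /negbTE ba; rewrite eq_sym ba.
have [c0|c0] := eqVneq (class_pr c) 0.
  rewrite c0 !mulr0 big1// => a _; rewrite subr0.
  have pk0 : pk a = 0.
    have h : \sum_(a < 2 ^ klen c) pk a = 0 by rewrite spk.
    by move/psumr_eq0P: h => -> // k _; exact: sumr_ge0.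
  by rewrite pk0 normr0.
have [[x y] /= /eqP pxy pp] : exists2 xy : X * Y, pub xy.1 xy.2 == c & 0 < p xy.1 xy.2.
  apply: contrapT => nex; move/eqP: c0; apply; rewrite /class_pr big1// => xy pc.
  apply/le_anti; rewrite p0 andbT leNgt; apply/negP => pp; apply: nex; by exists xy.
have m0 : 0 < mass (stop_lvl x y) x.
  by rewrite /mass (bigD1 y)//= ltr_pwDl// sumr_ge0.
have [kl|kl] : klen c = blk (stop_lvl x y) x \/ klen c = 0%N.
  by rewrite /klen; case: ifP => _; [left; rewrite -pxy|right].
- have e10 : 0 < 1 + e by rewrite ltr_pwDl// ltW.
  have := @sum_dev_near_mean R (2 ^ klen c) (fun a => pk a)
    ((2 ^ T)%:R^-1 / (1 + e) ^+ (mass_lvl (stop_lvl x y) x).+1) e _ (ltW e0).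
  rewrite spk; apply; first by rewrite expn_gt0.
  move=> a; have aL : (a < 2 ^ blk (stop_lvl x y) x)%N by rewrite -kl.
  move: (nat_of_ord a) aL => k kL.
  by have := live_class_key m0 kL; rewrite /pk /key_of kl -pxy; exact.
- rewrite (_ : \sum_(a < _) _ = 0) ?mulr_ge0 ?(ltW e0)// big1// => a _.
  suff -> : pk a = class_pr c by rewrite kl expn0 invr1 mul1r subrr normr0.
  rewrite -spk (bigD1 a)//= big1 ?addr0// => b ba; exfalso; move/eqP: ba; apply; apply/val_inj.
  by case: a b => [a la] [b lb] /=; move: la lb; rewrite kl expn0 !ltnS !leqn0 => /eqP-> /eqP->.
Qed.

(** After [i] refusals the transcript has length 2 i and level [T - i] is probed; after an
    acceptance at that level the length is 2 i + 2. On the empty transcript [last] defaults to 0,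
    which reads as a refusal. *)
Definition msgA (w : seq nat) x : nat :=
  if last 0%N w == 0%N then (H x %/ 2 ^ (T - (size w)./2))%N
  else pickle (info (T - (size w - 2)./2)%N x).
Definition msgB (w : seq nat) y : nat :=
  stops_at (T - (size w)./2)%N (last 0%N w) y.
(** Alice has replied to an acceptance: for odd size the entry at size - 2 is Bob's last answer. The
    test [2 < size] excludes size 1, where truncated subtraction would read Alice's hash. *)
Definition halts (w : seq nat) : bool :=
  [&& odd (size w), (2 < size w)%N & nth 0%N w (size w - 2) == 1%N].

Fixpoint dialogue k x y : seq nat :=
  if k is k'.+1 then
    let w := dialogue k' x y in
    if halts w then w else rcons w (if odd (size w) then msgB w y else msgA w x)
  else [::].

Definition probes x r : seq nat :=
  flatten [seq [:: (H x %/ 2 ^ (T - i))%N; 0%N] | i <- iota 0 r].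
Definition transcript x y : seq nat :=
  let v := stop_lvl x y in
  probes x (T - v) ++ [:: (H x %/ 2 ^ v)%N; 1%N; pickle (info v x)].
Definition decode (w : seq nat) : nat * nat * (nat * nat * nat) :=
  ((T - (size w - 3)./2)%N, nth 0%N w (size w - 3),
   odflt (0%N, 0%N, 0%N) (unpickle (last 0%N w))).

Lemma dialogueS k x y : dialogue k.+1 x y =
  if halts (dialogue k x y) then dialogue k x y
  else rcons (dialogue k x y) (if odd (size (dialogue k x y)) then msgB (dialogue k x y) y
                               else msgA (dialogue k x y) x).
Proof. by []. Qed.

Lemma probesS x r : probes x r.+1 = probes x r ++ [:: (H x %/ 2 ^ (T - r))%N; 0%N].
Proof. by rewrite /probes -[r.+1]addn1 iotaD map_cat flatten_cat. Qed.

Lemma size_probes x r : size (probes x r) = r.*2.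
Proof. by elim: r => // r ih; rewrite probesS size_cat ih/= doubleS addn2. Qed.

Lemma last_probes x r : last 0%N (probes x r) = 0%N.
Proof. by case: r => // r; rewrite probesS last_cat. Qed.

Lemma stop_lvl_le x y : (stop_lvl x y <= T)%N.
Proof. by apply/bigmax_leqP => v _; rewrite -ltnS. Qed.

Lemma stop_lvl_ge x y v : (v <= T)%N -> stops_at v (H x %/ 2 ^ v)%N y -> (v <= stop_lvl x y)%N.
Proof.
move=> vT s; exact: (@leq_bigmax_cond _ (fun m : 'I_T.+1 => stops_at m (H x %/ 2 ^ m)%N y)
  (fun m => m : nat) (Ordinal (vT : v < T.+1)%N)).
Qed.

Lemma stops_at_stop_lvl x y : stops_at (stop_lvl x y) (H x %/ 2 ^ stop_lvl x y)%N y.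
Proof.
rewrite /stop_lvl.
have h : (0 < #|[pred m : 'I_T.+1 | stops_at m (H x %/ 2 ^ m)%N y]|)%N.
  by apply/card_gt0P; exists ord0; rewrite inE.
by have [m sm ->] := @eq_bigmax_cond _ [pred m : 'I_T.+1 | stops_at m (H x %/ 2 ^ m)%N y] (fun m => m : nat) h.
Qed.

Lemma halts_even w : ~~ odd (size w) -> halts w = false.
Proof. by rewrite /halts => /negbTE ->. Qed.

Lemma dialogue_probes x y r : (r <= T - stop_lvl x y)%N -> dialogue r.*2 x y = probes x r.
Proof.
elim: r => // r ih rR; rewrite doubleS /= ih ?(ltnW rR)//.
have he : halts (probes x r) = false by rewrite halts_even// size_probes odd_double.
rewrite he/= size_probes odd_double/=.
rewrite /msgA last_probes eqxx size_probes doubleK.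
set w := rcons _ _; have -> : halts w = false.
  rewrite /halts /w size_rcons size_probes; case: r {ih rR w he} => // r.
  rewrite -cats1 nth_cat size_probes ifT; last by lia.
  rewrite probesS nth_cat size_probes ifF; last by lia.
  by rewrite (_ : (r.+1.*2.+1 - 2 - r.*2)%N = 1%N) ?andbF//; lia.
rewrite /w size_rcons size_probes/= odd_double/= probesS -!cats1 -catA; congr (_ ++ [:: _; _]).
rewrite /msgB size_cat size_probes/= addn1.
rewrite (_ : (r.*2.+1)./2 = r); last by lia.
rewrite last_cat/=.
case st : stops_at => //=.
have := @stop_lvl_ge x y (T - r) (leq_subr _ _) st.
have := stop_lvl_le x y; lia.
Qed.

Lemma size_transcript x y : size (transcript x y) = ((T - stop_lvl x y).*2 + 3)%N.
Proof. by rewrite size_cat size_probes. Qed.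

Lemma halts_transcript x y : halts (transcript x y).
Proof.
rewrite /halts size_transcript oddD odd_double/=; apply/andP; split; first by lia.
rewrite nth_cat size_probes ifF; last by lia.
by rewrite (_ : (_ - _)%N = 1%N)//; lia.
Qed.

Lemma dialogue_transcript x y : dialogue ((T - stop_lvl x y).*2 + 3) x y = transcript x y.
Proof.
have le := stop_lvl_le x y; set r := (T - stop_lvl x y)%N.
have Tr : (T - r)%N = stop_lvl x y by rewrite /r; lia.
have d0 : dialogue r.*2 x y = probes x r by exact: dialogue_probes.
have d1 : dialogue r.*2.+1 x y = probes x r ++ [:: (H x %/ 2 ^ stop_lvl x y)%N].
  rewrite /= d0 halts_even ?size_probes ?odd_double//.
  by rewrite /msgA last_probes eqxx size_probes doubleK Tr cats1.
have d2 : dialogue r.*2.+2 x y = probes x r ++ [:: (H x %/ 2 ^ stop_lvl x y)%N; 1%N].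
  rewrite dialogueS d1 ifF.
    rewrite size_cat size_probes/= addn1/= odd_double/= /msgB size_cat size_probes/= addn1.
    rewrite (_ : (r.*2.+1)./2 = r) ?Tr; last by lia.
    by rewrite last_cat/= stops_at_stop_lvl -cats1 -catA.
  rewrite /halts size_cat size_probes/= addn1; case: (r) => // r'.
  rewrite nth_cat size_probes ifT; last by lia.
  rewrite probesS nth_cat size_probes ifF; last by lia.
  by rewrite (_ : (r'.+1.*2.+1 - 2 - r'.*2)%N = 1%N) ?andbF//; lia.
rewrite addn3 dialogueS d2.
rewrite halts_even ?size_cat ?size_probes/= ?oddD ?odd_double//=.
rewrite /msgA last_cat/= size_cat size_probes/= addnK doubleK Tr.
by rewrite /transcript -cats1 -catA.
Qed.

Lemma decode_transcript x y : decode (transcript x y) = pub x y.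
Proof.
have le := stop_lvl_le x y; rewrite /decode size_transcript addnK doubleK subKn//.
rewrite last_cat/= pickleK/= nth_cat size_probes ltnn subnn/=.
by [].
Qed.

(** The refused probes are coarser prefixes of the last one and hence determined by it. So
    conditioning on the transcript is conditioning on the class [pub]. *)
Lemma transcript_pub x y x' y' : pub x y = pub x' y' -> transcript x y = transcript x' y'.
Proof.
move=> eq; have := eq; rewrite /pub /transcript => -[E1 E2 E3 E4 E5].
rewrite -E2 (_ : info (stop_lvl x' y') x' = info (stop_lvl x y) x); last first.
  by rewrite /info -E5 -E4 -E3.
congr (_ ++ _); rewrite -E1 /probes; congr flatten.
apply/eq_in_map => i; rewrite mem_iota add0n => /andP[_ iT].
have hle : (stop_lvl x y <= T - i)%N by lia.
congr [:: _; _].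
by rewrite -(subnKC hle) expnD !divnMA E2 -E1.
Qed.
(** Markov, class by class: a class cut to length 0 has probability below 2 / e times its error
    probability, and its block exponent is at most the stopping level. *)
Lemma klen_expectation :
  \sum_(xy : X * Y) p xy.1 xy.2 * (blk (stop_lvl xy.1 xy.2) xy.1)%:R <=
  \sum_(xy : X * Y) p xy.1 xy.2 * (klen (pub xy.1 xy.2))%:R +
  2 / e * \sum_(xy : X * Y | wrong xy.1 xy.2) p xy.1 xy.2 * (stop_lvl xy.1 xy.2)%:R.
Proof.
pose pu (xy : X * Y) := pub xy.1 xy.2.
pose g c : R := if class_err c <= e / 2 * class_pr c then 0 else (c.2.1.2)%:R.
have split1 : \sum_(xy : X * Y) p xy.1 xy.2 * (blk (stop_lvl xy.1 xy.2) xy.1)%:R =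
    \sum_(xy : X * Y) p xy.1 xy.2 * (klen (pu xy))%:R +
    \sum_(xy : X * Y) p xy.1 xy.2 * g (pu xy).
  rewrite -big_split/=; apply: eq_bigr => xy _; rewrite -mulrDr /klen /g /pu.
  by case: ifP => _; rewrite ?addr0 ?add0r.
rewrite split1 lerD2l (partition_image pu).
apply: (@le_trans _ _ (\sum_(c <- undup [seq pu i | i <- enum {: X * Y}])
    2 / e * ((c.2.1.2)%:R * class_err c))).
  apply: ler_sum => c _.
  rewrite (eq_bigr (fun xy => p xy.1 xy.2 * g c)); last by move=> xy /eqP ->.
  rewrite -mulr_suml -/(class_pr c) /g; case: ifPn => bad.
    by rewrite mulr0 mulr_ge0 ?divr_ge0 ?(ltW e0)// mulr_ge0// class_err_ge0.
  rewrite -ltNge in bad; rewrite mulrCA mulrC ler_wpM2l//.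
  rewrite mulrAC ler_pdivlMr// mulrC; move: bad; set A := class_pr c; lra.
rewrite -mulr_sumr ler_wpM2l ?divr_ge0 ?(ltW e0)//.
apply: (@le_trans _ _ (\sum_(xy : X * Y) (if wrong xy.1 xy.2 then
    p xy.1 xy.2 * ((pu xy).2.1.2)%:R else 0))).
  rewrite (partition_image pu); apply: ler_sum => c _.
  rewrite /class_err mulr_sumr big_mkcondr/= le_eqVlt; apply/orP; left; apply/eqP.
  by apply: eq_bigr => xy /eqP <-; case: ifP => _ //; rewrite mulrC.
rewrite [leRHS]big_mkcond/=; apply: ler_sum => xy _; case: ifP => // _.
by rewrite ler_wpM2l// ler_nat blk_le.
Qed.

Hypothesis HT : forall x, (H x < 2 ^ T)%N.

(** At most 2^l ranks of a group, whatever its size, miss a full block of size 2^l, and each mass is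
    at most 2^-T (1 + e)^-j. *)
Lemma group_unfit_mass v h j l : (0 < l <= v)%N ->
  \sum_(x | (H x %/ 2 ^ v == h)%N && (mass_lvl v x == j)) mass v x * (blk v x < l)%:R <=
  2 ^+ l * ((2 ^ T)%:R^-1 * ((1 + e)^-1) ^+ j).
Proof.
move=> lv; have e10 : 0 < 1 + e by rewrite ltr_pwDl// ltW.
set u := _ * _ ^+ j; have u0 : 0 <= u.
  by rewrite mulr_ge0 ?invr_ge0// exprn_ge0// invr_ge0 ltW.
have -> : \sum_(x | (H x %/ 2 ^ v == h)%N && (mass_lvl v x == j)) mass v x * (blk v x < l)%:R =
    \sum_(x <- group v h j) mass v x * (blk v x < l)%:R.
  rewrite big_filter big_enum_cond/= [LHS]big_mkcond [RHS]big_mkcond/=.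
  apply: eq_bigr => x _; case: (_ == h) => //=.
  case: (ltP 0 (mass v x)) => //= mx; case: ifP => // _.
  by rewrite (_ : mass v x = 0) ?mul0r//; apply/le_anti; rewrite mx mass_ge0.
case gE : (group v h j) => [|x0 s0].
  by rewrite big_nil mulr_ge0// exprn_ge0.
rewrite -gE (big_nth x0) big_mkord.
apply: (@le_trans _ _ (\sum_(i < size (group v h j)) u * (~~ block_fits (size (group v h j)) l i)%:R)).
  apply: ler_sum => i _; set x := nth x0 _ i.
  have xG : x \in group v h j by exact: mem_nth.
  have [eh em ej] := group_mem xG.
  have ri : rank v h j x = i by rewrite /rank index_uniq ?group_uniq.
  have -> : (blk v x < l)%N = ~~ block_fits (size (group v h j)) l i.
    by rewrite /blk /rank_of eh ej ri block_exp_lt.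
  rewrite ler_wpM2r// /u exprVn ler_pdivlMr ?exprn_gt0//.
  by have /andP[] := mass_lvlP em; rewrite ej.
rewrite -mulr_sumr mulrC ler_wpM2r// -natr_sum -natrX ler_nat.
rewrite (_ : (\sum_(i < _) _)%N = #|[pred i : 'I_(size (group v h j)) |
    ~~ block_fits (size (group v h j)) l i]|); last first.
  by rewrite -sum1_card [RHS]big_mkcond/=; apply: eq_bigr => i _; rewrite inE; case: block_fits.
exact: card_block_unfit.
Qed.

(** Sum over the 2^(T - v) prefixes and geometrically over the probability classes; the latter
    contribute (1 + e) / e, however many there are. *)
Lemma unfit_mass v l : (v <= T)%N -> (0 < l <= v)%N ->
  \sum_x mass v x * (blk v x < l)%:R <= 2 ^+ l * ((2 ^+ v)^-1 * ((1 + e) / e)).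
Proof.
move=> vT lv; have e10 : 0 < 1 + e by rewrite ltr_pwDl// ltW.
have hlt x : (H x %/ 2 ^ v < 2 ^ (T - v))%N.
  by rewrite ltn_divLR ?expn_gt0// -expnD subnK.
pose J := (\max_x mass_lvl v x).+1.
have jlt x : (mass_lvl v x < J)%N by rewrite ltnS leq_bigmax.
rewrite (partition_big (fun x => (Ordinal (hlt x), Ordinal (jlt x))) predT)//=.
apply: (@le_trans _ _ (\sum_(hj : 'I_(2 ^ (T - v)) * 'I_J)
   2 ^+ l * ((2 ^ T)%:R^-1 * ((1 + e)^-1) ^+ hj.2))).
  apply: ler_sum => -[h j] _ /=.
  apply: le_trans (group_unfit_mass (h : nat) (j : nat) lv).
  rewrite le_eqVlt; apply/orP; left; apply/eqP; apply: eq_bigl => x.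
  by rewrite xpair_eqE -!val_eqE.
rewrite -(pair_bigA _ (fun (h : 'I_(2 ^ (T - v))) (j : 'I_J) =>
  2 ^+ l * ((2 ^ T)%:R^-1 * ((1 + e)^-1) ^+ j)))/=.
rewrite sumr_const card_ord -mulr_sumr -mulrnAr ler_wpM2l ?exprn_ge0//.
rewrite -mulr_sumr -mulrnAl.
have -> : (2 ^ T)%:R^-1 *+ 2 ^ (T - v) = (2 ^+ v)^-1 :> R.
  rewrite -[LHS]mulr_natr !natrX -{1}(subnK vT) exprD invfM mulrAC mulVf ?mul1r//.
rewrite ler_wpM2l ?invr_ge0 ?exprn_ge0//.
have q1 : 0 <= (1 + e)^-1 < 1 by rewrite invr_ge0 (ltW e10)/= invf_lt1// ltrDl.
apply: (le_trans (geometric_sum_le J q1)); rewrite le_eqVlt; apply/orP; left; apply/eqP.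
by field; rewrite !gt_eqF//= addrC addrK gt_eqF.
Qed.

Definition expect_lvl : R := \sum_(xy : X * Y) p xy.1 xy.2 * (stop_lvl xy.1 xy.2)%:R.

Lemma sum_by_lvl (F : nat -> X -> R) :
  \sum_(xy : X * Y) p xy.1 xy.2 * F (stop_lvl xy.1 xy.2) xy.1 =
  \sum_(v < T.+1) \sum_x mass v x * F v x.
Proof.
rewrite (partition_big (fun xy : X * Y => Ordinal (stop_lvl_le xy.1 xy.2 : (_ < T.+1)%N)) predT)//=.
apply: eq_bigr => v _; under [RHS]eq_bigr do rewrite /mass mulr_suml.
rewrite pair_big_dep/=; apply: eq_big => [xy|xy /eqP <-//].
by rewrite -val_eqE.
Qed.

(** At each level the lost bits [v - blk] are a sum over [l] of the events [blk < l], bounded by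
    [unfit_mass] for small [l] and by the total mass of the level for large [l]. *)
Lemma blk_expectation (N : R) : 2 <= N -> \sum_(xy : X * Y) p xy.1 xy.2 = 1 ->
  (1 + log2 (1 - N^-1)) * expect_lvl - log2 N - log2 ((1 + e) / e) - 3 <=
  \sum_(xy : X * Y) p xy.1 xy.2 * (blk (stop_lvl xy.1 xy.2) xy.1)%:R.
Proof.
move=> N2 p1; have e10 : 0 < 1 + e by rewrite ltr_pwDl// ltW.
have N0 : 0 < N by lra.
set th := 1 - N^-1.
have Ni : 0 < N^-1 <= 2^-1 by rewrite invr_gt0 N0 lef_pV2 ?posrE.
have th0 : 0 < th by rewrite /th; lra.
have th1 : th < 1 by rewrite /th; lra.
pose ka : R := log2 N + log2 ((1 + e) / e) + 1.
have per (v : 'I_T.+1) : \sum_x mass v x * (v%:R - (blk v x)%:R) <=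
    \sum_x mass v x * (ka - v%:R * log2 th) + 2 * (th ^+ v / N).
  have vT : (v <= T)%N by rewrite -ltnS.
  (* The factor [th ^+ v] reduces the remainder to 2 th^v / N, which sums to at most 2 over all
     levels; it costs - v log2 th bits, and the rest of the cut-off costs the logarithms in [ka]. *)
  pose B : R := 2 ^+ v * (th ^+ v * (e / (N * (1 + e)))).
  have d0 : 0 < e / (N * (1 + e)) by rewrite divr_gt0// mulr_gt0.
  have B0 : 0 < B by rewrite mulr_gt0 ?exprn_gt0// mulr_gt0 ?exprn_gt0.
  have Bv : B <= 2 ^+ v.
    rewrite /B ler_piMr ?exprn_ge0// mulr_ile1 ?exprn_ge0 ?exprn_ile1 ?(ltW th0) ?(ltW th1) ?(ltW d0)//.
    by rewrite ler_pdivrMr ?mulr_gt0// mul1r; nra.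
  have lB : log2 B = v%:R + v%:R * log2 th - log2 N - log2 ((1 + e) / e).
    have t0 : 0 < 2 ^+ v :> R by rewrite exprn_gt0.
    have t1 : 0 < th ^+ v by rewrite exprn_gt0.
    have d1 : 0 < th ^+ v * (e / (N * (1 + e))) by rewrite mulr_gt0.
    have d2 : 0 < N * (1 + e) by rewrite mulr_gt0.
    rewrite /B (log2M t0 d1) (log2M t1 d0) log2_pow2 log2X// (log2_div e0 d2) log2M// log2_div//.
    lra.
  have := @capped_sum_le R v (fun l => \sum_x mass v x * (blk v x < l)%:R)
    (\sum_x mass v x) ((2 ^+ v)^-1 * ((1 + e) / e)) B _ _ B0 Bv.
  have -> : \sum_(1 <= l < v.+1) \sum_x mass v x * (blk v x < l)%:R =
      \sum_x mass v x * (v%:R - (blk v x)%:R).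
    rewrite exchange_big/=; apply: eq_bigr => x _; rewrite -mulr_sumr; congr (_ * _).
    by rewrite -natr_sum sum_ltn_nat ?blk_le// natrB// blk_le.
  move=> /(_ _ _ _)/le_trans; apply.
  - by apply: sumr_ge0 => x _; exact: mass_ge0.
  - by rewrite mulr_ge0 ?invr_ge0 ?exprn_ge0// divr_ge0// ltW.
  - move=> l lv; split; last exact: unfit_mass.
    apply: ler_sum => x _; rewrite -[leRHS]mulr1 ler_wpM2l ?mass_ge0//.
    by case: (_ < _)%N.
  - rewrite mulr_suml lB lerD//.
      apply: ler_sum => x _; rewrite ler_wpM2l ?mass_ge0// /ka; lra.
    rewrite le_eqVlt; apply/orP; left; apply/eqP; rewrite /B.
    by field; rewrite !gt_eqF// exprn_gt0.
have tot : \sum_(xy : X * Y) p xy.1 xy.2 * ((stop_lvl xy.1 xy.2)%:R - (blk (stop_lvl xy.1 xy.2) xy.1)%:R) <=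
    \sum_(xy : X * Y) p xy.1 xy.2 * (ka - (stop_lvl xy.1 xy.2)%:R * log2 th) + 2.
  rewrite (sum_by_lvl (fun v x => v%:R - (blk v x)%:R)).
  rewrite (sum_by_lvl (fun v x => ka - v%:R * log2 th)).
  apply: (@le_trans _ _ (\sum_(v < T.+1) (\sum_x mass v x * (ka - v%:R * log2 th) + 2 * (th ^+ v / N)))).
    by apply: ler_sum => v _; exact: per.
  rewrite big_split/= lerD2l -mulr_sumr -mulr_suml ler_piMr// ler_pdivrMr// mul1r.
  apply: (le_trans (geometric_sum_le _ _)); first by rewrite (ltW th0).
  by rewrite /th opprB addrC subrK invrK.
move: tot; under eq_bigr do rewrite mulrBr; rewrite sumrB.
under [X in _ <= X + _]eq_bigr do rewrite mulrBr mulrA.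
rewrite sumrB -!mulr_suml p1 mul1r /expect_lvl /ka.
move: (log2 th) => a; set E := \sum_i _; set F := \sum_i _; lra.
Qed.
End Core.

(** * Choice of the lists and of the hash *)

Lemma weighted_geometric_sum_le {R : realType} (q : R) n : 0 <= q < 1 ->
  \sum_(i < n) i%:R * q ^+ i <= (1 - q)^-1 ^+ 2.
Proof.
move=> q01; have /andP[q0 q1] := q01; have q1' : 0 < 1 - q by rewrite subr_gt0.
have E : (\sum_(i < n) i%:R * q ^+ i) * (1 - q) = \sum_(i < n) q ^+ i - 1 - (n%:R - 1) * q ^+ n.
  elim: n => [|n ih]; first by rewrite !big_ord0 expr0; ring.
  by rewrite !big_ord_recr/= mulrDl ih exprS -natr1; ring.
rewrite expr2 ler_pdivlMr// E.
apply: le_trans (geometric_sum_le n q01); case: n {E} => [|n].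
  by rewrite big_ord0 expr0; lra.
have : 0 <= (n.+1%:R - 1) * q ^+ n.+1 by rewrite mulr_ge0 ?exprn_ge0// -natr1 addrK.
by lra.
Qed.

Lemma card_prefix (n v a : nat) : (#|[pred j : 'I_n | j %/ 2 ^ v == a]| <= 2 ^ v)%N.
Proof.
rewrite cardE /enum_mem size_filter.
have -> : count [in [pred j : 'I_n | (j %/ 2 ^ v)%N == a]] (Finite.enum 'I_n) =
    count (fun j => j %/ 2 ^ v == a)%N (iota 0 n).
  by rewrite -val_enum_ord count_map enumT.
rewrite -size_filter -[leqRHS](size_iota (a * 2 ^ v)).
apply: uniq_leq_size; first by rewrite filter_uniq// iota_uniq.
move=> j; rewrite mem_filter => /andP[/eqP <- _].
rewrite mem_iota leq_trunc_div/= [X in (X < _)%N](divn_eq j (2 ^ v)) ltn_add2l.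
by rewrite ltn_mod expn_gt0.
Qed.

(* Shifting the value of [H] at [x'] by a constant permutes the colourings [H]. *)
Lemma sum_collision {R : realType} {X : finType} (n v : nat) (x x' : X) : x != x' ->
  n.+1%:R * \sum_(H : {ffun X -> 'I_n.+1}) ((H x' %/ 2 ^ v == H x %/ 2 ^ v)%N)%:R <=
  2 ^+ v * #|{ffun X -> 'I_n.+1}|%:R :> R.
Proof.
move=> xx'; pose shift (s : 'I_n.+1) (H : {ffun X -> 'I_n.+1}) :=
  [ffun z => if z == x' then H z + s else H z].
have shift_inj s : injective (shift s).
  move=> H1 H2 /ffunP eH; apply/ffunP => z; have := eH z; rewrite !ffunE.
  by case: eqP => // _; exact: addIr.
pose F (H : {ffun X -> 'I_n.+1}) : R := ((H x' %/ 2 ^ v == H x %/ 2 ^ v)%N)%:R.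
rewrite -/F -[n.+1 in X in X * _]card_ord mulr_natl -sumr_const.
rewrite (eq_bigr (fun s => \sum_H F (shift s H))); last first.
  by move=> s _; rewrite (reindex_inj (shift_inj s)).
rewrite exchange_big/= mulr_natr -sumr_const; apply: ler_sum => H _.
rewrite -natrX; apply: le_trans (_ : (#|[pred j : 'I_n.+1 | j %/ 2 ^ v == H x %/ 2 ^ v]|%N)%:R <= _); last first.
  by rewrite ler_nat card_prefix.
rewrite -sum1_card natr_sum [leRHS]big_mkcond/= [leRHS](reindex_inj (addrI (H x')))/=.
apply: ler_sum => s _; rewrite /F !ffunE eqxx (negbTE xx') inE.
by case: eqP.
Qed.

Section Average.
Context {R : realType} {X Y : finType}.
Variables (p : X -> Y -> R) (T : nat) (Lst : nat -> Y -> pred X) (B : nat -> R).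
Hypotheses (p0 : forall x y, 0 <= p x y)
  (p1 : \sum_(xy : X * Y) p xy.1 xy.2 = 1)
  (Bsize : forall v x y, 0 < p x y -> #|Lst v y|%:R * 2 ^+ v <= B v * 2 ^+ T).

Let collide v (H : X -> nat) x y : R :=
  \sum_(x' | (x != x') && Lst v y x') ((H x' %/ 2 ^ v == H x %/ 2 ^ v)%N)%:R.

(** At a positive stopping level some listed piece has the announced prefix. If the guess is not
    [x], it is another piece, and this collision appears in the term of that level. *)
Lemma wrong_le (H : X -> nat) x y : wrong T H Lst x y ->
  (stop_lvl T H Lst x y)%:R <= \sum_(v < T.+1) v%:R * collide v H x y.
Proof.
move=> /andP[]; set v := stop_lvl T H Lst x y => v0 g.
have vT : (v < T.+1)%N by rewrite ltnS stop_lvl_le.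
rewrite (bigD1 (Ordinal vT))//= -[leLHS]addr0 lerD//; last first.
  by apply: sumr_ge0 => u _; rewrite mulr_ge0// sumr_ge0.
rewrite -[leLHS]mulr1 ler_wpM2l//.
have := stops_at_stop_lvl T H Lst x y; rewrite -/v /stops_at eqn0Ngt v0/=.
move: g; rewrite /guess; case: pickP => [x' /andP[Lx' hx'] g _|nof _ /existsP[x']]; last by rewrite nof.
have xx' : x != x' by apply: contraNneq g => ->.
rewrite /collide (bigD1 x')/= ?xx' ?Lx'//= hx' lerDl.
exact: sumr_ge0.
Qed.

(** First-moment method: the mean over all colourings obeys the bound, so some colouring does. A
    listed piece collides with probability at most 2^(v - T), and a list has at most B v 2^(T - v)
    entries. *)
Lemma good_hash : (forall v, 0 <= B v) -> exists H : X -> nat, (forall x, (H x < 2 ^ T)%N) /\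
  \sum_(xy : X * Y | wrong T H Lst xy.1 xy.2) p xy.1 xy.2 * (stop_lvl T H Lst xy.1 xy.2)%:R <=
  \sum_(v < T.+1) v%:R * B v.
Proof.
move=> B0; pose n := (2 ^ T).-1; have nT : n.+1 = (2 ^ T)%N by rewrite prednK// expn_gt0.
pose W (H : {ffun X -> 'I_n.+1}) := \sum_(xy : X * Y | wrong T (fun x => H x : nat) Lst xy.1 xy.2)
  p xy.1 xy.2 * (stop_lvl T (fun x => H x : nat) Lst xy.1 xy.2)%:R.
suff : exists H, W H <= \sum_(v < T.+1) v%:R * B v.
  by move=> [H WH]; exists (fun x => H x : nat); split => // x; rewrite -nT.
apply: contrapT => nex.
pose b := \sum_(v < T.+1) v%:R * B v.
have hlt H : b < W H by rewrite ltNge; apply/negP => h; apply: nex; exists H.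
have card0 : (0 < #|{ffun X -> 'I_n.+1}|)%N by apply/card_gt0P; exists [ffun _ => ord0].
have : \sum_(H : {ffun X -> 'I_n.+1}) b < \sum_H W H.
  apply: ltr_sum => [|H _]; last exact: hlt.
  by apply/hasP; exists [ffun _ => ord0] => //; rewrite mem_index_enum.
rewrite ltNge => /negP; apply.
apply: (@le_trans _ _ (\sum_(H : {ffun X -> 'I_n.+1}) \sum_(xy : X * Y) \sum_(v < T.+1)
    v%:R * (p xy.1 xy.2 * collide v (fun x => H x : nat) xy.1 xy.2))).
  apply: ler_sum => H _; rewrite /W big_mkcond/=; apply: ler_sum => -[x y] _ /=.
  under eq_bigr do rewrite mulrCA.
  rewrite -mulr_sumr; case: ifPn => [w|_].
    by rewrite ler_wpM2l//; exact: wrong_le.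
  by rewrite mulr_ge0// sumr_ge0// => v _; rewrite mulr_ge0// sumr_ge0.
rewrite exchange_big/=; under eq_bigr do rewrite exchange_big/=.
rewrite exchange_big/= sumr_const -mulr_natr /b mulr_suml; apply: ler_sum => v _.
under eq_bigr do rewrite -mulr_sumr.
rewrite -mulr_sumr -mulrA ler_wpM2l//.
apply: (@le_trans _ _ (\sum_(xy : X * Y) p xy.1 xy.2 * (B v * #|{ffun X -> 'I_n.+1}|%:R))); last first.
  by rewrite -mulr_suml p1 mul1r.
apply: ler_sum => -[x y] _ /=; rewrite -mulr_sumr.
have := p0 x y; rewrite le_eqVlt => /orP[/eqP <-|pxy]; first by rewrite !mul0r.
rewrite ler_pM2l// /collide exchange_big/=.
have K0 : 0 < 2 ^+ T :> R by rewrite exprn_gt0.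
rewrite -(ler_pM2l K0) mulr_sumr.
apply: (@le_trans _ _ (\sum_(x' | (x != x') && Lst v y x') 2 ^+ v * #|{ffun X -> 'I_n.+1}|%:R)).
  apply: ler_sum => x' /andP[xx' _].
  by have := @sum_collision R X n v x x' xx'; rewrite nT natrX.
apply: (@le_trans _ _ (\sum_(x' in Lst v y) 2 ^+ v * #|{ffun X -> 'I_n.+1}|%:R)).
  rewrite big_mkcond [leRHS]big_mkcond/=; apply: ler_sum => x' _.
  rewrite -[x' \in _]/(Lst v y x'); case: (Lst v y x'); rewrite ?andbF// andbT.
  by case: ifP => // _; rewrite mulr_ge0// exprn_ge0.
rewrite sumr_const -[leLHS]mulr_natl mulrA [leRHS]mulrA ler_wpM2r//.
by rewrite [leRHS]mulrC; exact: (Bsize v pxy).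
Qed.
End Average.

Section CoreChoice.
Context {R : realType} {X Y : finType}.
Variables (p : X -> Y -> R) (T : nat) (e N : R).
Hypotheses (p0 : forall x y, 0 <= p x y) (e0 : 0 < e) (e1 : e < 1)
  (pX : forall x, \sum_y p x y <= (2 ^ T)%:R^-1)
  (p1 : \sum_(xy : X * Y) p xy.1 xy.2 = 1) (N2 : 2 <= N).

Let th := 1 - N^-1.
(** Chosen so that cst (1 - th)^-2 = e / 2, which cancels the factor 2 / e of [klen_expectation]. *)
Let cst := e / (2 * N ^+ 2).
Let col y := \sum_x p x y.

(* The threshold decays with [v] fast enough for the expected number of levels lost
   to hash collisions to stay below [e / 2]. *)
Definition lists v y : pred X := fun x =>
  (0 < p x y) && (2 ^+ v * col y <= cst * th ^+ v * 2 ^+ T * p x y).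

(** Mean of log2 (p(x | y) / 2^-T): close to the mutual information when pieces have probability
    close to 2^-T. *)
Definition density_log : R :=
  \sum_(xy : X * Y) p xy.1 xy.2 * log2 (2 ^+ T * (p xy.1 xy.2 / col xy.2)).

Let N0 : 0 < N. Proof. by apply: lt_le_trans N2. Qed.
Let Ni : 0 < N^-1 <= 2^-1. Proof. by rewrite invr_gt0 N0 lef_pV2 ?posrE. Qed.
Let th0 : 0 < th. Proof. by rewrite /th; move: Ni => /andP[]; lra. Qed.
Let th1 : th < 1. Proof. by rewrite /th; move: Ni => /andP[]; lra. Qed.
Let cst0 : 0 < cst. Proof. by rewrite divr_gt0// mulr_gt0// exprn_gt0. Qed.
Let cst1 : cst <= 1.
Proof.
rewrite ler_pdivrMr ?mulr_gt0 ?exprn_gt0// mul1r.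
have : 1 <= N ^+ 2 by rewrite exprn_ege1//; move: N2; lra.
by move: e1; lra.
Qed.
Let col_ge x y : p x y <= col y.
Proof. by rewrite /col (bigD1 x)//= lerDl sumr_ge0. Qed.

(** Listed pieces have p(x | y) at least 2^(v - T) / (cst th^v), and these conditional probabilities
    sum to at most 1. *)
Let lists_size v x y : 0 < p x y -> #|lists v y|%:R * 2 ^+ v <= cst * th ^+ v * 2 ^+ T.
Proof.
move=> pxy; have col0 : 0 < col y by apply: lt_le_trans (col_ge x y).
rewrite -(ler_pM2r col0) -[leLHS]mulrA -sum1_card natr_sum mulr_suml.
apply: (@le_trans _ _ (\sum_(x' in lists v y) cst * th ^+ v * 2 ^+ T * p x' y)).
  by apply: ler_sum => x' /andP[_]; rewrite mul1r.
rewrite /col mulr_sumr [leLHS]big_mkcond/=.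
apply: ler_sum => x' _; case: ifP => // _.
by rewrite mulr_ge0// mulr_ge0 ?exprn_ge0// mulr_ge0 ?exprn_ge0 ?(ltW cst0) ?(ltW th0).
Qed.

(** The true piece is itself listed at the integer part of [z], the solution of the threshold
    equation, so Bob stops there or at a higher level. The added 1 pays for rounding. *)
Let lvl_ge (H : X -> nat) x y : 0 < p x y ->
  log2 (2 ^+ T * (p x y / col y)) + log2 cst <=
  (1 - log2 th) * (1 + (stop_lvl T H lists x y)%:R).
Proof.
move=> pxy; have col0 : 0 < col y by apply: lt_le_trans (col_ge x y).
have T0 : 0 < 2 ^+ T :> R by rewrite exprn_gt0.
have lth : log2 th <= 0 by rewrite -log2_1 ler_log2// ltW.
have lcst : log2 cst <= 0 by rewrite -log2_1 ler_log2.
have r0 : 0 < p x y / col y by rewrite divr_gt0.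
have r1 : log2 (p x y / col y) <= 0.
  by rewrite -log2_1 ler_log2// ler_pdivrMr// mul1r.
rewrite (log2M T0 r0) log2_pow2.
set lr := log2 (p x y / col y) in r1 *.
set z := (T%:R + lr + log2 cst) / (1 - log2 th).
have a0 : 0 < 1 - log2 th by lra.
suff : z <= 1 + (stop_lvl T H lists x y)%:R by rewrite /z ler_pdivrMr// mulrC.
have [zneg|z0] := ltP z 0.
  by apply: (le_trans (ltW zneg)); rewrite addr_ge0.
have /andP[zl zu] := truncn_itv z0; set v := Num.truncn z in zl zu.
have zT : z <= T%:R.
  rewrite /z ler_pdivrMr//.
  have : 0 <= T%:R * - log2 th by rewrite mulr_ge0// oppr_ge0.
  by lra.
have vT : (v <= T)%N by rewrite -(ler_nat R) (le_trans zl).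
suff : (v <= stop_lvl T H lists x y)%N.
  by rewrite -(ler_nat R) => h; rewrite -natr1 in zu; lra.
apply: (stop_lvl_ge vT); rewrite /stops_at /found; apply/orP; right.
apply/existsP; exists x; rewrite eqxx andbT /lists pxy/=.
have t1 : 0 < th ^+ v by rewrite exprn_gt0.
have t2 : 0 < 2 ^+ v :> R by rewrite exprn_gt0.
have t3 : 0 < cst * th ^+ v by rewrite mulr_gt0.
rewrite -[leRHS]mulrA leNgt; apply/negP => /(ltr_log2 _).
rewrite (mulr_gt0 t3 (mulr_gt0 T0 pxy)) => /(_ isT).
rewrite (log2M t3 (mulr_gt0 T0 pxy)) (log2M cst0 t1) (log2M T0 pxy) (log2M t2 col0).
rewrite !log2_pow2 (log2X _ th0).
move: zl; rewrite /z ler_pdivlMr// /lr log2_div//.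
move: (log2 th) (log2 cst) (log2 (p x y)) (log2 (col y)) (v%:R) => a b c d w.
rewrite mulrBr mulr1; move: (w * a) => wa.
by clear z z0 zu zT lr r0 r1 v vT t1 t2 t3 a0 lth lcst; lra.
Qed.

(** Put a = - log2 th. The mean level is at least (D + log2 cst) / (1 + a) - 1, and the blocks keep
    1 - a of it up to logarithms. As a D <= 2, the loss 2 a D is at most 4. Thus 11 = 4 + 1
    (rounding) + 1 ([cst]) + 1 (from (1 + e) / e) + 3 (blocks) + 1 (wrong guesses). *)
Lemma good_scheme : exists H : X -> nat, (forall x, (H x < 2 ^ T)%N) /\
  (density_log <= N - 1 ->
   density_log - 3 * log2 N - 2 * log2 e^-1 - 11 <=
   \sum_(xy : X * Y) p xy.1 xy.2 * (klen p T H lists e (pub p T H lists e xy.1 xy.2))%:R).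
Proof.
have B0 v : 0 <= cst * th ^+ v by rewrite mulr_ge0 ?exprn_ge0 ?(ltW th0) ?(ltW cst0).
have [H [HT Hw]] := good_hash p0 p1 lists_size B0.
exists H; split => // DN; set EL := \sum_xy _.
have EL0 : 0 <= EL by apply: sumr_ge0 => xy _; rewrite mulr_ge0.
have lN : 1 <= log2 N by rewrite -log2_2 ler_log2.
have le : 0 <= log2 e^-1 by rewrite log2_ge0// invf_ge1// ltW.
have lam : log2 cst = - (1 + 2 * log2 N + log2 e^-1).
  have N20 : 0 < 2 * N ^+ 2 by rewrite mulr_gt0 ?exprn_gt0.
  rewrite /cst (log2_div e0 N20) (log2M _ (exprn_gt0 2 N0))// log2_2 log2X// log2V//.
  by lra.
(* In the first case the claimed lower bound is negative. *)
have [small|big] := leP (density_log + log2 cst) 0.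
  by apply: le_trans EL0; rewrite lam in small; lra.
have loss : 2 / e * \sum_(xy : X * Y | wrong T H lists xy.1 xy.2)
    p xy.1 xy.2 * (stop_lvl T H lists xy.1 xy.2)%:R <= 1.
  have E : 2 / e * (cst * (1 - th)^-1 ^+ 2) = 1.
    by rewrite /cst /th opprB addrC subrK invrK; field; rewrite !gt_eqF.
  rewrite -[leRHS]E.
  rewrite ler_pM2l ?divr_gt0//; apply: (le_trans Hw).
  under eq_bigr do rewrite mulrCA.
  rewrite -mulr_sumr ler_pM2l//; apply: weighted_geometric_sum_le.
  by rewrite (ltW th0).
have h1 := klen_expectation T H lists p0 e0.
have h2 := blk_expectation lists p0 e0 pX HT N2 p1.
have h3 : density_log + log2 cst <= (1 - log2 th) * (1 + expect_lvl p T H lists).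
  rewrite -[log2 cst]mul1r -[1 in X in X * log2 _]p1 mulr_suml /density_log -big_split/=.
  rewrite mulrDr mulr1 -[X in X + _]mul1r -[1 in X in X * _ + _]p1 mulr_suml /expect_lvl mulr_sumr -big_split/=.
  apply: ler_sum => -[x y] _ /=; rewrite [(1 - _) * (p x y * _)]mulrCA -!mulrDr.
  have := p0 x y; rewrite le_eqVlt => /orP[/eqP <-|pxy]; first by rewrite !mul0r.
  by rewrite ler_pM2l//; have := lvl_ge H pxy; lra.
have a0 : 0 <= - log2 th by rewrite oppr_ge0 -log2_1 ler_log2// ltW.
(* - ln th = ln (N / (N - 1)) <= 1 / (N - 1), and ln 2 >= 1/2. *)
have aD : - log2 th * (N - 1) <= 2.
  have N1 : 0 < N - 1 by move: N2; lra.
  have -> : - log2 th = log2 (N / (N - 1)).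
    by rewrite -log2V// /th; congr log2; field; rewrite !gt_eqF.
  have r0 : 0 < N / (N - 1) by rewrite divr_gt0.
  rewrite /log2 mulrAC ler_pdivrMr ?ln2_gt0//.
  apply: (@le_trans _ _ 1); last by have := @ln2_ge R; lra.
  rewrite -ler_pdivlMr//; apply: (le_trans (ln_leB1 r0)).
  by rewrite le_eqVlt; apply/orP; left; apply/eqP; field; rewrite gt_eqF.
have a1 : - log2 th <= 1.
  rewrite -log2V// -log2_2 ler_log2 ?invr_gt0//.
  rewrite -[2]invrK lef_pV2 ?posrE ?invr_gt0//.
  by rewrite /th; move: Ni => /andP[_]; lra.
have le1 : log2 ((1 + e) / e) <= 1 + log2 e^-1.
  have e10 : 0 < 1 + e by rewrite ltr_pwDl// ltW.
  rewrite log2_div// log2V// lerD2r -[leRHS]log2_2 ler_log2//; move: e1; lra.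
move: h1 h2 h3 loss DN big le1 aD a1 a0; rewrite -/th lam -/EL.
set D := density_log; set a := log2 th; set V := expect_lvl _ _ _ _.
set E := \sum_xy _; set W := 2 / e * _ => h1 h2 h3 h4 DN big le1 aD a1 a0.
have aD2 : - a * D <= 2 by apply: le_trans aD; rewrite ler_wpM2l.
nra.
Qed.
End CoreChoice.

(** * The protocol as a scheme *)

Lemma measurable_fiber_pred {d} {T : measurableType d} {I : finType} (f : T -> I) (Q : I -> Prop) :
  mfibers f -> measurable [set t | Q (f t)].
Proof.
move=> mf; rewrite (_ : [set t | _] = \bigcup_(i in [set i | Q i]) fiber f i).
  by apply: fin_bigcup_measurable => // i _; exact: mf.
apply/seteqP; split => t /=; first by move=> h; exists (f t).
by move=> [i Qi]; rewrite /fiber/= => ->.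
Qed.

Lemma esum_finite_support {R : realType} {I : choiceType} (s : seq I) (a : I -> R) :
  uniq s -> (forall i, 0 <= a i) -> (forall i, i \notin s -> a i = 0) ->
  (\esum_(i in [set: I]) (a i)%:E = (\sum_(i <- s) a i)%:E)%E.
Proof.
move=> us a0 as0; rewrite -sumEFin fsbig_seq//= -esum_fset//.
  by rewrite [RHS]esum_mkcond; apply: eq_esum => i _; rewrite mem_setE; case: ifPn => // /as0 ->.
by move=> i _; rewrite lee_fin.
Qed.

Lemma sum_iota1 {R : realType} n (F : nat -> R) :
  \sum_(i <- iota 1 n) F i = \sum_(i < n) F i.+1.
Proof.
by rewrite (iotaDl 1 0) big_map -[iota 0 n]val_enum_ord big_map big_enum.
Qed.

Section Bridge.
Context {R : realType} {d1 d2 da : measure_display}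
  {T1 : measurableType d1} {T2 : measurableType d2} {Oa : measurableType da} {X Y : finType}.
Variables (P : probability (T1 * T2)%type R) (Q : probability Oa R)
  (phi : T1 * Oa -> X) (psi : T2 -> Y).
Hypotheses (mphi : mfibers phi) (mpsi : mfibers psi).

Definition law (x : X) (y : Y) : R :=
  sk_pr P Q Q (fun z1 z2 u _ => phi (z1, u) = x /\ psi z2 = y).

Let alice_measurable (F : X -> Prop) : measurable [set xu : T1 * Oa | F (phi (xu.1, xu.2))].
Proof.
rewrite (_ : [set _ | _] = [set xu | F (phi xu)]); last by apply/seteqP; split => -[].
exact: (measurable_fiber_pred F mphi).
Qed.

Let bob_measurable (F : Y -> Prop) : measurable [set yv : T2 * Oa | F (psi yv.1)].
Proof.
rewrite -[X in measurable X]setTI.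
exact: (measurable_fst measurableT _ (measurable_fiber_pred F mpsi)).
Qed.

Lemma event_law_measurable (F : X -> Y -> Prop) :
  measurable (@event _ _ _ _ T1 T2 Oa Oa (fun z1 z2 u _ => F (phi (z1, u)) (psi z2))).
Proof.
rewrite (_ : event _ = \bigcup_(xy in [set xy : X * Y | F xy.1 xy.2])
    (event (fun z1 z2 u v => phi (z1, u) = xy.1) `&` event (fun z1 z2 u v => psi z2 = xy.2))).
  apply: fin_bigcup_measurable => // -[x y] _; apply: measurableI.
    exact: (event_alice_measurable (alice_measurable (fun x' => x' = x))).
  exact: (event_bob_measurable (bob_measurable (fun y' => y' = y))).
apply/seteqP; split => o.
  by move=> h; exists (phi (o.1.1.1, o.1.2), psi o.1.1.2).
by move=> [[x y] /= h [/= e1 e2]]; rewrite /event/= e1 e2.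
Qed.

(** Everything in the protocol depends on the data only through [phi] and [psi], so all its
    probabilities become finite sums. *)
Lemma sk_pr_law (F : X -> Y -> bool) :
  sk_pr P Q Q (fun z1 z2 u _ => F (phi (z1, u)) (psi z2)) =
  \sum_(xy : X * Y | F xy.1 xy.2) law xy.1 xy.2.
Proof.
have mF := event_law_measurable F.
rewrite (sk_pr_event _ _ _ mF) big_mkcond/=.
pose A (xy : X * Y) : set (((T1 * T2) * Oa) * Oa)%type :=
  event (fun z1 z2 u _ => F xy.1 xy.2 /\ (phi (z1, u) = xy.1 /\ psi z2 = xy.2)).
have mA xy : measurable (A xy) by exact: (event_law_measurable (fun x y => F xy.1 xy.2 /\ (x = xy.1 /\ y = xy.2))).
rewrite -(@sum_pr_disjoint _ _ _ (total_law P Q Q) _ A _ mA mF).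
- apply: eq_bigr => -[x y] _ /=; case: ifPn => Fxy.
    rewrite /law (sk_pr_event _ _ _ (event_law_measurable (fun x' y' => x' = x /\ y' = y))).
    by congr (fine (_ _)); apply/seteqP; split => o; rewrite /A /event/=; tauto.
  rewrite (_ : A _ = set0) ?measure0//; apply/seteqP; split => o //.
  by rewrite /A /event/= (negbTE Fxy) => -[].
- by move=> [x y] [x' y'] o [_ [/= <- <-]] [_ [/= <- <-]].
- move=> o; split => [h|[[x y] [/= h [e1 e2]]]].
    by exists (phi (o.1.1.1, o.1.2), psi o.1.1.2).
  by rewrite /event/= e1 e2.
Qed.

Lemma law_ge0 x y : 0 <= law x y.
Proof. exact: sk_pr_ge0. Qed.

Lemma law_sum1 : \sum_(xy : X * Y) law xy.1 xy.2 = 1.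
Proof.
rewrite -(sk_pr_law (fun _ _ => true)) (sk_pr_event _ _ _ (event_law_measurable (fun _ _ => true))).
by rewrite (_ : event _ = setT) ?probability_setT//; apply/seteqP; split.
Qed.

Variables (T : nat) (H : X -> nat) (Lst : nat -> Y -> pred X) (e : R).
Hypotheses (e0 : 0 < e) (e1 : e < 1) (pX : forall x, \sum_y law x y <= (2 ^ T)%:R^-1).

Let pb := pub law T H Lst e.
Let tr := transcript law T H Lst e.
Let kl := klen law T H Lst e.

(** The length is a function of the transcript alone, so the parties agree on it everywhere. *)
Definition hash_scheme : skaScheme T1 T2 Oa Oa := SkaScheme halts
  (fun w z u => msgA law T H Lst e w (phi (z, u)))
  (fun w z _ => msgB T H Lst w (psi z))
  (fun _ w => kl (decode T w)) (fun _ w => kl (decode T w))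
  (fun z u w => keyA law T H Lst e (phi (z, u)) (decode T w))
  (fun z _ w => keyB law T H Lst e (psi z) (decode T w)).

Let S := hash_scheme.

Lemma hash_trans k z1 z2 u v :
  sk_trans S k z1 z2 u v = dialogue law T H Lst e k (phi (z1, u)) (psi z2).
Proof. by elim: k => //= k ->. Qed.

Lemma hash_term w z1 z2 u v :
  sk_term S w z1 z2 u v <-> tr (phi (z1, u)) (psi z2) = w.
Proof.
have st : sk_term S (tr (phi (z1, u)) (psi z2)) z1 z2 u v.
  have E : sk_trans S ((T - stop_lvl T H Lst (phi (z1, u)) (psi z2)).*2 + 3) z1 z2 u v =
      tr (phi (z1, u)) (psi z2) by rewrite hash_trans dialogue_transcript.
  by rewrite -E; apply: sk_term_trans; rewrite E; exact: halts_transcript.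
by split => [h|<-//]; exact: sk_term_uniq st h.
Qed.

Lemma hash_valid : sk_valid S P Q Q.
Proof.
split; first by move=> h m; exact: (alice_measurable (fun x => msgA law T H Lst e h x = m)).
split; first by move=> h m; exact: (bob_measurable (fun y => msgB T H Lst h y = m)).
split; first by move=> w l; exact: (measurable_prop (kl (decode T w) = l)).
split; first by move=> w l; exact: (measurable_prop (kl (decode T w) = l)).
split; first by move=> w a; exact: (alice_measurable (fun x => keyA law T H Lst e x (decode T w) = a)).
split; first by move=> w b; exact: (bob_measurable (fun y => keyB law T H Lst e y (decode T w) = b)).
split.
  move=> z1 z2 u v; exists ((T - stop_lvl T H Lst (phi (z1, u)) (psi z2)).*2 + 3)%N.
  by rewrite hash_trans dialogue_transcript//; apply: halts_transcript.
split.
  move=> k; exists (\max_(xy : X * Y) nth 0%N (dialogue law T H Lst e k.+1 xy.1 xy.2) k).+1.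
  move=> z1 z2 u v _; rewrite hash_trans ltnS.
  exact: (@leq_bigmax _ (fun xy : X * Y => nth 0%N (dialogue law T H Lst e k.+1 xy.1 xy.2) k)
    (phi (z1, u), psi z2)).
by split => *; [exact: keyA_itv|exact: keyB_itv].
Qed.

Lemma hash_agree : sk_len_agree S P Q Q.
Proof.
transitivity (\sum_(xy : X * Y | false) law xy.1 xy.2); last by rewrite big_pred0.
rewrite -(sk_pr_law (fun _ _ => false)); congr sk_pr.
by do 4 (apply/funext => ?); apply/propext; split => // -[w [_ /=]].
Qed.

Lemma hash_pL l : sk_pL S P Q Q l = \sum_(xy : X * Y | kl (pb xy.1 xy.2) == l) law xy.1 xy.2.
Proof.
rewrite -(sk_pr_law (fun x y => kl (pb x y) == l)); congr sk_pr.
do 4 (apply/funext => ?); apply/propext; split.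
  by move=> [w [/hash_term <- /=]]; rewrite decode_transcript => ->.
by move=> /eqP <-; eexists; split; [apply/hash_term; reflexivity|rewrite /= decode_transcript].
Qed.

Lemma hash_pWL w l : sk_pWL S P Q Q w l =
  \sum_(xy : X * Y | (tr xy.1 xy.2 == w) && (kl (decode T w) == l)) law xy.1 xy.2.
Proof.
rewrite -(sk_pr_law (fun x y => (tr x y == w) && (kl (decode T w) == l))); congr sk_pr.
do 4 (apply/funext => ?); apply/propext; split.
  by move=> [/hash_term -> /= ->]; rewrite !eqxx.
by move=> /andP[/eqP ? /eqP ?]; split => //; exact/hash_term.
Qed.

Lemma hash_pABWL a b w l : sk_pABWL S P Q Q a b w l =
  \sum_(xy : X * Y | [&& tr xy.1 xy.2 == w, keyA law T H Lst e xy.1 (decode T w) == a,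
     keyB law T H Lst e xy.2 (decode T w) == b & kl (decode T w) == l]) law xy.1 xy.2.
Proof.
rewrite -(sk_pr_law (fun x y => [&& tr x y == w, keyA law T H Lst e x (decode T w) == a,
     keyB law T H Lst e y (decode T w) == b & kl (decode T w) == l])); congr sk_pr.
do 4 (apply/funext => ?); apply/propext; split.
  by move=> [/hash_term -> /= -> -> ->]; rewrite !eqxx.
by move=> /and4P[/eqP ? /eqP ? /eqP ? /eqP ?]; split => //; exact/hash_term.
Qed.

Lemma hash_EL : ((\sum_(xy : X * Y) law xy.1 xy.2 * (kl (pb xy.1 xy.2))%:R)%:E <= sk_EL S P Q Q)%E.
Proof.
pose M := (\max_(xy : X * Y) kl (pb xy.1 xy.2)).+1.
have lM (xy : X * Y) : (kl (pb xy.1 xy.2) < M)%N.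
  by rewrite ltnS; exact: (@leq_bigmax _ (fun xy : X * Y => kl (pb xy.1 xy.2)) xy).
apply: le_trans (@esum_ge_finsum R nat _ (@nat_of_ord M) (fun l => l%:R * sk_pL S P Q Q l) (@ord_inj M)).
rewrite lee_fin (partition_big (fun xy => Ordinal (lM xy)) predT)//=.
apply: ler_sum => l _; rewrite hash_pL mulr_sumr le_eqVlt; apply/orP; left; apply/eqP.
by apply: eq_big => [xy|xy /eqP <-]; rewrite -?val_eqE//= mulrC.
Qed.

Lemma tr_decode x y x0 y0 : (tr x y == tr x0 y0) = (pb x y == pb x0 y0).
Proof.
apply/eqP/eqP => [E|/(transcript_pub e0 e1)//].
by rewrite /pb -(decode_transcript law T H Lst e x y) -[RHS]decode_transcript -/(tr x y) E.
Qed.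

(** The sum in [sk_dist_l] has finite support. Grouped by transcript, that is by class, it is
    bounded by [class_dev]; the factor 1/2 turns 2 e into e. *)
Lemma hash_dist : sk_dist_le S P Q Q e.
Proof.
move=> l pL0; rewrite /sk_dist_l; set pL := sk_pL S P Q Q l in pL0 *.
pose s := undup [seq tr xy.1 xy.2 | xy : X * Y].
pose f (o : nat * nat * seq nat) : R := `| sk_pABWL S P Q Q o.1.1 o.1.2 o.2 l / pL
         - (if (o.1.1 == o.1.2) && (1 <= o.1.1 <= 2 ^ l)%N
            then (2 ^ l)%:R^-1 * (sk_pWL S P Q Q o.2 l / pL) else 0) |.
pose t := [seq (ab, w) | ab <- [seq (a, b) | a <- iota 1 (2 ^ l), b <- iota 1 (2 ^ l)], w <- s].
rewrite (@esum_finite_support _ _ t f); last first.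
- move=> [[a b] w] nt; rewrite /f /=.
  have [wins|nws] := boolP (w \in s); last first.
    have none xy : (tr xy.1 xy.2 == w) = false.
      apply/negP => /eqP E; move/negP: nws; apply; rewrite mem_undup -E.
      by apply: map_f; rewrite mem_enum.
    rewrite hash_pABWL hash_pWL !big_pred0 ?mul0r ?mulr0 ?if_same ?subrr ?normr0//.
      by move=> xy; rewrite none.
    by move=> xy; rewrite none.
  have nab : ~~ ((1 <= a <= 2 ^ l)%N && (1 <= b <= 2 ^ l)%N).
    apply: contra nt => /andP[ha hb]; apply: allpairs_f => //.
    by apply: allpairs_f; rewrite mem_iota add1n ltnS.
  rewrite ifF; last first.
    by apply: contraNF nab => /andP[/eqP <- ->].
  rewrite hash_pABWL big_pred0 ?mul0r ?subr0 ?normr0// => xy.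
  apply: contraNF nab => /and4P[_ /eqP <- /eqP <- /eqP <-].
  by rewrite /kl keyA_itv keyB_itv.
- by move=> o; exact: normr_ge0.
- apply: allpairs_uniq => [||[? ?] [? ?] _ _ [-> ->]//]; last exact: undup_uniq.
  by apply: allpairs_uniq => [||[? ?] [? ?] _ _ [-> ->]//]; exact: iota_uniq.
rewrite -EFinM lee_fin big_allpairs_dep/= exchange_big/=.
suff : \sum_(w <- s) \sum_(ab <- [seq (a, b) | a <- iota 1 (2 ^ l), b <- iota 1 (2 ^ l)]) f (ab, w) <=
    2 * e by lra.
apply: (@le_trans _ _ (\sum_(w <- s) 2 * e *
    (\sum_(xy : X * Y | tr xy.1 xy.2 == w) (if kl (pb xy.1 xy.2) == l then law xy.1 xy.2 else 0) / pL))); last first.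
  rewrite -mulr_sumr -[leRHS]mulr1 ler_wpM2l ?mulr_ge0 ?(ltW e0)//.
  rewrite -(partition_image (fun xy : X * Y => tr xy.1 xy.2)
    (fun xy => (if kl (pb xy.1 xy.2) == l then law xy.1 xy.2 else 0) / pL)).
  by rewrite -mulr_suml -big_mkcond/= -hash_pL divff// gt_eqF.
rewrite big_seq [leRHS]big_seq; apply: ler_sum => w.
rewrite mem_undup => /mapP[[x0 y0] _ /= ->].
rewrite big_allpairs_dep/=.
have dw : decode T (tr x0 y0) = pb x0 y0 by exact: decode_transcript.
have prE : \sum_(xy : X * Y | tr xy.1 xy.2 == tr x0 y0)
    (if kl (pb xy.1 xy.2) == l then law xy.1 xy.2 else 0) / pL =
    if kl (pb x0 y0) == l then class_pr law T H Lst e (pb x0 y0) / pL else 0.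
  rewrite -mulr_suml; case: ifPn => kll.
    congr (_ / _); apply: eq_big => xy; rewrite tr_decode// => /eqP ->.
    by rewrite kll.
  rewrite big1 ?mul0r// => xy; rewrite tr_decode => /eqP ->.
  by rewrite (negbTE kll).
(* A class with another key length contributes nothing to either law. *)
rewrite prE; case: ifPn => [/eqP kll|kll]; last first.
  rewrite mulr0 big1// => a _; rewrite big1// => b _; rewrite /f/=.
  rewrite hash_pABWL hash_pWL dw (negbTE kll).
  rewrite !big_pred0 ?mul0r ?mulr0 ?if_same ?subrr ?normr0// => xy.
    by rewrite andbF.
  by rewrite !andbF.
rewrite mulrA ler_pdivlMr// mulr_suml.
apply: le_trans (class_dev H Lst law_ge0 e0 pX (pb x0 y0)); rewrite -/kl kll sum_iota1.
apply: ler_sum => a _; rewrite sum_iota1 mulr_suml; apply: ler_sum => b _.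
rewrite /f/= ltn_ord andbT eqSS -[X in _ <= `|_ - (if X then _ else _)|]val_eqE/=.
rewrite -[X in _ * X](gtr0_norm pL0) -normrM mulrBl divfK ?(gt_eqF pL0)//.
have -> : sk_pABWL S P Q Q a.+1 b.+1 (tr x0 y0) l =
    class_key_pr law T H Lst e (pb x0 y0) a.+1 b.+1.
  rewrite hash_pABWL dw kll eqxx; apply: eq_bigl => xy.
  by rewrite tr_decode andbT.
have -> : sk_pWL S P Q Q (tr x0 y0) l = class_pr law T H Lst e (pb x0 y0).
  by rewrite hash_pWL dw kll eqxx; apply: eq_bigl => xy; rewrite tr_decode andbT.
case: (_ == _ :> nat); last by rewrite mul0r.
by rewrite mulrA divfK// gt_eqF.
Qed.

Lemma Lstar_ge_hash :
  ((\sum_(xy : X * Y) law xy.1 xy.2 * (kl (pb xy.1 xy.2))%:R)%:E <= Lstar P e)%E.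
Proof.
apply: (le_trans hash_EL); apply: ereal_sup_ubound.
exists da, da, Oa, Oa, Q, Q, S; split => //.
- exact: hash_valid.
- exact: hash_agree.
- exact: hash_dist.
Qed.
End Bridge.

(** * Splitting cells and the lower bound *)

Section UniformNat.
Context {R : realType}.
Variable K : nat.

Definition uniform_nat : set nat -> \bar R :=
  msum (fun i => mscale (K.+1%:R^-1)%:nng (@dirac _ nat i R)) K.+1.

HB.instance Definition _ := Measure.on uniform_nat.

Lemma uniform_natE (A : set nat) :
  uniform_nat A = (K.+1%:R^-1 * \sum_(i < K.+1) (nat_of_ord i \in A)%:R)%:E.
Proof.
rewrite /uniform_nat /msum mulr_sumr -sumEFin; apply: eq_bigr => i _.
by rewrite -[LHS]/((K.+1%:R^-1)%:E * \d_(nat_of_ord i) A)%E diracE EFinM.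
Qed.

Let uniform_nat_setT : uniform_nat [set: nat] = 1%:E.
Proof.
rewrite uniform_natE; under eq_bigr do rewrite in_setT.
by rewrite sumr_const card_ord mulVf.
Qed.

HB.instance Definition _ := Measure_isProbability.Build _ _ R uniform_nat uniform_nat_setT.

Lemma sum_mod (q m k : nat) : (k < m)%N -> (\sum_(i < q * m) (i %% m == k) = q)%N.
Proof.
move=> km; elim: q => [|q ih]; first by rewrite mul0n big_ord0.
rewrite mulSnr big_split_ord/= ih (bigD1 (Ordinal km))//= modnMDl modn_small// eqxx.
rewrite big1 ?addn0 ?addn1// => j jk; rewrite modnMDl modn_small//.
by apply/eqP; rewrite eqb0; apply: contra jk => /eqP jk; exact/eqP/val_inj.
Qed.

(** One random number splits all cells at once: K + 1 will be the product of the numbers of pieces,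
    so its residue modulo each of them is uniform. *)
Lemma uniform_nat_mod (m k : nat) : (m %| K.+1)%N -> (k < m)%N ->
  fine (uniform_nat [set u | u %% m = k]%N) = m%:R^-1.
Proof.
move=> /dvdnP[q Kq] km; rewrite uniform_natE/=.
rewrite (eq_bigr (fun i : 'I_K.+1 => ((i %% m == k)%N : nat)%:R)); last first.
  move=> i _; congr ((nat_of_bool _)%:R); apply/idP/eqP; first by rewrite inE.
  by move=> h; rewrite inE.
rewrite -natr_sum Kq sum_mod// natrM invfM mulrAC mulVf ?mul1r// pnatr_eq0.
by apply: contraTneq isT => q0; move: Kq; rewrite q0 mul0n.
Qed.
End UniformNat.

Section Splitting.
Context {R : realType} {d1 d2 : measure_display}
  {T1 : measurableType d1} {T2 : measurableType d2}.
Variables (P : probability (T1 * T2)%type R) (n n' : nat) (r : T1 -> 'I_n) (s : T2 -> 'I_n').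
Hypotheses (mr : mfibers r) (ms : mfibers s).
Variable T : nat.

Let row := rowpr P r s.
Let col := colpr P r s.
Let cell := cell_pr P r s.

(* Each cell of Alice's partition is split uniformly at random into enough pieces
   for every piece to have probability at most [2 ^- T]. *)
Definition pieces i : nat := (Num.truncn (2 ^+ T * row i)).+1.
Let M := (\max_i pieces i)%N.
Let K := (\prod_i pieces i)%N.-1.
Let U : probability nat R := uniform_nat K.

Definition piece (zu : T1 * nat) : 'I_n * 'I_M.+1 :=
  (r zu.1, inord (zu.2 %% pieces (r zu.1))).

Let piecesM i : (pieces i <= M)%N.
Proof. exact: leq_bigmax. Qed.

Let dvdn_piecesK i : (pieces i %| K.+1)%N.
Proof.
rewrite prednK; first by rewrite (bigD1 i)//= dvdn_mulr.
by rewrite prodn_gt0.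
Qed.

Definition piece_pr i (k : 'I_M.+1) : R := if (k < pieces i)%N then (pieces i)%:R^-1 else 0.

Let inord_mod i u : (inord (u %% pieces i) : 'I_M.+1) = (u %% pieces i)%N :> nat.
Proof.
by rewrite inordK// ltnS (leq_trans _ (piecesM i))// ltnW// ltn_mod.
Qed.

Lemma piece_prE i k : fine (U [set u | inord (u %% pieces i) = k :> 'I_M.+1]) = piece_pr i k.
Proof.
rewrite /piece_pr; case: ifPn => kp.
  rewrite -(uniform_nat_mod (dvdn_piecesK i) kp); congr (fine (U _)).
  apply/seteqP; split => u /=; first by move=> <-; rewrite inord_mod.
  by move=> h; apply/val_inj; rewrite /= inord_mod.
rewrite (_ : [set _ | _] = set0) ?measure0//; apply/seteqP; split => u //= h.
by move: kp; rewrite -h inord_mod ltn_mod.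
Qed.

(** F 0 = 0 discards the indices beyond the number of pieces of the cell. *)
Lemma sum_piece_pr i (F : R -> R) : F 0 = 0 ->
  \sum_k F (piece_pr i k) = (pieces i)%:R * F (pieces i)%:R^-1.
Proof.
move=> F0; rewrite (eq_bigr (fun k : 'I_M.+1 => if (k < pieces i)%N then F (pieces i)%:R^-1 else 0)).
  rewrite -big_mkcond/= (big_ord_narrow (leqW (piecesM i))).
  by rewrite sumr_const card_ord mulr_natl.
by move=> k _; rewrite /piece_pr; case: ifP.
Qed.

Lemma piece_fibers : mfibers piece.
Proof.
move=> -[i k]; rewrite (_ : fiber _ _ =
    fiber r i `*` [set u | inord (u %% pieces i) = k :> 'I_M.+1]).
  exact: measurableX (mr i) _.
apply/seteqP; split => -[z u]; first by rewrite /fiber/= => -[<- <-].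
by rewrite /fiber/= => -[<- <-].
Qed.

Let p := law P U piece s.

Lemma law_piece i k j : p (i, k) j = cell i j * piece_pr i k.
Proof.
rewrite /p /law.
have mA : measurable [set xu : T1 * nat | piece (xu.1, xu.2) = (i, k)].
  by rewrite (_ : [set _ | _] = fiber piece (i, k)); [exact: piece_fibers|apply/seteqP; split => -[]].
have mB : measurable [set yv : T2 * nat | s yv.1 = j].
  rewrite -[X in measurable X]setTI.
  exact: (measurable_fst measurableT _ (ms j)).
rewrite (sk_pr_rect P U U mA (B := fun z _ => s z = j) mB) /expect.
have e1 z : slice_pr U (fun z u => piece (z, u) = (i, k)) z = (r z == i)%:R * piece_pr i k.
  rewrite /slice_pr; have [rz|rz] := eqVneq (r z) i.
    rewrite mul1r -piece_prE; congr (fine (U _)); apply/seteqP; split => u.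
      by rewrite /piece/= rz => -[].
    by rewrite /piece/= rz => ->.
  rewrite mul0r (_ : [set _ | _] = set0) ?measure0//.
  by apply/seteqP; split => u //= -[] /eqP; rewrite (negbTE rz).
have e2 z : slice_pr U (fun z _ => s z = j) z = (s z == j)%:R.
  rewrite /slice_pr; have [sz|sz] := eqVneq (s z) j.
    by rewrite (_ : [set _ | _] = setT) ?probability_setT//; apply/seteqP; split.
  rewrite (_ : [set _ | _] = set0) ?measure0//.
  by apply/seteqP; split => u //= /eqP; rewrite (negbTE sz).
under eq_integral do rewrite e1 e2.
rewrite (cell_integral P mr ms (g := fun i' j' => (i' == i)%:R * piece_pr i k * (j' == j)%:R))/=; last first.
  by move=> i' j'; rewrite !mulr_ge0// /piece_pr; case: ifP.
rewrite (bigD1 i)//= [X in _ + X]big1 ?addr0; last first.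
  by move=> i' /negbTE ii; rewrite big1// => j' _; rewrite ii !mul0r.
rewrite (bigD1 j)//= [X in _ + X]big1 ?addr0; last first.
  by move=> j' /negbTE jj; rewrite jj mulr0 mul0r.
by rewrite !eqxx mul1r mulr1 mulrC.
Qed.

Let row0 i : 0 <= row i.
Proof. by apply: sumr_ge0 => j _; exact: cell_pr_ge0. Qed.

Let pieces_gt i : 2 ^+ T * row i < (pieces i)%:R.
Proof.
by have /andP[_] := truncn_itv (mulr_ge0 (exprn_ge0 T (ler0n R 2)) (row0 i)).
Qed.

Let pieces_le i : (pieces i)%:R <= 2 ^+ T * row i + 1.
Proof.
rewrite /pieces -natr1 lerD2r.
by have /andP[] := truncn_itv (mulr_ge0 (exprn_ge0 T (ler0n R 2)) (row0 i)).
Qed.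

Lemma law_piece_row x : \sum_j p x j <= (2 ^ T)%:R^-1.
Proof.
case: x => i k; under eq_bigr do rewrite law_piece.
rewrite -mulr_suml -/(rowpr P r s i) -/(row i) /piece_pr.
case: ifP => _; last by rewrite mulr0.
have T0 : 0 < 2 ^+ T :> R by rewrite exprn_gt0.
rewrite natrX ler_pdivrMr ?ltr0n// mulrC ler_pdivlMr// mulrC.
exact: ltW.
Qed.

Lemma law_piece_col j : \sum_x p x j = col j.
Proof.
rewrite (eq_bigr (fun x => cell x.1 j * piece_pr x.1 x.2)); last first.
  by move=> [i k] _; exact: law_piece.
rewrite -(pair_bigA _ (fun i k => cell i j * piece_pr i k))/=.
apply: eq_bigr => i _; rewrite -mulr_sumr (@sum_piece_pr i id)// divff ?mulr1//.
by rewrite pnatr_eq0.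
Qed.

Lemma density_log_piece : density_log p T =
  \sum_i \sum_j cell i j * log2 (2 ^+ T * (cell i j / (pieces i)%:R / col j)).
Proof.
rewrite /density_log -(pair_bigA _ (fun x j => p x j * log2 (2 ^+ T * (p x j / \sum_x' p x' j))))/=.
rewrite (eq_bigr (fun x => \sum_j cell x.1 j * piece_pr x.1 x.2 *
    log2 (2 ^+ T * (cell x.1 j * piece_pr x.1 x.2 / col j)))); last first.
  by move=> [i k] _; apply: eq_bigr => j _; rewrite law_piece law_piece_col.
rewrite -(pair_bigA _ (fun i k => \sum_j cell i j * piece_pr i k *
    log2 (2 ^+ T * (cell i j * piece_pr i k / col j))))/=.
apply: eq_bigr => i _; rewrite exchange_big/=; apply: eq_bigr => j _.
rewrite (@sum_piece_pr i (fun t => cell i j * t * log2 (2 ^+ T * (cell i j * t / col j)))).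
  rewrite mulrA; congr (_ * _); field.
  by rewrite pnatr_eq0.
by rewrite mulr0 mul0r.
Qed.

(** The number of pieces lies between 2^T row and twice that, so exchanging 1 / row for 2^T / pieces
    inside the logarithm costs at most one bit. *)
Lemma density_log_bounds : (forall i, row i = 0 \/ 1 <= 2 ^+ T * row i) ->
  qmi P r s - 1 <= density_log p T <= qmi P r s.
Proof.
move=> rT; rewrite density_log_piece (qmiE _ mr ms).
suff b i j : mi_term (cell i j) (row i) (col j) - cell i j <=
    cell i j * log2 (2 ^+ T * (cell i j / (pieces i)%:R / col j)) <=
    mi_term (cell i j) (row i) (col j).
  apply/andP; split; last first.
    by apply: ler_sum => i _; apply: ler_sum => j _; have /andP[] := b i j.
  rewrite -[X in _ - X](cell_pr_sum1 P mr ms) -sumrB; apply: ler_sum => i _.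
  by rewrite -sumrB; apply: ler_sum => j _; have /andP[] := b i j.
rewrite /mi_term; case: eqVneq => [->|c0]; first by rewrite mul0r subr0 lexx.
have cpos : 0 < cell i j by rewrite lt0r c0 cell_pr_ge0.
have nz : row i * col j != 0.
  by apply: contraNneq c0 => /cell_pr_eq0 h; apply/eqP.
have /andP[ri cj] : (0 < row i) && (0 < col j).
  move: nz; rewrite mulf_eq0 negb_or !lt0r row0 !andbT => /andP[-> ->]/=.
  by apply: sumr_ge0 => k _; exact: cell_pr_ge0.
have T0 : 0 < 2 ^+ T :> R by rewrite exprn_gt0.
have m0 : (0 : R) < (pieces i)%:R by rewrite ltr0n.
have q0 : 0 < cell i j / (pieces i)%:R by rewrite divr_gt0.
rewrite -[X in _ - X]mulr1 -mulrBr !ler_pM2l//.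
rewrite (log2M T0 (divr_gt0 q0 cj)) (log2_div q0 cj) (log2_div cpos m0).
rewrite (log2_div cpos (mulr_gt0 ri cj)) (log2M ri cj).
have h1 : log2 (2 ^+ T * row i) <= log2 (pieces i)%:R by rewrite ler_log2 ?mulr_gt0// ltW.
have h2 : log2 (pieces i)%:R <= log2 (2 * (2 ^+ T * row i)).
  rewrite ler_log2//; apply: (le_trans (pieces_le i)).
  by case: (rT i) => [z|]; [rewrite z ltxx in ri|lra].
rewrite (log2M (ltr0n R 2) (mulr_gt0 T0 ri)) log2_2 (log2M T0 ri) in h2.
rewrite (log2M T0 ri) in h1.
by apply/andP; split; lra.
Qed.
End Splitting.

Section LowerBound.
Context {R : realType} {d1 d2 : measure_display}
  {T1 : measurableType d1} {T2 : measurableType d2}.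
Variables (P : probability (T1 * T2)%type R) (eps : R).
Hypotheses (eps0 : 0 < eps) (eps1 : eps < 1).

(** [good_scheme] with N = q + 1: the density lies between q - 1 and q = N - 1, so 12 = 11 + 1. *)
Lemma Lstar_ge_qmi n m (r : T1 -> 'I_n) (s : T2 -> 'I_m) :
  mfibers r -> mfibers s -> 1 <= qmi P r s ->
  ((qmi P r s - 3 * log2 (qmi P r s + 1) - 2 * log2 eps^-1 - 12)%:E <= Lstar P eps)%E.
Proof.
move=> mr ms q1; set q := qmi P r s in q1 *.
(* [T] dominates every t i > 1 / row, and 2^T > T; so 2^T row >= 1 on each cell of positive mass. *)
pose t i := (Num.truncn (rowpr P r s i)^-1).+1.
pose T := (\max_i t i)%N.
have rT i : rowpr P r s i = 0 \/ 1 <= 2 ^+ T * rowpr P r s i.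
  have : 0 <= rowpr P r s i by apply: sumr_ge0 => j _; exact: cell_pr_ge0.
  rewrite le_eqVlt => /orP[/eqP <-|ri]; first by left.
  right; rewrite -ler_pdivrMr// mul1r.
  have /andP[_ /ltW h] := truncn_itv (ltW (etrans (invr_gt0 _) ri)).
  apply: (le_trans h); rewrite -natrX ler_nat; apply: leq_trans (ltnW (ltn_expl T (ltnSn 1))).
  exact: (leq_bigmax i).
have /andP[D1 D2] := density_log_bounds mr ms rT.
have q2 : 2 <= q + 1 by lra.
pose U : probability nat R := uniform_nat (\prod_i pieces P r s T i)%N.-1.
have mphi : mfibers (piece P r s T) by exact: piece_fibers.
have pX x : \sum_y law P U (piece P r s T) s x y <= (2 ^ T)%:R^-1 by exact: law_piece_row.
have [H [_ hH]] := good_scheme (law_ge0 P U _ s) eps0 eps1 pX (law_sum1 P U mphi ms) q2.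
apply: le_trans (Lstar_ge_hash mphi ms H _ eps0 eps1 pX).
rewrite lee_fin; apply: (le_trans _ (hH _)); rewrite -/q in D1 D2 *; lra.
Qed.

Lemma mpartition_index {d} {T : measurableType d} (C : nat -> set T) k :
  finite_mpartition C k -> exists r : T -> 'I_k, forall i, fiber r i = C i.
Proof.
move=> [_ [dC cC]]; have cover x : exists i : 'I_k, C i x.
  have [i ik Ci] : (\bigcup_(i in [set j | (j < k)%N]) C i) x by rewrite cC.
  by exists (Ordinal (ik : (i < k)%N)).
have [r rP] := choice cover; exists r => i; apply/seteqP; split => x.
  by rewrite /fiber/= => <-.
move=> Cx; apply/eqP; apply: contraT => /eqP ri; exfalso.
suff : (C (r x) `&` C i) x by rewrite dC// => /val_inj.
by split => //; exact: rP.
Qed.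

Lemma quantized_mi_fiber A n B m :
  finite_mpartition A n -> finite_mpartition B m ->
  exists (r : T1 -> 'I_n) (s : T2 -> 'I_m),
    [/\ mfibers r, mfibers s & quantized_mi P A n B m = qmi P r s].
Proof.
move=> pA pB; have [r rA] := mpartition_index pA; have [s sB] := mpartition_index pB.
exists r, s; split.
- by move=> i; rewrite rA; apply: pA.1.
- by move=> j; rewrite sB; apply: pB.1.
rewrite /qmi /quantized_mi; apply: eq_bigr => i _; apply: eq_bigr => j _.
by rewrite !fiber_val rA sB.
Qed.

Lemma mutual_info_gt c : (c%:E < mutual_info P)%E ->
  exists n m (r : T1 -> 'I_n) (s : T2 -> 'I_m), [/\ mfibers r, mfibers s & c < qmi P r s].
Proof.
move=> /ereal_sup_gt[_ [A [n [B [m [pA pB ->]]]]]]; rewrite lte_fin => cq.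
have [r [s [mr ms E]]] := quantized_mi_fiber pA pB.
by exists n, m, r, s; rewrite -E.
Qed.

Let mfibers_cst {d} {T : measurableType d} : mfibers (fun _ : T => @ord0 0).
Proof. by move=> i; exact: measurable_prop. Qed.

Lemma mutual_info_ge0 : (0 <= mutual_info P)%E.
Proof.
apply: ereal_sup_ubound; exists (fiber (fun=> 0%N)), 1%N, (fiber (fun=> 0%N)), 1%N.
split; [exact: (fiber_partition mfibers_cst)|exact: (fiber_partition mfibers_cst)|].
have := qmiE P mfibers_cst mfibers_cst; rewrite /qmi/= => ->.
have := cell_pr_sum1 P mfibers_cst mfibers_cst.
by rewrite /rowpr /colpr !big_ord1 => ->; rewrite /mi_term oner_eq0 !mul1r invr1 log2_1.
Qed.

(** Any admissible scheme has nonnegative expected length; the protocol with one piece and T = 0 is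
    one. *)
Lemma Lstar_ge0 : (0 <= Lstar P eps)%E.
Proof.
pose U : probability nat R := uniform_nat 0.
have mA : mfibers (fun _ : T1 * nat => tt) by move=> i; exact: measurable_prop.
have mB : mfibers (fun _ : T2 => tt) by move=> i; exact: measurable_prop.
have row x : \sum_y law P U (fun=> tt) (fun=> tt) x y <= (2 ^ 0)%:R^-1.
  rewrite expn0 invr1 -(law_sum1 P U mA mB) -(pair_bigA _ (law P U (fun=> tt) (fun=> tt)))/=.
  by rewrite [leRHS](bigD1 x)//= lerDl; apply: sumr_ge0 => z _; apply: sumr_ge0 => y _; exact: law_ge0.
apply: le_trans (Lstar_ge_hash mA mB (fun=> 0%N) (fun _ _ => xpred0) eps0 eps1 row).
by rewrite lee_fin; apply: sumr_ge0 => xy _; rewrite mulr_ge0// law_ge0.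
Qed.
End LowerBound.

Theorem theorem1 (R : realType) (d1 d2 : measure_display)
    (T1 : measurableType d1) (T2 : measurableType d2)
    (P : probability (T1 * T2)%type R) (eps : R) (heps0 : 0 < eps) (heps1 : eps < 1) :
  (forall I : R, mutual_info P = I%:E ->
     ((I - 3 * log2 (I + 1) - 2 * log2 (1 / eps) - 15)%:E <= Lstar P eps)%E /\
     (Lstar P eps <= ((1 - eps)^-1 * (I + log2 3 + 1))%:E)%E) /\
  (mutual_info P = +oo%E -> Lstar P eps = +oo%E).
Proof.
have le : 0 <= log2 eps^-1 by rewrite log2_ge0// invf_ge1// ltW.
rewrite div1r; split.
  move=> I PI; split; last exact: Lstar_le (ltW heps0) heps1 PI.
  have I0 : 0 <= I by have := mutual_info_ge0 P; rewrite PI lee_fin.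
  have lI : 0 <= log2 (I + 1) by rewrite log2_ge0// lerDr.
  (* For I < 2 the right-hand side is negative. *)
  have [I2|I2] := ltP I 2.
    by apply: le_trans (Lstar_ge0 P heps0 heps1); rewrite lee_fin; lra.
  (* A quantisation within one bit of I is enough, since 1 + 12 <= 15; I >= 2 makes its information
     at least 1. *)
  have [n [m [r [s [mr ms qI]]]]] : exists n m (r : T1 -> 'I_n) (s : T2 -> 'I_m),
      [/\ mfibers r, mfibers s & I - 1 < qmi P r s].
    by apply: mutual_info_gt; rewrite PI lte_fin gtrBl.
  have q1 : 1 <= qmi P r s by lra.
  apply: le_trans (Lstar_ge_qmi heps0 heps1 mr ms q1); rewrite lee_fin.
  have : log2 (qmi P r s + 1) <= log2 (I + 1).
    rewrite ler_log2//; first lra.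
    by rewrite lerD2r; exact: qmi_le.
  lra.
move=> Poo; apply/eqyP => A A0.
(* Three times the logarithm will cost at most 3 (q + 1) / 8 + 12; with the 12 of [Lstar_ge_qmi]
   this makes 24, and the factor 2 absorbs the 3/8. *)
pose c := 2 * (A + 2 * log2 eps^-1 + 24) + 1.
have [n [m [r [s [mr ms qc]]]]] : exists n m (r : T1 -> 'I_n) (s : T2 -> 'I_m),
    [/\ mfibers r, mfibers s & c < qmi P r s].
  by apply: mutual_info_gt; rewrite Poo ltry.
have q1 : 1 <= qmi P r s by rewrite /c in qc; lra.
apply: le_trans (Lstar_ge_qmi heps0 heps1 mr ms q1); rewrite lee_fin.
set q := qmi P r s in qc q1 *.
have q16 : 0 < (q + 1) / 16 by rewrite divr_gt0//; lra.
(* ln z <= z - 1 at z = (q + 1) / 16, divided by ln 2 >= 1/2. *)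
have : log2 (q + 1) <= (q + 1) / 8 + 4.
  rewrite /log2 ler_pdivrMr ?ln2_gt0//.
  have -> : q + 1 = (q + 1) / 16 * 2 ^+ 4 by field.
  rewrite lnM ?posrE ?exprn_gt0// lnXn// -[ln 2 *+ 4]mulr_natl.
  have := ln_leB1 q16; have := @ln2_ge R; set z := (q + 1) / 16 in q16 *.
  move: (ln 2) (ln z) => a b a2 bz; nra.
rewrite /c in qc; lra.
Qed.
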